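(* Let $X_i$, $i=1,\ldots,n$, be $(n-1)$-independent non-constant random variables (with values in $\mathbb{R}^{d_i}$) and let $\boldsymbol{X}^{(k)}$, $k=1,\ldots,N$, be independent copies of $(X_1,\ldots,X_n)$. Suppose that either all $\psi_i$ are bounded, or for all $i=1,\ldots,n$: $\mathbb{E}(\psi_i(X_i))<\infty$ and $\mathbb{E}\bigl[(\log(1+|X_i|^2))^{1+\varepsilon}\bigr]<\infty$ for some $\varepsilon>0$. Then for any $\beta\in(0,1)$, almost everywhere as $N\to\infty$, $$N^\beta\cdot{}^{N}\mathcal{M}^2(\boldsymbol{X}^{(1)},\ldots,\boldsymbol{X}^{(N)})\to\begin{cases}\infty,&\text{if }X_1,\ldots,X_n\text{ are dependent},\\0,&\text{if }X_1,\ldots,X_n\text{ are independent}.\end{cases}$$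
   Context: Setting. $n\ge2$. For $i=1,\ldots,n$ let $\rho_i$ be a symmetric measure on $\mathbb{R}^{d_i}$ with full topological support (i.e. $\rho_i(O)>0$ for all nonempty open $O$) and $\int 1\wedge|t_i|^2\,\rho_i(dt_i)<\infty$, and let $\psi_i(y)=\int_{\mathbb{R}^{d_i}\setminus\{0\}}(1-\cos(y\cdot t))\,\rho_i(dt)$ for $y\in\mathbb{R}^{d_i}$. For samples $\boldsymbol{x}^{(k)}=(x_1^{(k)},\ldots,x_n^{(k)})\in\mathbb{R}^{d_1}\times\cdots\times\mathbb{R}^{d_n}$, $k=1,\ldots,N$, let $A_i=-CB_iC$ with $B_i=(\psi_i(x_i^{(j)}-x_i^{(k)}))_{j,k=1,\ldots,N}$ and $C=(\delta_{jk}-\frac1N)_{j,k=1,\ldots,N}$; let ${}^{N}a_i=\frac1{N^2}\sum_{j,k=1}^N\psi_i(x_i^{(j)}-x_i^{(k)})$ and $\mathcal{A}_i=A_i/{}^{N}a_i$ if ${}^{N}a_i>0$, $\mathcal{A}_i=0$ if ${}^{N}a_i=0$. Normalized sample multivariance is $${}^{N}\mathcal{M}^2(\boldsymbol{x}^{(1)},\ldots,\boldsymbol{x}^{(N)})=\frac1{N^2}\sum_{j,k=1}^N\prod_{i=1}^n(\mathcal{A}_i)_{jk}.$$ Random variables $X_1,\ldots,X_n$ are $m$-independent if $X_{i_1},\ldots,X_{i_m}$ are independent for any distinct $i_1,\ldots,i_m\in\{1,\ldots,n\}$. Dependent means not independent. *)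

(* Defs.v *)
From HB Require Import structures.
From mathcomp Require Import all_boot all_order all_algebra.
From mathcomp Require Import finmap.
From mathcomp Require Import all_classical all_reals all_analysis.

Set Implicit Arguments.
Unset Strict Implicit.
Unset Printing Implicit Defensive.

Import Order.TTheory GRing.Theory Num.Theory.
Import numFieldNormedType.Exports.

Local Open Scope classical_set_scope.
Local Open Scope ring_scope.

(* R^d is 'rV[R]_d; [borelE R d] is the same carrier with its Borel
   sigma-algebra, the one generated by the open sets. *)
Notation borelE R d := (g_sigma_algebraType (@open 'rV[R]_d)).

(* The norm that the library puts on 'rV[R]_d is the sup norm, hence the
   explicit inner product and Euclidean norm. *)
Definition edot (R : realType) (d : nat) (y t : 'rV[R]_d) : R :=
  \sum_(j < d) y ord0 j * t ord0 j.

Definition enorm (R : realType) (d : nat) (t : 'rV[R]_d) : R :=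
  Num.sqrt (edot t t).

Section Measures.
Context (R : realType) (d : nat) (rho : {measure set (borelE R d) -> \bar R}).

Definition symmetric_measure :=
  forall A : set (borelE R d), measurable A ->
    rho ((fun t : 'rV[R]_d => - t) @^-1` A) = rho A.

Definition full_support :=
  forall O : set 'rV[R]_d, open O -> O !=set0 -> (0 < rho O)%E.

Definition levy_integrable :=
  (\int[rho]_t (Num.min 1 (enorm t ^+ 2))%:E < +oo)%E.

(* Real-valued integral; it is finite under [levy_integrable]. *)
Definition cndf (y : 'rV[R]_d) : R :=
  \int[rho]_(t in ~` [set (0 : 'rV[R]_d)]) (1 - cos (edot y t)).

End Measures.

Section ProductSpace.
Context (R : realType) (n : nat) (d : 'I_n -> nat).

Definition cylinders : set (set (forall i, borelE R (d i))) :=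
  \bigcup_(i in [set: 'I_n])
    preimage_set_system setT (fun x : forall i, borelE R (d i) => x i) measurable.

End ProductSpace.

(* R^(d_1) x ... x R^(d_n) with the product sigma-algebra. *)
Notation prodE R d := (g_sigma_algebraType (@cylinders R _ d)).

Section Probability.
Context (dO : measure_display) (Omega : measurableType dO) (R : realType)
  (P : probability Omega R).

Definition mutually_independent (I : choiceType) (dT : I -> measure_display)
    (T : forall i, measurableType (dT i)) (X : forall i, {RV P >-> T i}) :=
  forall (J : {fset I}) (A : forall i, set (T i)),
    (forall i, measurable (A i)) ->
    P (\bigcap_(i in [set` J]) (X i @^-1` A i)) =
    (\prod_(i <- J) fine (P (X i @^-1` A i)))%:E.

Definition m_independent (m n : nat) (dT : 'I_n -> measure_display)
    (T : forall i, measurableType (dT i)) (X : forall i, {RV P >-> T i}) :=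
  forall s : 'I_m -> 'I_n, injective s ->
    mutually_independent (fun j => X (s j)).

Definition same_law (dT : measure_display) (T : measurableType dT)
    (X Y : {RV P >-> T}) :=
  forall A : set T, measurable A -> distribution P X A = distribution P Y A.

Definition ae_constant (dT : measure_display) (T : measurableType dT)
    (X : {RV P >-> T}) :=
  exists c : T, {ae P, forall w, X w = c}.

Section Joint.
Context (n : nat) (d : 'I_n -> nat) (X : forall i, {RV P >-> borelE R (d i)}).

Definition joint : Omega -> prodE R d := fun w i => X i w.

Lemma measurable_joint : measurable_fun setT joint.
Proof.
apply: (@measurability _ _ _ _ setT joint (cylinders (d := d))) => //.
move=> _ [_ [i _ [B mB <-]] <-].
rewrite !setTI (_ : _ @^-1` _ = X i @^-1` B) //.
by rewrite -[_ @^-1` _]setTI; exact: (measurable_funPT (X i)).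
Qed.

HB.instance Definition _ := isMeasurableFun.Build _ _ _ _ joint measurable_joint.

End Joint.

End Probability.

Section Multivariance.
Context (R : realType) (n : nat) (d : 'I_n -> nat)
  (psi : forall i, 'rV[R]_(d i) -> R)
  (N : nat) (x : 'I_N -> forall i, 'rV[R]_(d i)).

Definition distmx (i : 'I_n) : 'M[R]_N :=
  \matrix_(j, k) psi (x j i - x k i).

Definition centmx : 'M[R]_N := \matrix_(j, k) ((j == k)%:R - N%:R^-1).

Definition cdistmx (i : 'I_n) : 'M[R]_N := - (centmx *m distmx i *m centmx).

Definition mean_psi (i : 'I_n) : R :=
  (N%:R ^+ 2)^-1 * \sum_(j < N) \sum_(k < N) psi (x j i - x k i).

Definition ncdistmx (i : 'I_n) : 'M[R]_N :=
  if 0 < mean_psi i then (mean_psi i)^-1 *: cdistmx i else 0.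

(* The quantity written M^2 (normalized sample multivariance); M itself is
   never needed. *)
Definition multivariance2 : R :=
  (N%:R ^+ 2)^-1 * \sum_(j < N) \sum_(k < N) \prod_(i < n) ncdistmx i j k.

End Multivariance.

(* Main.v *)
Require Import Defs.
From HB Require Import structures.
From mathcomp Require Import all_boot all_order all_algebra.
From mathcomp Require Import finmap.
From mathcomp Require Import all_classical all_reals all_analysis.
From mathcomp Require Import measurable_realfun.
From mathcomp Require Import ring lra.

Set Implicit Arguments.
Unset Strict Implicit.
Unset Printing Implicit Defensive.

Import Order.TTheory GRing.Theory Num.Theory.
Import numFieldNormedType.Exports.

Local Open Scope classical_set_scope.
Local Open Scope ring_scope.

(* Each psi_i is a mixture of the functions 1 - cos(y . t), so -psi_i is
   conditionally positive definite and the centred distance matrices A_i are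
   positive semidefinite.  Sample multivariance is thus a mean of positive
   semidefinite kernels divided by the product of the means N_a_i.

   Independent case: subtracting means turns -psi_i into a positive
   semidefinite kernel K_i whose integral in either variable vanishes, and
   A_i <= 2 K_i + 2 q_i 11^T with q_i the sample mean of K_i.  By Schur's
   product theorem the mean of prod_i A_i is at most the mean of the product of
   the right-hand sides, a sum of products of sample means of degenerate
   kernels.  By a Rademacher-Menshov argument those are o(N^-beta), whereas
   every N_a_i stays away from 0 because X_i is not constant.

   Dependent case: averages h_i of waves cos(x . t), sin(x . t) over sets of
   frequencies satisfy h_i h_i <= C_i (-psi_i) as conditional kernels, so the
   mean of prod_i A_i dominates a multiple of the square of the empirical mean of
   prod_i (h_i - mean h_i).  By full support such h_i generate all bounded Borel
   functions under bounded pointwise limits; hence, (n-1)-independence leaving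
   only the top-order mixed moment, dependence makes E prod_i (h_i - E h_i)
   nonzero for some choice of the h_i.  Finally N_a_i grows slower than any power
   of N, because psi_i is integrable and psi_i(x - y) <= 2 psi_i(x) + 2 psi_i(y). *)

(** * Positive semidefinite kernels *)

Section PsdKernels.
Context (R : realFieldType).

(** When psi_i is unbounded only its integrability is at hand, so the double means have no usable
    variance. The geometry of kernels replaces it: if k (x, y) is an inner product of feature
    vectors, the double mean of k is the squared norm of a mean of vectors, and integrability of k
    (x, x) is a second moment of these vectors. Vanishing integrals make the vectors of distinct
    sample points orthogonal in mean, and the almost sure rate needs no more than that. No Hilbert
    space is built: quadratic forms over finite lists stand in for it. Through the centring the
    entries of A_i depend on the whole sample, so their products are no fixed kernel evaluated at
    pairs of sample points. The comparisons with fixed kernels and rank one matrices are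
    inequalities between positive semidefinite forms; these survive entrywise products, and summing
    all entries is testing with the vector of ones. A single frequency may have mass 0 under rho_i,
    and the mass near the origin may be infinite; averages over small balls away from the origin
    avoid both. *)

Definition qform (I : Type) (K : I -> I -> R) (s : seq (R * I)) : R :=
  \sum_(p <- s) \sum_(q <- s) p.1 * q.1 * K p.2 q.2.

(** Points may be repeated in the list, so the property is stable under composition with an
    arbitrary map, injective or not. *)
Definition psd (I : Type) (K : I -> I -> R) :=
  (forall x y, K x y = K y x) /\ forall s, 0 <= qform K s.

Lemma qform_map (I J : Type) (K : I -> I -> R) (r : seq J) (a : J -> R)
    (x : J -> I) :
  qform K [seq (a j, x j) | j <- r] =
  \sum_(j <- r) \sum_(k <- r) a j * a k * K (x j) (x k).
Proof.
by rewrite /qform big_map; apply: eq_bigr => j _; rewrite big_map.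
Qed.

Lemma psd_sum_ge0 (I J : Type) (K : I -> I -> R) (r : seq J) (a : J -> R)
    (x : J -> I) :
  psd K -> 0 <= \sum_(j <- r) \sum_(k <- r) a j * a k * K (x j) (x k).
Proof. by move=> [_ K0]; rewrite -qform_map. Qed.

Lemma psd_comp (I J : Type) (f : J -> I) (K : I -> I -> R) :
  psd K -> psd (fun x y => K (f x) (f y)).
Proof. by move=> psdK; split=> [x y|s]; 
  [case: psdK | exact: (psd_sum_ge0 s fst (f \o snd))]. Qed.

Lemma eq_psd (I : Type) (K L : I -> I -> R) :
  (forall x y, K x y = L x y) -> psd K -> psd L.
Proof.
move=> KL [symK psdK]; split=> [x y|s]; first by rewrite -!KL.
rewrite (le_trans (psdK s))// le_eqVlt; apply/orP; left; apply/eqP.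
by apply: eq_bigr => p _; apply: eq_bigr => q _; rewrite KL.
Qed.

Lemma psd_add (I : Type) (K L : I -> I -> R) :
  psd K -> psd L -> psd (fun x y => K x y + L x y).
Proof.
move=> [sK pK] [sL pL]; split=> [x y|s]; first by rewrite sK sL.
rewrite (_ : qform _ _ = qform K s + qform L s) ?addr_ge0//.
rewrite /qform -big_split; apply: eq_bigr => p _ /=.
by rewrite -big_split; apply: eq_bigr => q _ /=; rewrite mulrDr.
Qed.

Lemma psd_scale (I : Type) (K : I -> I -> R) (c : R) :
  0 <= c -> psd K -> psd (fun x y => c * K x y).
Proof.
move=> c0 [sK pK]; split=> [x y|s]; first by rewrite sK.
rewrite (_ : qform _ _ = c * qform K s) ?mulr_ge0//.
rewrite /qform mulr_sumr; apply: eq_bigr => p _; rewrite mulr_sumr.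
by apply: eq_bigr => q _; ring.
Qed.

Lemma psd_rank1 (I : Type) (f : I -> R) : psd (fun x y => f x * f y).
Proof.
split=> [x y|s]; first by rewrite mulrC.
rewrite (_ : qform _ _ = (\sum_(p <- s) p.1 * f p.2) ^+ 2) ?sqr_ge0//.
rewrite /qform expr2 mulr_suml; apply: eq_bigr => p _; rewrite mulr_sumr.
by apply: eq_bigr => q _; ring.
Qed.

Lemma psd_cst (I : Type) (c : R) : 0 <= c -> psd (fun _ _ : I => c).
Proof.
move=> c0; apply: eq_psd (psd_scale c0 (psd_rank1 (fun _ => 1))) => x y /=.
by rewrite !mulr1.
Qed.

Lemma psd_diag_ge0 (I : Type) (K : I -> I -> R) x : psd K -> 0 <= K x x.
Proof.
by move=> [_ /(_ [:: (1, x)])]; rewrite /qform !big_seq1 /= !mul1r.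
Qed.

Lemma psd_pair (I : Type) (K : I -> I -> R) (a b : R) x y : psd K ->
  0 <= a ^+ 2 * K x x + 2 * a * b * K x y + b ^+ 2 * K y y.
Proof.
move=> [sK /(_ [:: (a, x); (b, y)])]; rewrite /qform !big_cons !big_nil /=.
by rewrite (sK y x) !addr0 => /le_trans; apply; rewrite le_eqVlt; apply/orP;
  left; apply/eqP; ring.
Qed.

Lemma psd_normr_le (I : Type) (K : I -> I -> R) x y : psd K ->
  `|K x y| <= (K x x + K y y) / 2.
Proof.
move=> pK; have := psd_pair 1 1 x y pK; have := psd_pair 1 (-1) x y pK.
rewrite ler_norml !expr2 => h1 h2; apply/andP; split; lra.
Qed.

Lemma psd_diag0 (I : Type) (K : I -> I -> R) x y : psd K ->
  K x x = 0 -> K x y = 0.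
Proof.
move=> pK Kx0; apply/eqP; apply: contraT => Kxy0.
(* With [K x x = 0] the form is affine in the weight of [x]; this weight gives it the value -1. *)
have := psd_pair (- (K y y + 1) / (2 * K x y)) 1 x y pK.
rewrite Kx0 mulr0 add0r expr1n mul1r mulr1.
rewrite (_ : _ * K x y = - (K y y + 1)); first lra.
by field; rewrite Kxy0.
Qed.

(** Since [0^-1 = 0], the complement is [K] itself if [K o o = 0]; by [psd_diag0] such a [K] already
    vanishes at [o]. *)
Definition schur (I : Type) (K : I -> I -> R) (o : I) x y : R :=
  K x y - K x o * K o y / K o o.

Lemma psd_schur (I : Type) (K : I -> I -> R) (o : I) :
  psd K -> psd (schur K o).
Proof.
move=> pK; have [sK qK] := pK; split=> [x y|s].
  by rewrite /schur (sK x y) (sK x o) (sK o y); ring.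
have [K0|K0] := eqVneq (K o o) 0.
  rewrite (le_trans (qK s))// le_eqVlt; apply/orP; left; apply/eqP.
  apply: eq_bigr => p _; apply: eq_bigr => q _.
  by rewrite /schur K0 invr0 mulr0 subr0.
pose S := \sum_(p <- s) p.1 * K p.2 o.
(* This weight of [o] minimises the form of [K], and the minimum is the form of the Schur
   complement. *)
have := qK ((- S / K o o, o) :: s); rewrite {1}/qform big_cons /= big_cons /=.
under [X in _ + X]eq_bigr do rewrite big_cons /=.
rewrite big_split /= -/(qform K s).
rewrite (_ : \sum_(j <- s) _ = - S / K o o * S); last first.
  rewrite mulr_sumr; apply: eq_bigr => p _; rewrite (sK o); ring.
rewrite (_ : \sum_(i <- s) _ = - S / K o o * S); last first.
  rewrite mulr_sumr; apply: eq_bigr => p _; ring.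
move/le_trans; apply; rewrite le_eqVlt; apply/orP; left; apply/eqP.
have -> : qform (schur K o) s = qform K s - S * S / K o o.
  have -> : S * S / K o o = \sum_(p <- s) \sum_(q <- s)
      p.1 * q.1 * (K p.2 o * K o q.2 / K o o).
    rewrite -mulrA {1}/S mulr_suml; apply: eq_bigr => p _.
    rewrite [S / _]mulr_suml mulr_sumr; apply: eq_bigr => q _.
    by rewrite (sK o q.2); ring.
  rewrite /qform -sumrB; apply: eq_bigr => p _; rewrite -sumrB.
  by apply: eq_bigr => q _; rewrite /schur mulrBr.
by field.
Qed.

(* Schur's product theorem, by induction on the points: the Schur complement
   of K at the first point vanishes on it, and K differs from it by a kernel
   of rank one. *)
Lemma psd_mul (I : Type) (K L : I -> I -> R) :
  psd K -> psd L -> psd (fun x y => K x y * L x y).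
Proof.
move=> pK pL; split=> [x y|s]; first by case: pK => ->; case: pL => ->.
elim: s => [|[a o] s IH] in K pK *; first by rewrite /qform big_nil.
have pS := psd_schur o pK; have [sK _] := pK; have [sS _] := pS.
have S0 y : schur K o o y = 0.
  rewrite /schur; have [K0|K0] := eqVneq (K o o) 0; last by field.
  by rewrite (psd_diag0 y pK K0) (psd_diag0 o pK K0) !mul0r subr0.
pose v x := K x o.
have -> : qform (fun x y => K x y * L x y) ((a, o) :: s) =
    qform (fun x y => schur K o x y * L x y) s +
    (K o o)^-1 * qform (fun x y => v x * v y * L x y) ((a, o) :: s).
  transitivity (qform (fun x y => schur K o x y * L x y) ((a, o) :: s) +
      (K o o)^-1 * qform (fun x y => v x * v y * L x y) ((a, o) :: s)).
    rewrite /qform mulr_sumr -big_split; apply: eq_bigr => p _.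
    rewrite mulr_sumr -big_split; apply: eq_bigr => q _ /=.
    by rewrite /schur /v (sK o q.2); ring.
  congr (_ + _); rewrite /qform big_cons /= big1 ?add0r; last first.
    by move=> q _; rewrite S0 mul0r mulr0.
  by apply: eq_bigr => p _; rewrite big_cons /= sS S0 mul0r mulr0 add0r.
rewrite addr_ge0 ?IH// mulr_ge0 ?invr_ge0 ?psd_diag_ge0//.
rewrite (_ : qform _ _ = qform L [seq (p.1 * v p.2, p.2) | p <- (a, o) :: s]).
  by case: pL => _; apply.
rewrite qform_map; apply: eq_bigr => p _; apply: eq_bigr => q _; ring.
Qed.

Lemma psd_prod (I J : Type) (r : seq J) (K : J -> I -> I -> R) :
  (forall j, psd (K j)) -> psd (fun x y => \prod_(j <- r) K j x y).
Proof.
move=> pK; elim: r => [|j r IH].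
  by apply: eq_psd (@psd_cst I 1 ler01) => x y; rewrite big_nil.
by apply: eq_psd (psd_mul (pK j) IH) => x y; rewrite big_cons.
Qed.

(** Exchanging one factor at a time leaves [L j - K j] times factors [L], plus [K j] times the
    difference for the remaining indices; Schur's theorem applies to both summands. This
    monotonicity in the Loewner order carries both the upper and the lower bound on the sample
    mean. *)
Lemma psd_prodB (I J : Type) (r : seq J) (K L : J -> I -> I -> R) :
  (forall j, psd (K j)) -> (forall j, psd (fun x y => L j x y - K j x y)) ->
  psd (fun x y => \prod_(j <- r) L j x y - \prod_(j <- r) K j x y).
Proof.
move=> pK pKL.
have pL j : psd (L j).
  by apply: eq_psd (psd_add (pK j) (pKL j)) => x y; rewrite subrKC.
elim: r => [|j r IH].
  by apply: eq_psd (@psd_cst I 0 (lexx 0)) => x y; rewrite !big_nil subrr.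
apply: eq_psd (psd_add (psd_mul (pKL j) (psd_prod r pL))
  (psd_mul (pK j) IH)) => x y.
by rewrite !big_cons; ring.
Qed.

End PsdKernels.

(** * Conditionally positive definite kernels and sample centring *)

Section Centring.
Context (R : realFieldType).

Definition cpd (I : Type) (K : I -> I -> R) :=
  (forall x y, K x y = K y x) /\
  forall s : seq (R * I), \sum_(p <- s) p.1 = 0 -> 0 <= qform K s.

(** The matrix product d K d^T; for [d = cent] it is C K C. *)
Definition conjk (N : nat) (d K : 'I_N -> 'I_N -> R) (j k : 'I_N) : R :=
  \sum_(p < N) \sum_(q < N) d j p * d k q * K p q.

Definition cent (N : nat) (j p : 'I_N) : R := (j == p)%:R - N%:R^-1.

Lemma sum_pred1 (N : nat) (j : 'I_N) (f : 'I_N -> R) :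
  \sum_(p < N) (j == p)%:R * f p = f j.
Proof.
rewrite (bigD1 j)//= eqxx mul1r big1 ?addr0// => p pj.
by rewrite eq_sym (negbTE pj) mul0r.
Qed.

Lemma sum_cent_mul (N : nat) (j : 'I_N) (f : 'I_N -> R) :
  \sum_(p < N) cent j p * f p = f j - N%:R^-1 * \sum_(p < N) f p.
Proof.
rewrite mulr_sumr -[in RHS](sum_pred1 j f) -sumrB.
by apply: eq_bigr => p _; rewrite mulrBl.
Qed.

Lemma sum_cent (N : nat) (j : 'I_N) : \sum_(p < N) cent j p = 0.
Proof.
have := sum_cent_mul j (fun _ => 1); under eq_bigr do rewrite mulr1.
move=> ->; rewrite sumr_const card_ord mulVf ?subrr// pnatr_eq0.
by case: N j => // -[].
Qed.

Lemma qform_conjk (N : nat) (d K : 'I_N -> 'I_N -> R) s :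
  qform (conjk d K) s =
  qform K [seq (\sum_(a <- s) a.1 * d a.2 p, p) | p <- index_enum 'I_N].
Proof.
rewrite qform_map /qform.
transitivity (\sum_(a <- s) \sum_(p < N) \sum_(b <- s) \sum_(q < N)
    a.1 * b.1 * (d a.2 p * d b.2 q * K p q)).
  apply: eq_bigr => a _; rewrite exchange_big; apply: eq_bigr => b _.
  by rewrite /conjk mulr_sumr; apply: eq_bigr => p _; rewrite mulr_sumr.
rewrite exchange_big; apply: eq_bigr => p _ /=.
transitivity (\sum_(a <- s) \sum_(q < N) \sum_(b <- s)
    a.1 * b.1 * (d a.2 p * d b.2 q * K p q)).
  by apply: eq_bigr => a _; rewrite exchange_big.
rewrite exchange_big; apply: eq_bigr => q _ /=.
rewrite -mulrA mulr_suml; apply: eq_bigr => a _.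
by rewrite mulr_suml mulr_sumr; apply: eq_bigr => b _; ring.
Qed.

Lemma conjkC (N : nat) (d K : 'I_N -> 'I_N -> R) :
  (forall p q, K p q = K q p) -> forall j k, conjk d K j k = conjk d K k j.
Proof.
move=> sK j k; rewrite /conjk exchange_big /=; apply: eq_bigr => p _.
by apply: eq_bigr => q _; rewrite sK; ring.
Qed.

Lemma psd_conjk (N : nat) (d K : 'I_N -> 'I_N -> R) :
  psd K -> psd (conjk d K).
Proof.
move=> [sK pK]; split; first exact: conjkC.
by move=> s; rewrite qform_conjk.
Qed.

(** Weights pushed through [cent] have sum 0, because each row of [cent] does. *)
Lemma cpd_conjk_cent (N : nat) (K : 'I_N -> 'I_N -> R) :
  cpd K -> psd (conjk (@cent N) K).
Proof.
move=> [sK pK]; split; first exact: conjkC.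
move=> s; rewrite qform_conjk; apply: pK; rewrite big_map /= exchange_big /=.
by rewrite big1// => a _; rewrite -mulr_sumr sum_cent mulr0.
Qed.

Lemma cpd_comp (I J : Type) (f : J -> I) (K : I -> I -> R) :
  cpd K -> cpd (fun x y => K (f x) (f y)).
Proof.
move=> [sK pK]; split=> [x y|s s0]; first by [].
have := pK [seq (p.1, f p.2) | p <- s]; rewrite big_map qform_map; exact.
Qed.

(** Centring in both indices kills functions of a single index. Hence a distance kernel may be
    replaced by any kernel that differs from it by such functions, in particular by one that is
    positive semidefinite without side condition. *)
Lemma conjk_cent_shift (N : nat) (K : 'I_N -> 'I_N -> R) (f : 'I_N -> R) j k :
  conjk (@cent N) (fun p q => K p q + f p + f q) j k = conjk (@cent N) K j k.
Proof.
rewrite /conjk; under eq_bigr => p _.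
  under eq_bigr do rewrite 2!mulrDr.
  rewrite 2!big_split /=.
  rewrite (_ : \sum_(q < N) _ * f p = 0); last first.
    rewrite -mulr_suml -mulr_sumr sum_cent mulr0 mul0r //.
  over.
rewrite 2!big_split /= big1_eq addr0 -[RHS]addr0; congr (_ + _).
rewrite exchange_big /= big1// => q _.
under eq_bigr do rewrite -mulrA.
by rewrite -mulr_suml sum_cent mul0r.
Qed.

Lemma conjk_rank1 (N : nat) (d : 'I_N -> 'I_N -> R) (f : 'I_N -> R) j k :
  conjk d (fun p q => f p * f q) j k =
  (\sum_(p < N) d j p * f p) * (\sum_(p < N) d k p * f p).
Proof.
rewrite /conjk mulr_suml; apply: eq_bigr => p _; rewrite mulr_sumr.
by apply: eq_bigr => q _; ring.
Qed.

Lemma conjkD (N : nat) (d K L : 'I_N -> 'I_N -> R) j k :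
  conjk d (fun p q => K p q + L p q) j k = conjk d K j k + conjk d L j k.
Proof.
rewrite /conjk -big_split; apply: eq_bigr => p _; rewrite -big_split.
by apply: eq_bigr => q _; rewrite mulrDr.
Qed.

Lemma conjkZ (N : nat) (d K : 'I_N -> 'I_N -> R) c j k :
  conjk d (fun p q => c * K p q) j k = c * conjk d K j k.
Proof.
rewrite /conjk mulr_sumr; apply: eq_bigr => p _; rewrite mulr_sumr.
by apply: eq_bigr => q _; rewrite mulrCA.
Qed.

(* With J = 1 - C one has C K C + (1 + J) K (1 + J) = 2 K + 2 J K J. *)
Lemma psd_conjk_cent_le (N : nat) (K : 'I_N -> 'I_N -> R) : psd K ->
  psd (fun j k => (2 * K j k +
    2 * ((N%:R ^+ 2)^-1 * \sum_(p < N) \sum_(q < N) K p q)) -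
    conjk (@cent N) K j k).
Proof.
move=> pK.
apply: eq_psd (psd_conjk (fun j p => (j == p)%:R + N%:R^-1) pK) => j k.
apply/eqP; rewrite eq_sym subr_eq; apply/eqP; rewrite /conjk -big_split /=.
have <- : \sum_(p < N) \sum_(q < N) (j == p)%:R * ((k == q)%:R * K p q) = K j k.
  under eq_bigr do rewrite -mulr_sumr (sum_pred1 k).
  by rewrite (sum_pred1 j (K^~ k)).
rewrite !mulr_sumr -big_split /=; apply: eq_bigr => p _.
rewrite !mulr_sumr -!big_split /=; apply: eq_bigr => q _.
by rewrite /cent -exprVn; ring.
Qed.

End Centring.

(** * A law of large numbers with rate for orthogonal arrays *)

Section Dyadic.
Context (R : realFieldType) (K : nat -> nat -> R) (eta : R).

Definition blockq (s m : nat) : R :=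
  \sum_(s <= j < s + m) \sum_(s <= k < s + m) K j k.

(* An upper bound for [blockq s m] uniform in [m <= 2 ^ L]. *)
Fixpoint dyadic_bound (L s : nat) : R :=
  if L is l.+1 then
    dyadic_bound l s + ((1 + eta^-1) * blockq s (2 ^ l) +
      (1 + eta) * dyadic_bound l (s + 2 ^ l))
  else K s s.

Hypotheses (eta0 : 0 < eta) (pK : psd K).

Lemma blockq_ge0 s m : 0 <= blockq s m.
Proof.
have := psd_sum_ge0 (index_iota s (s + m)) (fun=> 1) id pK.
by under eq_bigr do under eq_bigr do rewrite !mul1r.
Qed.

(** For u and v the vector sums over the two blocks this is |u + v|^2 <= (1 + 1/eta) |u|^2 + (1 +
    eta) |v|^2, which follows from |u/eta - v|^2 >= 0. The possibly large factor falls on the first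
    block, which will be complete and have a known mean; the factor that gets iterated is
    [1 + eta]. *)
Lemma blockqD s a b : blockq s (a + b) <=
  (1 + eta^-1) * blockq s a + (1 + eta) * blockq (s + a) b.
Proof.
set r1 := index_iota s (s + a); set r2 := index_iota (s + a) (s + a + b).
pose X := \sum_(j <- r1) \sum_(k <- r2) K j k.
have X' : \sum_(j <- r2) \sum_(k <- r1) K j k = X.
  rewrite exchange_big; apply: eq_bigr => j _; apply: eq_bigr => k _.
  by case: pK.
have sab : index_iota s (s + (a + b)) = r1 ++ r2.
  by rewrite /r1 /r2 /index_iota !addKn iotaD.
have -> : blockq s (a + b) = blockq s a + 2 * X + blockq (s + a) b.
  rewrite /blockq sab big_cat /=.
  under eq_bigr do rewrite big_cat /=.
  under [X in _ + X]eq_bigr do rewrite big_cat /=.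
  by rewrite !big_split /= X' -/X; ring.
have h : 0 <= eta^-1 * (eta^-1 * blockq s a) - eta^-1 * (2 * X) +
    blockq (s + a) b.
  have := pK.2 ([seq (eta^-1, j) | j <- r1] ++ [seq (-1, j) | j <- r2]).
  congr (_ <= _); rewrite /qform big_cat !big_map /=.
  have split_sum (t : R) r : \sum_(j <- r) \sum_(q <- [seq (eta^-1, j) | j <- r1] ++
      [seq (-1, j) | j <- r2]) t * q.1 * K j q.2 =
      t * eta^-1 * (\sum_(j <- r) \sum_(k <- r1) K j k) -
      t * (\sum_(j <- r) \sum_(k <- r2) K j k).
    rewrite !mulr_sumr -sumrB; apply: eq_bigr => j _.
    rewrite big_cat !big_map !mulr_sumr -sumrN; congr (_ + _).
    by apply: eq_bigr => k _ /=; rewrite mulrN1 mulNr.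
  rewrite !split_sum X' -/X -/(blockq s a) -/(blockq (s + a) b); ring.
have := mulr_ge0 (ltW eta0) h.
rewrite (_ : eta * _ = eta^-1 * blockq s a - 2 * X + eta * blockq (s + a) b).
  lra.
by field; rewrite gt_eqF.
Qed.

Lemma dyadic_bound_ge0 L s : 0 <= dyadic_bound L s.
Proof.
elim: L s => [|L IH] s /=; first exact: psd_diag_ge0.
by rewrite !addr_ge0 ?mulr_ge0 ?IH ?addr_ge0 ?blockq_ge0 ?invr_ge0 ?ltW.
Qed.

Lemma blockq_le L s m : (m <= 2 ^ L)%N -> blockq s m <= dyadic_bound L s.
Proof.
elim: L s m => [|L IH] s m.
  case: m => [|[|//]] _; last by rewrite /blockq addn1 !big_nat1.
  by rewrite /blockq addn0 big_geq// dyadic_bound_ge0.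
move=> mL /=; have [mL'|mL'] := leqP m (2 ^ L).
  rewrite (le_trans (IH s m mL'))// lerDl.
  rewrite addr_ge0 ?mulr_ge0 ?dyadic_bound_ge0 ?blockq_ge0 ?addr_ge0//.
  - by rewrite invr_ge0 ltW.
  - exact: ltW.
rewrite -(subnKC (ltnW mL')) (le_trans (blockqD _ _ _))//.
rewrite -[leLHS]add0r lerD ?dyadic_bound_ge0// lerD2l ler_wpM2l//.
  by rewrite addr_ge0// ltW.
by apply: IH; rewrite leq_subLR addnn -mul2n -expnS.
Qed.

End Dyadic.
(** The means are summable, so the sum of all [f n] has a finite integral; it is finite almost
    everywhere, and there its terms tend to 0. *)
Lemma ae_cvg0_geometric d (T : measurableType d) (R : realType)
    (mu : {measure set T -> \bar R}) (f : nat -> T -> R) (c q : R) :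
  (forall n, measurable_fun setT (f n)) -> (forall n x, 0 <= f n x) ->
  0 <= q < 1 -> 0 <= c ->
  (forall n, (\int[mu]_x (f n x)%:E <= (c * q ^+ n)%:E)%E) ->
  {ae mu, forall x, f n x @[n --> \oo] --> (0 : R)}.
Proof.
move=> mf f0 /andP[q0 q1] c0 fle.
pose F x : \bar R := (\sum_(n <oo) (f n x)%:E)%E.
have F0 x : (0 <= F x)%E by apply: nneseries_ge0 => n _ _; rewrite lee_fin.
have mF : measurable_fun setT F.
  apply: ge0_emeasurable_sum => [n x _ _|n _]; first by rewrite lee_fin.
  exact/measurable_EFinP.
have iF : mu.-integrable setT F.
  apply/integrableP; split => //.
  under eq_integral do rewrite gee0_abs//.
  rewrite integral_nneseries//; last 2 first.
    - by move=> n; exact/measurable_EFinP.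
    - by move=> n x _; rewrite lee_fin.
  apply: (@le_lt_trans _ _ (\sum_(n <oo) (c * q ^+ n)%:E)%E).
    apply: lee_nneseries => [n _ _|n _]; last exact: fle.
    by apply: integral_ge0 => x _; rewrite lee_fin.
  have cq : (fun n => (\sum_(0 <= k < n) (c * q ^+ k)%:E)%E) @ \oo --> (c * (1 - q)^-1)%:E.
    rewrite (_ : (fun n => _) = EFin \o series (geometric c q)); last first.
      by apply/funext => n /=; rewrite -sumEFin.
    apply: cvg_EFin; first exact: nearW.
    by apply: cvg_geometric_series; rewrite ger0_norm.
  by rewrite (cvg_lim _ cq)// ltry.
have := integrable_ae measurableT iF; apply: filterS => x /(_ I) Fx.
apply: cvg_series_cvg_0; apply: nondecreasing_is_cvgn.
  by apply/nondecreasing_seqP => n; rewrite /series /= big_nat_recr//= lerDl.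
exists (fine (F x)) => _ [n _ <-]; rewrite -lee_fin fineK// /series /= -sumEFin.
by apply: nneseries_lim_ge => k _ _; rewrite lee_fin.
Qed.

Lemma cvg0_squeeze (R : realType) (f g : nat -> R) :
  (\forall N \near \oo, 0 <= f N <= g N) ->
  g N @[N --> \oo] --> (0 : R) -> f N @[N --> \oo] --> (0 : R).
Proof. by move=> fg; apply: squeeze_cvgr fg _ (cvg_cst 0). Qed.

Section RealIntegrable.
Context d (T : measurableType d) (R : realType) (mu : {measure set T -> \bar R}).
Implicit Types (D : set T) (f g : T -> R).

Lemma integrableDr D f g : measurable D ->
  mu.-integrable D (EFin \o f) -> mu.-integrable D (EFin \o g) ->
  mu.-integrable D (EFin \o (fun x => f x + g x)).
Proof. by move=> mD fi gi; exact: eq_integrable (integrableD mD fi gi). Qed.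

Lemma integrableBr D f g : measurable D ->
  mu.-integrable D (EFin \o f) -> mu.-integrable D (EFin \o g) ->
  mu.-integrable D (EFin \o (fun x => f x - g x)).
Proof. by move=> mD fi gi; exact: eq_integrable (integrableB mD fi gi). Qed.

Lemma integrableMcr D (c : R) f : measurable D ->
  mu.-integrable D (EFin \o f) ->
  mu.-integrable D (EFin \o (fun x => c * f x)).
Proof. by move=> mD fi; exact: eq_integrable (integrableZl mD c fi). Qed.

Lemma le_integrabler D f g : measurable D -> measurable_fun D f ->
  mu.-integrable D (EFin \o g) -> (forall x, D x -> `|f x| <= g x) ->
  mu.-integrable D (EFin \o f).
Proof.
move=> mD mf gi fg; apply: le_integrable gi => //; first exact/measurable_EFinP.
by move=> x Dx /=; rewrite lee_fin (le_trans (fg x Dx))// ler_norm.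
Qed.

Lemma integrable_measurable D f :
  mu.-integrable D (EFin \o f) -> measurable_fun D f.
Proof. by move=> /measurable_int/measurable_EFinP. Qed.

Lemma integrable_sumr D (I : Type) (r : seq I) (f : I -> T -> R) :
  measurable D -> (forall i, mu.-integrable D (EFin \o f i)) ->
  mu.-integrable D (EFin \o (fun w => \sum_(i <- r) f i w)).
Proof.
move=> mD fi; have := integrable_sum mD r (P := xpredT) (fun i _ => fi i).
by apply: eq_integrable => // w _ /=; rewrite sumEFin.
Qed.

Lemma Rintegral_sum D (I : Type) (r : seq I) (f : I -> T -> R) :
  measurable D -> (forall i, mu.-integrable D (EFin \o f i)) ->
  \int[mu]_(w in D) (\sum_(i <- r) f i w) = \sum_(i <- r) \int[mu]_(w in D) f i w.
Proof.
move=> mD fi; elim: r => [|i r IH].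
  by under eq_Rintegral do rewrite big_nil; rewrite Rintegral_cst// big_nil mul0r.
under eq_Rintegral do rewrite big_cons.
by rewrite RintegralD ?IH ?big_cons//; exact: integrable_sumr.
Qed.

End RealIntegrable.

Section OrthogonalArray.
Context d (T : measurableType d) (R : realType) (P : probability T R).
Context (K : nat -> nat -> T -> R) (C : R).
Hypotheses (pK : forall w, psd (fun j k => K j k w))
  (iK : forall j k, P.-integrable setT (EFin \o K j k))
  (K0 : forall j k, j != k -> \int[P]_w K j k w = 0)
  (KC : forall j, \int[P]_w K j j w <= C).

Let Kw w j k := K j k w.

Lemma integrable_blockq s m :
  P.-integrable setT (EFin \o (fun w => blockq (Kw w) s m)).
Proof.
apply: integrable_sumr => // j; apply: integrable_sumr => // k.
exact: iK.
Qed.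

Lemma Rintegral_blockq s m : \int[P]_w blockq (Kw w) s m <= C * m%:R.
Proof.
rewrite Rintegral_sum//; last first.
  by move=> j; apply: integrable_sumr => // k; exact: iK.
rewrite (_ : C * m%:R = \sum_(s <= j < s + m) C); last first.
  by rewrite big_const_nat addKn iter_addr_0 mulr_natr.
apply: ler_sum_nat => j /andP[sj js]; rewrite Rintegral_sum//;
  last by move=> k; exact: iK.
rewrite (bigD1_seq j) /=; [|by rewrite mem_index_iota sj|exact: iota_uniq].
rewrite big1 ?addr0; first exact: KC.
by move=> k kj; apply: K0; rewrite eq_sym.
Qed.

Lemma integrable_dyadic_bound eta L s :
  P.-integrable setT (EFin \o (fun w => dyadic_bound (Kw w) eta L s)).
Proof.
elim: L s => [|L IH] s /=; first exact: iK.
by apply: integrableDr => //; apply: integrableDr => //; apply: integrableMcr => //;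
  exact: integrable_blockq.
Qed.

(** The right-hand side solves b (L + 1) = (2 + eta) b (L) + (1 + 1/eta) C 2^L with b (0) = C. *)
Lemma Rintegral_dyadic_bound eta L s : 0 < eta -> 
  \int[P]_w dyadic_bound (Kw w) eta L s <=
  (C + (1 + eta^-1) * C / eta) * (2 + eta) ^+ L -
  (1 + eta^-1) * C / eta * 2 ^+ L.
Proof.
move=> eta0; elim: L s => [|L IH] s /=.
  by rewrite !expr0 !mulr1 addrK KC.
have iq : P.-integrable setT (EFin \o fun w => (1 + eta^-1) * blockq (Kw w) s (2 ^ L)).
  by apply: integrableMcr => //; exact: integrable_blockq.
have ib : P.-integrable setT
    (EFin \o fun w => (1 + eta) * dyadic_bound (Kw w) eta L (s + 2 ^ L)).
  by apply: integrableMcr => //; exact: integrable_dyadic_bound.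
rewrite !RintegralD//; [|exact: integrable_dyadic_bound|exact: integrableDr].
rewrite !RintegralZl//; [|exact: integrable_dyadic_bound|exact: integrable_blockq].
have e1 : 0 <= 1 + eta by rewrite addr_ge0// ltW.
have e2 : 0 <= 1 + eta^-1 by rewrite addr_ge0// invr_ge0 ltW.
apply: le_trans (lerD (IH s) (lerD (ler_wpM2l e2 (Rintegral_blockq _ _))
  (ler_wpM2l e1 (IH _)))) _.
rewrite le_eqVlt natrX !exprS; apply/orP; left; apply/eqP; field.
by rewrite gt_eqF.
Qed.

(* Rademacher-Menshov argument: all partial sums up to [2 ^ L] are controlled
   by sums over dyadic blocks, whose means only see the diagonal. *)
Theorem psd_array_cvg0 (beta : R) : 0 < beta < 1 ->
  {ae P, forall w, N%:R `^ beta * ((N%:R ^+ 2)^-1 *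
    \sum_(j < N) \sum_(k < N) K j k w) @[N --> \oo] --> (0 : R)}.
Proof.
(* For N of order 2^L, [tau ^+ L] has the order of N^beta / N^2. *)
move=> /andP[beta0 beta1]; pose tau : R := 2 `^ beta / 4.
have tau0 : 0 < tau by rewrite divr_gt0// powR_gt0.
have tau2 : tau < 2^-1.
  rewrite /tau ltr_pdivrMr// (_ : 2^-1 * 4 = 2 `^ 1 :> R); last first.
    by rewrite powRr1//; lra.
  by rewrite /powR pnatr_eq0 /= ltr_expR ltr_pM2r// ln_gt0// ltr1n.
(* [2 + eta] is the midpoint of 2 and [tau^-1], so that [tau * (2 + eta) < 1] and the means of [Y L]
   decay geometrically. *)
pose eta := (tau^-1 - 2) / 2.
have eta0 : 0 < eta.
  by rewrite divr_gt0// subr_gt0 -(invrK 2) ltf_pV2 ?posrE// invr_gt0.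
have C0 : 0 <= C.
  by apply: le_trans (KC 0); apply: Rintegral_ge0 => w _; exact: psd_diag_ge0 (pK w).
pose Y L w := tau ^+ L * dyadic_bound (Kw w) eta L 0.
have iY L : P.-integrable setT (EFin \o Y L).
  by apply: integrableMcr => //; exact: integrable_dyadic_bound.
have Y0 L w : 0 <= Y L w.
  apply: mulr_ge0; first exact: exprn_ge0 (ltW tau0).
  exact: dyadic_bound_ge0 eta0 (pK w) _ _.
pose D := C + (1 + eta^-1) * C / eta.
have D0 : 0 <= D.
  by rewrite addr_ge0// !mulr_ge0 ?addr_ge0 ?invr_ge0// (ltW eta0).
have : {ae P, forall w, Y L w @[L --> \oo] --> (0 : R)}.
  apply: (@ae_cvg0_geometric _ _ _ _ _ D (tau * (2 + eta))) => //.
  - by move=> L; apply/measurable_EFinP; exact: measurable_int (iY L).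
  - rewrite mulr_ge0 ?addr_ge0 ?(ltW tau0) ?(ltW eta0)//=.
    rewrite (_ : tau * _ = (1 + 2 * tau) / 2); first lra.
    by rewrite /eta; field; rewrite gt_eqF.
  - move=> L; rewrite -[X in (X <= _)%E]fineK;
      last by apply: integrable_fin_num (iY L).
    rewrite lee_fin; change (\int[P]_w Y L w <= D * (tau * (2 + eta)) ^+ L).
    rewrite /Y RintegralZl//; last exact: integrable_dyadic_bound.
    rewrite [(tau * _) ^+ L]exprMn [leRHS]mulrCA ler_wpM2l ?exprn_ge0 ?(ltW tau0)//.
    apply: le_trans (Rintegral_dyadic_bound _ _ eta0) _; rewrite gerBl.
    by rewrite !mulr_ge0 ?addr_ge0 ?invr_ge0 ?exprn_ge0 ?(ltW eta0).
apply: filterS => w cY.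
have cl : (trunc_log 2 N).+1 @[N --> \oo] --> \oo.
  apply/cvgnyPge => A; exists (2 ^ A)%N => // N /= AN; apply: leqW.
  by rewrite trunc_log_max.
have {}cY : Y (trunc_log 2 N).+1 w @[N --> \oo] --> (0 : R).
  exact: (cvg_comp _ _ cl cY).
(* With L = [trunc_log 2 N] only 4^L <= N^2 holds, whereas [Y] is taken at level L + 1 to cover N;
   the factor 4 makes up for the difference. *)
have {}cY : 4 * Y (trunc_log 2 N).+1 w @[N --> \oo] --> (0 : R).
  by rewrite -(mulr0 4); exact: cvgMl_tmp.
apply: cvg0_squeeze cY; exists 1%N => // N /= N0.
have Q0 : 0 <= \sum_(j < N) \sum_(k < N) K j k w.
  have := psd_sum_ge0 (index_enum 'I_N) (fun=> 1) (@nat_of_ord N) (pK w).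
  by under eq_bigr do under eq_bigr do rewrite !mul1r.
rewrite !mulr_ge0 ?powR_ge0 ?invr_ge0//=.
set L := trunc_log 2 N.
have [LN NL] : (2 ^ L <= N)%N /\ (N < 2 ^ L.+1)%N.
  by split; [exact: trunc_logP | exact: trunc_log_ltn].
have QB : \sum_(j < N) \sum_(k < N) K j k w <= dyadic_bound (Kw w) eta L.+1 0.
  have := blockq_le eta0 (pK w) 0 (ltnW NL); rewrite /blockq add0n big_mkord.
  by under eq_bigr do rewrite big_mkord.
rewrite /Y (_ : 4 * _ = 2 `^ beta ^+ L.+1 * ((4 ^+ L)^-1 *
  dyadic_bound (Kw w) eta L.+1 0)); last first.
  by rewrite /tau expr_div_n [4 ^+ L.+1]exprS; field; rewrite expf_neq0.
apply: ler_pM; [exact: powR_ge0 | by rewrite mulr_ge0// invr_ge0 | |].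
- rewrite -powR_mulrn ?powR_ge0// -powRrM mulrC powRrM powR_mulrn//.
  by rewrite ge0_ler_powR ?nnegrE ?exprn_ge0// ?(ltW beta0)// -natrX ler_nat ltnW.
- apply: ler_pM => //.
  rewrite lef_pV2 ?posrE ?exprn_gt0 ?ltr0n//.
  by rewrite -!natrX ler_nat (_ : 4 = 2 ^ 2)%N// -expnM mulnC expnM leq_sqr.
Qed.

End OrthogonalArray.

(** On a given list this is a finite sum of rank one kernels, one for each possible value.
    Multiplying by it turns a rank one array into a diagonal one, see [mean_growth]. *)
Lemma psd_delta (R : realFieldType) : psd (fun i j : nat => (i == j)%:R : R).
Proof.
split=> [i j|s]; first by rewrite eq_sym.
pose M := (\max_(p <- s) p.2).+1.
have ltM p : p \in s -> (p.2 < M)%N by move=> ps; rewrite ltnS leq_bigmax_seq.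
have -> : qform (fun i j : nat => (i == j)%:R : R) s =
    \sum_(v < M) (\sum_(p <- s) p.1 * (p.2 == v)%:R) ^+ 2.
  transitivity (\sum_(v < M) \sum_(p <- s) \sum_(q <- s)
      p.1 * q.1 * ((p.2 == v)%:R * (q.2 == v)%:R)); last first.
    apply: eq_bigr => v _; rewrite expr2 mulr_suml; apply: eq_bigr => p _.
    by rewrite mulr_sumr; apply: eq_bigr => q _; ring.
  rewrite exchange_big /qform !big_seq; apply: eq_bigr => p ps.
  rewrite exchange_big; apply: eq_bigr => q _; rewrite -mulr_sumr; congr (_ * _).
  rewrite (bigD1 (Ordinal (ltM p ps)))//= eqxx mul1r eq_sym big1 ?addr0// => v.
  by move=> /negbTE; rewrite -val_eqE /= eq_sym => ->; rewrite mul0r.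
by apply: sumr_ge0 => v _; exact: sqr_ge0.
Qed.

Lemma Rintegral_cst_probability d (T : measurableType d) (R : realType)
  (P : probability T R) (c : R) : \int[P]_x c = c.
Proof.
rewrite Rintegral_cst// -[RHS]mulr1; congr (_ * _).
by rewrite -[RHS]/(fine 1%E); congr fine; exact: probability_setT.
Qed.

(** * Change of variables and pairwise independent sequences *)

Section Law.
Context d d' (T : measurableType d) (E : measurableType d') (R : realType).
Context (P : {measure set T -> \bar R}) (mu : {measure set E -> \bar R}).
Context (U : T -> E).
Hypotheses (mU : measurable_fun setT U)
  (lawU : forall A, measurable A -> P (U @^-1` A) = mu A).

Let mU_mixin := isMeasurableFun.Build _ _ _ _ _ mU.
Let mU_pack : {mfun T >-> E} := MeasurableFun.Pack (MeasurableFun.Class mU_mixin).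

Lemma ge0_integral_law (f : E -> \bar R) : measurable_fun setT f ->
  (forall x, (0 <= f x)%E) -> (\int[P]_w f (U w) = \int[mu]_x f x)%E.
Proof.
move=> mf f0.
transitivity (\int[pushforward P mU_pack]_x f x)%E.
  by rewrite (ge0_integral_pushforward mU P measurableT mf).
by apply: eq_measure_integral => A mA _; exact: lawU.
Qed.

Lemma integrable_law (f : E -> R) : mu.-integrable setT (EFin \o f) ->
  P.-integrable setT (EFin \o (fun w => f (U w))).
Proof.
move=> /integrableP[mf fi]; apply/integrableP; split.
  exact: measurableT_comp mf mU.
rewrite (ge0_integral_law (f := fun x => `|(f x)%:E|%E))//.
exact: measurableT_comp mf.
Qed.

Lemma law_integrable (f : E -> R) : measurable_fun setT f ->
  P.-integrable setT (EFin \o (fun w => f (U w))) ->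
  mu.-integrable setT (EFin \o f).
Proof.
move=> mf /integrableP[_ fi]; apply/integrableP; split; first exact/measurable_EFinP.
rewrite -(ge0_integral_law (f := fun x => `|(f x)%:E|%E))//.
by apply: measurableT_comp => //; exact/measurable_EFinP.
Qed.

Lemma Rintegral_law (f : E -> R) : mu.-integrable setT (EFin \o f) ->
  \int[P]_w f (U w) = \int[mu]_x f x.
Proof.
move=> fi; have mf := measurable_int _ fi; congr fine.
transitivity (\int[pushforward P mU_pack]_x (f x)%:E)%E.
  by rewrite (integral_pushforward mU mf (integrable_law fi) measurableT).
by apply: eq_measure_integral => A mA _; exact: lawU.
Qed.

End Law.

Section PairLaw.
Context d d1 d2 (T : measurableType d) (E1 : measurableType d1)
  (E2 : measurableType d2) (R : realType).
Context (P : probability T R) (mu1 : probability E1 R) (mu2 : probability E2 R).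
Context (U : T -> E1) (V : T -> E2).
Hypotheses (mU : measurable_fun setT U) (mV : measurable_fun setT V)
  (lawUV : forall A B, measurable A -> measurable B ->
    P (U @^-1` A `&` V @^-1` B) = (mu1 A * mu2 B)%E).

Lemma pair_law (C : set (E1 * E2)) : measurable C ->
  P ((fun w => (U w, V w)) @^-1` C) = (mu1 \x mu2)%E C.
Proof.
move=> mC; have mUV := measurable_fun_pair mU mV.
pose UV_mixin := isMeasurableFun.Build _ _ _ _ _ mUV.
pose UV : {mfun T >-> (E1 * E2)%type} := MeasurableFun.Pack (MeasurableFun.Class UV_mixin).
by rewrite (@product_measure_unique _ _ _ _ _ mu1 mu2 (distribution P UV)).
Qed.

End PairLaw.

Section PairwiseIndependent.
Context d d' (T : measurableType d) (E : measurableType d') (R : realType).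
Context (P : probability T R) (mu : probability E R) (Z : nat -> T -> E).
Hypotheses (mZ : forall k, measurable_fun setT (Z k))
  (lawZ : forall k A, measurable A -> P (Z k @^-1` A) = mu A)
  (indZ : forall j k, j != k -> forall A B, measurable A -> measurable B ->
    P (Z j @^-1` A `&` Z k @^-1` B) = (mu A * mu B)%E).

(** Fubini turns degeneracy of the kernel into vanishing means off the diagonal of the array.
    Integrability of the diagonal is enough, because [psd_normr_le] bounds all other entries by
    it. *)
Theorem psd_kernel_cvg0 (k : E -> E -> R) (beta : R) :
  measurable_fun setT (fun z : E * E => k z.1 z.2) -> psd k ->
  (forall y, \int[mu]_x k x y = 0) ->
  mu.-integrable setT (EFin \o (fun x => k x x)) -> 0 < beta < 1 ->
  {ae P, forall w, N%:R `^ beta * ((N%:R ^+ 2)^-1 *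
    \sum_(i < N) \sum_(j < N) k (Z i w) (Z j w)) @[N --> \oo] --> (0 : R)}.
Proof.
move=> mk pk k0 ik; have idiag j := integrable_law (mZ j) (lawZ j) ik.
have iZ i j : P.-integrable setT (EFin \o (fun w => k (Z i w) (Z j w))).
  have ij := integrableMcr (2^-1) measurableT (integrableDr measurableT (idiag i) (idiag j)).
  apply: le_integrabler ij _ => //.
    exact: measurableT_comp mk (measurable_fun_pair (mZ i) (mZ j)).
  by move=> w _; rewrite mulrC; exact: psd_normr_le.
apply: (@psd_array_cvg0 _ _ _ P (fun i j w => k (Z i w) (Z j w)) (\int[mu]_x k x x)) => //.
- by move=> w; exact: (psd_comp (Z ^~ w) pk).
- move=> i j ij; have mij := measurable_fun_pair (mZ i) (mZ j).
  have lij := pair_law (mZ i) (mZ j) (indZ ij).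
  have iprod := law_integrable mij lij mk (iZ i j).
  rewrite (Rintegral_law mij lij iprod) /Rintegral -integral21_prod_meas1//.
  rewrite integral0_eq// => y _; rewrite /fubini_G /=.
  have ky : mu.-integrable setT (EFin \o (fun x => k x y)).
    have := integrableMcr (2^-1) measurableT (integrableDr measurableT ik
      (@finite_measure_integrable_cst _ _ _ mu _ (k y y) measurableT)).
    move=> h; apply: le_integrabler h _ => //.
      exact: (measurable_fun_pair1 y mk).
    by move=> x _ /=; rewrite mulrC; exact: psd_normr_le.
  rewrite -[LHS]fineK; last by apply: integrable_fin_num ky.
  by rewrite [X in X%:E](k0 y).
- by move=> j; rewrite (Rintegral_law (mZ j) (lawZ j) ik).
Qed.

(** For the kernel [(h x - m) * (h y - m)] the double mean is the square of the error of the sample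
    mean, so the strong law is a rank one case of [psd_kernel_cvg0]. The exponent 1/2 is arbitrary:
    all that counts is that the power of N is at least 1. *)
Lemma bounded_mean_cvg (h : E -> R) (M : R) : measurable_fun setT h ->
  (forall x, `|h x| <= M) ->
  {ae P, forall w, N%:R^-1 * \sum_(j < N) h (Z j w) @[N --> \oo] -->
    \int[mu]_x h x}.
Proof.
move=> mh hM; set m := \int[mu]_x h x.
have ih : mu.-integrable setT (EFin \o h).
  apply: le_integrabler (@finite_measure_integrable_cst _ _ _ mu _ M measurableT) _ => //.
have ihm : mu.-integrable setT (EFin \o (fun x => h x - m)).
  by apply: integrableBr => //; exact: finite_measure_integrable_cst.
have hm0 : \int[mu]_x (h x - m) = 0.
  rewrite RintegralB//; last exact: finite_measure_integrable_cst.
  by rewrite Rintegral_cst_probability subrr.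
have mhm : measurable_fun setT (fun x => h x - m) by exact: integrable_measurable ihm.
have mk : measurable_fun setT (fun z : E * E => (h z.1 - m) * (h z.2 - m)).
  apply: measurable_funM.
    exact: measurableT_comp mhm measurable_fst.
  exact: measurableT_comp mhm measurable_snd.
have k0 y : \int[mu]_x ((h x - m) * (h y - m)) = 0.
  by rewrite RintegralZr// hm0 mul0r.
have ik : mu.-integrable setT (EFin \o (fun x => (h x - m) * (h x - m))).
  have ic := @finite_measure_integrable_cst _ _ _ mu _ ((M + `|m|) ^+ 2) measurableT.
  apply: le_integrabler ic _ => //.
    exact: measurable_funM.
  move=> x _ /=; rewrite -expr2 normrX ler_pXn2r ?nnegrE//; last first.
    by rewrite addr_ge0// (le_trans _ (hM x)).
  by rewrite (le_trans (ler_normB _ _))// lerD2r.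
have half01 : 0 < (2^-1 : R) < 1 by apply/andP; split; lra.
have := psd_kernel_cvg0 mk (psd_rank1 _) k0 ik half01.
apply: filterS => w cw; apply/subr_cvg0.
have {}cw : (N%:R^-1 * \sum_(j < N) (h (Z j w) - m)) ^+ 2 @[N --> \oo] --> (0 : R).
  apply: cvg0_squeeze cw; exists 1%N => // N /= N0; rewrite sqr_ge0/=.
  set S := \sum_(j < N) _; rewrite (_ : \sum_(i < N) _ = S * S); last first.
    rewrite /S mulr_suml; apply: eq_bigr => i _; rewrite mulr_sumr; exact: eq_bigr.
  rewrite exprMn exprVn -expr2; apply: ler_peMl.
    by rewrite mulr_ge0 ?invr_ge0 ?sqr_ge0.
  have N1 : 1 <= N%:R :> R by rewrite ler1n.
  by have := ler_powR N1 (ltW (proj1 (andP half01))); rewrite powRr0.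
have {}cw := cvg_comp _ _ cw (@sqrt_continuous R 0).
rewrite sqrtr0 in cw.
apply/norm_cvg0P; apply: cvg_trans cw; apply: near_eq_cvg.
exists 1%N => // N /= N0; rewrite sqrtr_sqr sumrB sumr_const card_ord mulrBr.
by rewrite -[m *+ N]mulr_natl mulKf// pnatr_eq0 -lt0n.
Qed.

(** A diagonal array with entries [f (Z i w)] is trivially orthogonal. The outcome, a sample mean of
    order o(N^(1 - beta)), is weaker than the strong law but requires no truncation of [f]. *)
Lemma mean_growth (f : E -> R) (beta : R) : (forall x, 0 <= f x) ->
  mu.-integrable setT (EFin \o f) -> 0 < beta < 1 ->
  {ae P, forall w, N%:R `^ beta * ((N%:R ^+ 2)^-1 *
    \sum_(j < N) f (Z j w)) @[N --> \oo] --> (0 : R)}.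
Proof.
move=> f0 fi beta01.
have ifZ j := integrable_law (mZ j) (lawZ j) fi.
pose K i j w := (i == j)%:R * (Num.sqrt (f (Z i w)) * Num.sqrt (f (Z j w))).
have Kii i w : K i i w = f (Z i w) by rewrite /K eqxx mul1r -expr2 sqr_sqrtr.
have Kij i j w : i != j -> K i j w = 0 by rewrite /K => /negbTE ->; rewrite mul0r.
have pK w : psd (fun i j => K i j w).
  exact: psd_mul (psd_delta R) (psd_rank1 (fun i => Num.sqrt (f (Z i w)))).
have iK i j : P.-integrable setT (EFin \o K i j).
  have [<-|ij] := eqVneq i j.
    by apply: eq_integrable (ifZ i) => // w _ /=; rewrite Kii.
  by apply: eq_integrable (integrable0 _ _) => // w _ /=; rewrite Kij.
have K0 i j : i != j -> \int[P]_w K i j w = 0.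
  move=> ij; under eq_Rintegral do rewrite Kij//.
  by rewrite Rintegral_cst// mul0r.
have KC i : \int[P]_w K i i w <= \int[mu]_x f x.
  by under eq_Rintegral do rewrite Kii; rewrite (Rintegral_law (mZ i) (lawZ i) fi).
have := psd_array_cvg0 pK iK K0 KC beta01; apply: filterS => w.
apply: cvg_trans; apply: near_eq_cvg; apply: nearW => N; do 2 congr (_ * _).
apply: eq_bigr => i _; rewrite (bigD1 i)//= Kii big1 ?addr0// => j ji.
by rewrite Kij// eq_sym.
Qed.

End PairwiseIndependent.

(** * The distance functions [cndf rho] *)

Section CvgBig.
Context (R : realType) (T : Type) (F : set_system T) (FF : Filter F).

Lemma cvg_sumr (J : Type) (r : seq J) (f : J -> T -> R) (l : J -> R) :
  (forall j, f j x @[x --> F] --> l j) ->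
  \sum_(j <- r) f j x @[x --> F] --> \sum_(j <- r) l j.
Proof.
move=> fl; elim: r => [|j r IH].
  by under eq_fun do rewrite big_nil; rewrite big_nil; exact: cvg_cst.
by under eq_fun do rewrite big_cons; rewrite big_cons; exact: cvgD.
Qed.

Lemma cvg_prodr (J : Type) (r : seq J) (f : J -> T -> R) (l : J -> R) :
  (forall j, f j x @[x --> F] --> l j) ->
  \prod_(j <- r) f j x @[x --> F] --> \prod_(j <- r) l j.
Proof.
move=> fl; elim: r => [|j r IH].
  by under eq_fun do rewrite big_nil; rewrite big_nil; exact: cvg_cst.
by under eq_fun do rewrite big_cons; rewrite big_cons; exact: cvgM.
Qed.

End CvgBig.

Section Borel.
Context (R : realType) (d : nat).

Lemma continuous_borel_measurable (f : 'rV[R]_d -> R) :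
  continuous f -> measurable_fun setT (f : borelE R d -> R).
Proof.
move=> cf _; apply: (measurability _ (RGenOInfty.measurableE R)) => //.
move=> _ [_ [x ->] <-]; rewrite setTI; apply: sub_sigma_algebra.
by apply: open_comp => [y _|]; [exact: cf | exact: interval_open].
Qed.

(** Dominated convergence speaks of sequences; this turns its conclusions into continuity. *)
Lemma seq_continuous (f : 'rV[R]_d -> R) :
  (forall (u : nat -> 'rV[R]_d) p, u n @[n --> \oo] --> p ->
    f (u n) @[n --> \oo] --> f p) -> continuous f.
Proof.
move=> fu p; apply: (@cvgrPdist_lt _ _ _ (nbhs p) (nbhs_filter p) f (f p)).2.
move=> e e0; apply: contrapT => fe.
have /choice[u uP] : forall n, exists x : 'rV[R]_d,
    `|p - x| < n.+1%:R^-1 /\ e <= `|f p - f x|.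
  move=> n; apply: contrapT => /forallNP h; apply: fe.
  apply: (nbhs_normP p _).2; exists n.+1%:R^-1; first by rewrite /= invr_gt0.
  move=> x /= px; rewrite ltNge; apply/negP => ex; apply: (h x); split => //.
have up : u n @[n --> \oo] --> p.
  apply/cvgrPdist_lt => /= r r0.
  have := near_infty_natSinv_lt (PosNum r0); apply: filterS => n /= nr.
  exact: lt_trans (uP n).1 nr.
have /cvgrPdist_lt/(_ _ e0)[N _ /(_ N (leqnn N))] := fu u p up.
by rewrite /= ltNge (uP N).2.
Qed.

Lemma edotC (x y : 'rV[R]_d) : edot x y = edot y x.
Proof. by apply: eq_bigr => j _; rewrite mulrC. Qed.

Lemma edotBl (x y t : 'rV[R]_d) : edot (x - y) t = edot x t - edot y t.
Proof. by rewrite -sumrB; apply: eq_bigr => j _; rewrite !mxE mulrBl. Qed.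

Lemma edotNl (y t : 'rV[R]_d) : edot (- y) t = - edot y t.
Proof. by rewrite -sumrN; apply: eq_bigr => j _; rewrite !mxE mulNr. Qed.

Lemma edot0l (t : 'rV[R]_d) : edot 0 t = 0.
Proof. by apply: big1 => j _; rewrite mxE mul0r. Qed.

Lemma continuous_edot (y : 'rV[R]_d) : continuous (edot y).
Proof.
move=> t; apply: (cvg_sumr (nbhs_filter t)) => j.
exact: (cvgMl_tmp (FF := nbhs_filter t) (@coord_continuous _ _ _ ord0 j t)).
Qed.

Lemma coord_le_enorm (t : 'rV[R]_d) j : `|t ord0 j| <= enorm t.
Proof.
rewrite -sqrtr_sqr ler_wsqrtr// /edot (bigD1 j)//= -expr2 lerDl.
by apply: sumr_ge0 => k _; rewrite -expr2 sqr_ge0.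
Qed.

Lemma normr_edot_le (y t : 'rV[R]_d) :
  `|edot y t| <= (\sum_j `|y ord0 j|) * enorm t.
Proof.
rewrite mulr_suml (le_trans (ler_norm_sum _ _ _))//.
by apply: ler_sum => j _; rewrite normrM ler_wpM2l// coord_le_enorm.
Qed.

Lemma continuous_enorm : continuous (@enorm R d).
Proof.
move=> t; rewrite /enorm; apply: continuous_comp; last exact: sqrt_continuous.
apply: (cvg_sumr (nbhs_filter t)) => j.
have ct := @coord_continuous _ _ _ ord0 j t.
exact: (cvgM (FF := nbhs_filter t) ct ct).
Qed.

Lemma measurable_set1C0 : measurable (~` [set (0 : 'rV[R]_d)] : set (borelE R d)).
Proof.
apply: sub_sigma_algebra; apply: closed_openC.
exact: (accessible_closed_set1 (hausdorff_accessible (@norm_hausdorff _ _))).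
Qed.

End Borel.

Section Trigo.
Context (R : realType).
Implicit Types (x y : R).

Lemma sin_lipschitz x y : `|sin x - sin y| <= `|x - y|.
Proof.
wlog xy : x y / y <= x.
  move=> h; have [/ltW|] := ltP x y; last exact: h.
  by rewrite (distrC (sin x)) (distrC x); exact: h.
have cs : {within `[y, x], continuous (@sin R)}.
  by apply: continuous_subspaceT => z; exact: continuous_sin.
have [c _ ->] := MVT_segment xy (fun z _ => is_derive_sin z) cs.
by rewrite normrM ler_piMl// cos_max.
Qed.

Lemma cos_lipschitz x y : `|cos x - cos y| <= `|x - y|.
Proof.
rewrite -!sinDpihalf (le_trans (sin_lipschitz _ _))//.
by rewrite opprD addrACA subrr addr0.
Qed.

Lemma subr1cos_ge0 x : 0 <= 1 - cos x.
Proof. by rewrite subr_ge0 (le_trans (ler_norm _))// cos_max. Qed.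

Lemma subr1cos_le x : 1 - cos x <= x ^+ 2.
Proof.
have -> : 1 - cos x = 2 * sin (x / 2) ^+ 2.
  by rewrite {1}[x]splitr cosD -!expr2 cos2sin2; ring.
have := sin_lipschitz (x / 2) 0; rewrite sin0 !subr0 => h.
have : sin (x / 2) ^+ 2 <= (x / 2) ^+ 2.
  by rewrite -real_normK ?num_real// -[leRHS]real_normK ?num_real// ler_sqr.
rewrite expr_div_n => h2; have := sqr_ge0 x; lra.
Qed.

End Trigo.

Lemma Rintegral_dominated_cvg d (T : measurableType d) (R : realType)
    (mu : {measure set T -> \bar R}) (D : set T) (f_ : nat -> T -> R)
    (f g : T -> R) : measurable D ->
  (forall n, measurable_fun D (f_ n)) -> measurable_fun D f ->
  (forall x, D x -> f_ n x @[n --> \oo] --> f x) ->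
  mu.-integrable D (EFin \o g) -> (forall n x, D x -> `|f_ n x| <= g x) ->
  \int[mu]_(x in D) f_ n x @[n --> \oo] --> \int[mu]_(x in D) f x.
Proof.
move=> mD mf_ mf ff ig fg.
have [] := @dominated_convergence _ _ _ mu D mD (fun n => EFin \o f_ n)
  (EFin \o f) (EFin \o g) _ _ _ ig _.
- by move=> n; exact/measurable_EFinP.
- exact/measurable_EFinP.
- by apply: aeW => x Dx; apply: cvg_EFin; [exact: nearW | exact: ff].
- by apply: aeW => x n Dx /=; rewrite lee_fin; exact: fg.
move=> iF _ H; apply: fine_cvg; rewrite fineK; first exact: H.
exact: (integrable_fin_num mD iF).
Qed.

Section Cndf.
Context (R : realType) (d : nat) (rho : {measure set (borelE R d) -> \bar R}).
Hypothesis levy : levy_integrable rho.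

Let D : set (borelE R d) := ~` [set (0 : 'rV[R]_d)].
Let mD : measurable D. Proof. exact: measurable_set1C0. Qed.

(** Real and imaginary part of exp (i u) under one name. *)
Definition wave (b : bool) (u : R) : R := if b then cos u else sin u.

Lemma wave_le1 b u : `|wave b u| <= 1.
Proof. by case: b; [exact: cos_max | exact: sin_max]. Qed.

Lemma wave_lipschitz b u v : `|wave b u - wave b v| <= `|u - v|.
Proof. by case: b; [exact: cos_lipschitz | exact: sin_lipschitz]. Qed.

Lemma continuous_wave b : continuous (wave b).
Proof. by case: b; [exact: continuous_cos | exact: continuous_sin]. Qed.

Lemma measurable_wave b (y : 'rV[R]_d) :
  measurable_fun setT (fun t : borelE R d => wave b (edot y t)).
Proof.
apply: continuous_borel_measurable => t.
by apply: continuous_comp; [exact: continuous_edot | exact: continuous_wave].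
Qed.

Definition l1 (y : 'rV[R]_d) : R := \sum_j `|y ord0 j|.

Definition levy_min (t : borelE R d) : R := Num.min 1 (enorm t ^+ 2).

Lemma measurable_levy_min : measurable_fun setT levy_min.
Proof.
apply: measurable_minr; first exact: measurable_cst.
apply: measurable_funX; apply: continuous_borel_measurable.
exact: continuous_enorm.
Qed.

Lemma levy_min_ge0 t : 0 <= levy_min t.
Proof. by rewrite le_min ler01 sqr_ge0. Qed.

Lemma integrable_levy_min : rho.-integrable D (EFin \o levy_min).
Proof.
apply: (@integrableS _ _ _ _ setT) => //.
apply/integrableP; split; first by apply/measurable_EFinP; exact: measurable_levy_min.
rewrite (_ : (\int[rho]_x _)%E = (\int[rho]_t (levy_min t)%:E)%E)//.
by apply: eq_integral => t _ /=; rewrite ger0_norm//; exact: levy_min_ge0.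
Qed.

Lemma subr1cos_le_levy_min (y t : 'rV[R]_d) :
  1 - cos (edot y t) <= (2 + l1 y ^+ 2) * levy_min t.
Proof.
have l0 : 0 <= l1 y ^+ 2 by exact: sqr_ge0.
rewrite /levy_min; have [h|h] := leP 1 (enorm t ^+ 2).
  rewrite mulr1; have := cos_geN1 (edot y t); lra.
apply: (le_trans (subr1cos_le _)).
have := normr_edot_le y t; rewrite -/(l1 y) => h2.
have : edot y t ^+ 2 <= (l1 y * enorm t) ^+ 2.
  rewrite -real_normK ?num_real// ler_sqr ?nnegrE//.
  by apply: le_trans h2; exact: normr_ge0.
rewrite exprMn => /le_trans; apply; rewrite ler_wpM2r ?sqr_ge0//; lra.
Qed.

Lemma measurable_subr1cos (y : 'rV[R]_d) (B : set (borelE R d)) :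
  measurable_fun B (fun t : borelE R d => 1 - cos (edot y t)).
Proof.
apply: measurable_funTS; apply: measurable_funB; first exact: measurable_cst.
exact: measurable_wave true y.
Qed.

Lemma integrable_subr1cos (y : 'rV[R]_d) :
  rho.-integrable D (EFin \o (fun t => 1 - cos (edot y t))).
Proof.
apply: le_integrabler (integrableMcr (2 + l1 y ^+ 2) mD integrable_levy_min) _.
- exact: mD.
- exact: measurable_subr1cos.
- move=> t _; rewrite ger0_norm ?subr1cos_ge0//.
  exact: subr1cos_le_levy_min.
Qed.

Lemma cndf_ge0 y : 0 <= cndf rho y.
Proof. by apply: Rintegral_ge0 => t _; exact: subr1cos_ge0. Qed.

Lemma cndf0 : cndf rho 0 = 0.
Proof.
rewrite /cndf; under eq_Rintegral do rewrite edot0l cos0 subrr.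
by rewrite Rintegral_cst// mul0r.
Qed.

Lemma cndfN y : cndf rho (- y) = cndf rho y.
Proof. by apply: eq_Rintegral => t _; rewrite edotNl cosN. Qed.

Lemma l1_ge0 y : 0 <= l1 y.
Proof. exact: sumr_ge0. Qed.

Lemma continuous_l1 : continuous l1.
Proof.
move=> t; apply: (cvg_sumr (nbhs_filter t)) => j.
exact: (cvg_norm (FF := nbhs_filter t) (@coord_continuous _ _ _ ord0 j t)).
Qed.

Lemma continuous_cndf : continuous (cndf rho).
Proof.
apply: seq_continuous => u p up.
have lu : l1 (u n) @[n --> \oo] --> l1 p.
  exact: (cvg_comp _ _ up (@continuous_l1 p)).
have [N _ uN] : \forall n \near \oo, l1 (u n) < l1 p + 1.
  by apply: (cvgr_lt (l1 p)) => //; rewrite ltrDl.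
(* Past index [N] the numbers [l1 (u n)] have a common bound, which gives the dominating
   function. *)
rewrite -(cvg_shiftn N); apply: Rintegral_dominated_cvg.
- exact: mD.
- by move=> n; exact: measurable_subr1cos.
- exact: measurable_subr1cos.
- move=> t _; apply: cvgB; first exact: cvg_cst.
  have ct : edot (u n) t @[n --> \oo] --> edot p t.
    rewrite edotC; under eq_fun do rewrite edotC.
    exact: (cvg_comp _ _ up (@continuous_edot _ _ t p)).
  have := cvg_comp _ _ ct (@continuous_cos R _).
  by rewrite -(cvg_shiftn N).
- exact: (integrableMcr (2 + (l1 p + 1) ^+ 2) mD integrable_levy_min).
- move=> n t _; rewrite ger0_norm ?subr1cos_ge0//.
  apply: le_trans (subr1cos_le_levy_min _ _) _.
  rewrite ler_wpM2r ?levy_min_ge0// lerD2l ler_sqr ?nnegrE ?l1_ge0//.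
    by rewrite ltW// uN//= leq_addl.
  by rewrite addr_ge0// l1_ge0.
Qed.

(** Both sides are the squared modulus of the weighted sum of exp (i edot p.2 t): the constant 1 in
    [1 - cos] contributes nothing as the total weight is 0. *)
Lemma qform_wave (s : seq (R * 'rV[R]_d)) (t : 'rV[R]_d) :
  \sum_(p <- s) p.1 = 0 ->
  \sum_(p <- s) \sum_(q <- s) p.1 * q.1 * - (1 - cos (edot (p.2 - q.2) t)) =
  (\sum_(p <- s) p.1 * wave true (edot p.2 t)) ^+ 2 +
  (\sum_(p <- s) p.1 * wave false (edot p.2 t)) ^+ 2.
Proof.
move=> s0; rewrite !expr2 !mulr_suml -big_split /=.
transitivity (\sum_(p <- s) \sum_(q <- s) (p.1 * q.1 *
    (cos (edot p.2 t) * cos (edot q.2 t) + sin (edot p.2 t) * sin (edot q.2 t)) -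
    p.1 * q.1)).
  apply: eq_bigr => p _; apply: eq_bigr => q _.
  by rewrite edotBl cosB; ring.
apply: eq_bigr => p _; rewrite sumrB -mulr_sumr s0 mulr0 subr0.
rewrite !mulr_sumr -big_split; apply: eq_bigr => q _ /=; ring.
Qed.

Lemma qform_cndf (s : seq (R * 'rV[R]_d)) : \sum_(p <- s) p.1 = 0 ->
  qform (fun x y => - cndf rho (x - y)) s =
  \int[rho]_(t in D) ((\sum_(p <- s) p.1 * wave true (edot p.2 t)) ^+ 2 +
    (\sum_(p <- s) p.1 * wave false (edot p.2 t)) ^+ 2).
Proof.
move=> s0; under eq_Rintegral do rewrite -qform_wave//.
have ig (p q : R * 'rV[R]_d) : rho.-integrable D (EFin \o
    (fun t => p.1 * q.1 * - (1 - cos (edot (p.2 - q.2) t)))).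
  have := integrableMcr (- (p.1 * q.1)) mD (integrable_subr1cos (p.2 - q.2)).
  by apply: eq_integrable => // t _ /=; rewrite mulrN mulNr.
rewrite Rintegral_sum//; last first.
  by move=> p; apply: (@integrable_sumr _ _ _ rho _ _ s
    (fun q t => p.1 * q.1 * - (1 - cos (edot (p.2 - q.2) t)))) => // q; exact: ig.
apply: eq_bigr => p _; rewrite (Rintegral_sum s mD (ig p)).
apply: eq_bigr => q _; under eq_Rintegral do rewrite mulrN -mulNr.
rewrite RintegralZl//; last exact: integrable_subr1cos.
by rewrite mulrN mulNr.
Qed.

Lemma cpd_cndf : cpd (fun x y => - cndf rho (x - y)).
Proof.
split=> [x y|s s0]; first by rewrite -cndfN opprB.
by rewrite qform_cndf//; apply: Rintegral_ge0 => t _; rewrite addr_ge0 ?sqr_ge0.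
Qed.

(** The weights 1, 1, -2 at x, y, 0 express the parallelogram law |u - v|^2 + |u + v|^2 = 2 |u|^2 +
    2 |v|^2, with [cndf rho (x - y)] as a squared distance and 0 as the origin. *)
Lemma cndfB_le x y : cndf rho (x - y) <= 2 * cndf rho x + 2 * cndf rho y.
Proof.
pose s : seq (R * 'rV[R]_d) := [:: (1, x); (1, y); (- 2, 0)].
have s0 : \sum_(p <- s) p.1 = 0 by rewrite /s !big_cons !big_nil /=; ring.
have := cpd_cndf.2 s s0.
rewrite /qform /s !big_cons !big_nil /= !subrr !subr0 !sub0r !cndfN cndf0.
by rewrite -(cndfN (y - x)) opprB => h; lra.
Qed.

(* These functions belong to the reproducing space of the kernel [- cndf]. *)
Definition mean_wave (b : bool) (B : set (borelE R d)) (x : 'rV[R]_d) : R :=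
  (fine (rho B))^-1 * \int[rho]_(t in B) wave b (edot x t).

Context (b : bool) (B : set (borelE R d)).
Hypotheses (mB : measurable B) (BD : B `<=` D) (B0 : (0 < rho B)%E)
  (Boo : (rho B < +oo)%E).

Let rB0 : 0 < fine (rho B).
Proof. by apply: fine_gt0; rewrite B0. Qed.

Lemma integrable_bounded_on (f : borelE R d -> R) (M : R) :
  measurable_fun B f -> (forall t, `|f t| <= M) -> rho.-integrable B (EFin \o f).
Proof.
move=> mf fM; apply: measurable_bounded_integrable => //.
by exists M; split; [exact: num_real | move=> y yM t _ /=; apply: le_trans (fM t) (ltW yM)].
Qed.

Lemma integrable_wave (x : 'rV[R]_d) :
  rho.-integrable B (EFin \o (fun t => wave b (edot x t))).
Proof.
apply: (integrable_bounded_on (M := 1)); first exact: measurable_funTS (measurable_wave b x).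
by move=> t; exact: wave_le1.
Qed.

Lemma mean_wave_le1 x : `|mean_wave b B x| <= 1.
Proof.
rewrite normrM ger0_norm ?invr_ge0 ?(ltW rB0)// ler_pdivrMl// mulr1.
apply: le_trans (le_normr_Rintegral mB (integrable_wave x)) _.
have <- : \int[rho]_(t in B) (1 : R) = fine (rho B) by rewrite Rintegral_cst// mul1r.
apply: le_Rintegral => //.
- exact: integrable_norm (integrable_wave x).
- by apply: (integrable_bounded_on (M := 1)) => // t; rewrite normr1.
- by move=> t _; exact: wave_le1.
Qed.

Lemma continuous_mean_wave : continuous (mean_wave b B).
Proof.
apply: seq_continuous => u p up; apply: cvgMl_tmp.
apply: (@Rintegral_dominated_cvg _ _ _ _ _ _ _ (fun=> 1)) => //.
- by move=> n; exact: measurable_funTS (measurable_wave b (u n)).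
- exact: measurable_funTS (measurable_wave b p).
- move=> t _; have ct : edot (u n) t @[n --> \oo] --> edot p t.
    rewrite edotC; under eq_fun do rewrite edotC.
    exact: (cvg_comp _ _ up (@continuous_edot _ _ t p)).
  exact: (cvg_comp _ _ ct (@continuous_wave b _)).
- by apply: (integrable_bounded_on (M := 1)) => // t; rewrite normr1.
- by move=> n t _; exact: wave_le1.
Qed.

(* Jensen's inequality for the uniform distribution on [B]. *)
Lemma mean_wave_dominated (s : seq (R * 'rV[R]_d)) : \sum_(p <- s) p.1 = 0 ->
  (\sum_(p <- s) p.1 * mean_wave b B p.2) ^+ 2 <=
  (fine (rho B))^-1 * qform (fun x y => - cndf rho (x - y)) s.
Proof.
move=> s0; set m := fine (rho B).
pose G t := \sum_(p <- s) p.1 * wave b (edot p.2 t).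
pose M := \sum_(p <- s) `|p.1|.
have GM t : `|G t| <= M.
  rewrite (le_trans (ler_norm_sum _ _ _))// ler_sum// => p _.
  by rewrite normrM ler_piMr// wave_le1.
have mG : measurable_fun B G.
  apply: measurable_sum => p; apply: measurable_funM; first exact: measurable_cst.
  exact: measurable_funTS (measurable_wave b _).
have iG := integrable_bounded_on mG GM.
have M0 : 0 <= M by exact: sumr_ge0.
have G2M t : `|G t ^+ 2| <= M ^+ 2.
  by rewrite normrX ler_sqr ?nnegrE// (le_trans _ (GM 0)).
have iG2 : rho.-integrable B (EFin \o (fun t => G t ^+ 2)).
  by apply: (integrable_bounded_on (M := M ^+ 2)) => //; exact: measurable_funX.
set I := \int[rho]_(t in B) G t.
have -> : \sum_(p <- s) p.1 * mean_wave b B p.2 = m^-1 * I.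
  rewrite /I Rintegral_sum//; last first.
    by move=> p; apply: integrableMcr => //; exact: integrable_wave.
  rewrite mulr_sumr; apply: eq_bigr => p _.
  by rewrite RintegralZl//; [rewrite mulrCA | exact: integrable_wave].
set J := \int[rho]_(t in B) (G t ^+ 2).
have JI : m^-1 * I ^+ 2 <= J.
  (* The mean of [G] over [B]; the integral of [(G t - c) ^+ 2] is nonnegative. *)
  pose c := m^-1 * I.
  have : 0 <= \int[rho]_(t in B) (G t ^+ 2 + (- (2 * c) * G t + c ^+ 2)).
    apply: Rintegral_ge0 => t _; rewrite (_ : _ + _ = (G t - c) ^+ 2) ?sqr_ge0//.
    by ring.
  have ic : rho.-integrable B (EFin \o (fun=> c ^+ 2 : R)).
    by apply: (integrable_bounded_on (M := `|c ^+ 2|)).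
  have iG' := integrableMcr (- (2 * c)) mB iG.
  rewrite RintegralD//; last exact: integrableDr.
  rewrite RintegralD// RintegralZl// Rintegral_cst// -/I -/J -/m.
  rewrite (_ : J + _ = J - m^-1 * I ^+ 2) ?subr_ge0//.
  by rewrite /c; field; rewrite gt_eqF.
rewrite exprMn expr2 -mulrA ler_pM2l ?invr_gt0//; apply: le_trans JI _.
rewrite qform_cndf//.
have iF : rho.-integrable D (EFin \o (fun t =>
  (\sum_(p <- s) p.1 * wave true (edot p.2 t)) ^+ 2 +
  (\sum_(p <- s) p.1 * wave false (edot p.2 t)) ^+ 2)).
  pose f t := \sum_(p <- s) \sum_(q <- s) - (p.1 * q.1) * (1 - cos (edot (p.2 - q.2) t)).
  apply: (@eq_integrable _ _ _ _ _ mD (EFin \o f)).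
    move=> t _ /=; rewrite -qform_wave// /f; congr (_ %:E).
    by apply: eq_bigr => p _; apply: eq_bigr => q _; rewrite mulrN mulNr.
  apply: integrable_sumr => // p; apply: integrable_sumr => // q.
  by apply: integrableMcr => //; exact: integrable_subr1cos.
rewrite (@le_trans _ _ (\int[rho]_(t in B) ((\sum_(p <- s) p.1 * wave true (edot p.2 t)) ^+ 2 +
  (\sum_(p <- s) p.1 * wave false (edot p.2 t)) ^+ 2)))//.
  apply: le_Rintegral => //; first exact: (integrableS mD mB BD iF).
  by move=> t _; rewrite /G; case: (b); [rewrite lerDl|rewrite lerDr]; exact: sqr_ge0.
have F0 t : D t -> (0 <= ((\sum_(p <- s) p.1 * wave true (edot p.2 t)) ^+ 2 +
  (\sum_(p <- s) p.1 * wave false (edot p.2 t)) ^+ 2)%:E)%E.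
  by move=> _; rewrite lee_fin addr_ge0// sqr_ge0.
apply: fine_le.
- exact: (integrable_fin_num mB (integrableS mD mB BD iF)).
- exact: (integrable_fin_num mD iF).
- apply: ge0_subset_integral => //; exact: (measurable_int _ iF).
Qed.

End Cndf.

(** * Bounded pointwise limits *)

Section BoundedLimits.
Context (R : realType) (T : Type).

(** The closure behind the functional monotone class theorem. As an inductive predicate it allows
    limits of limits, and whatever is stable under the constructors holds by induction, without
    transfinite iteration. *)
Inductive blim (B : (T -> R) -> Prop) : (T -> R) -> Prop :=
| blim_base f : B f -> blim B f
| blim_cst c : blim B (fun=> c)
| blim_add f g : blim B f -> blim B g -> blim B (fun x => f x + g x)
| blim_scale c f : blim B f -> blim B (fun x => c * f x)
| blim_lim (f_ : nat -> T -> R) f M : (forall n, blim B (f_ n)) ->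
    (forall n x, `|f_ n x| <= M) ->
    (forall x, f_ n x @[n --> \oo] --> f x) -> blim B f.

Context (B : (T -> R) -> Prop).

Lemma eq_blim f g : f =1 g -> blim B f -> blim B g.
Proof. by move=> /funext ->. Qed.

Lemma blim_trans (B' : (T -> R) -> Prop) f :
  (forall g, B g -> blim B' g) -> blim B f -> blim B' f.
Proof.
move=> BB'; elim=> [g /BB'//|c|g h _ gB _ hB|c g _ gB|g_ g M _ gB gM gg].
- exact: blim_cst.
- exact: blim_add.
- exact: blim_scale.
- exact: blim_lim gB gM gg.
Qed.

Hypothesis bB : forall f, B f -> exists M, forall x, `|f x| <= M.

Lemma blim_bounded f : blim B f -> exists M, forall x, `|f x| <= M.
Proof.
elim=> [g /bB//|c|g h _ [M gM] _ [N hN]|c g _ [M gM]|g_ g M _ _ gM gg].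
- by exists `|c|.
- by exists (M + N) => x; rewrite (le_trans (ler_normD _ _))// lerD.
- by exists (`|c| * M) => x; rewrite normrM ler_wpM2l.
- by exists M => x; apply: (cvgr_to_le (cvg_norm (gg x))); exact: nearW.
Qed.

Hypothesis BM : forall f g, B f -> B g -> blim B (fun x => f x * g x).

(** Two inductions, one per factor: first a base function times a general one, then a general
    function times a fixed general one. *)
Lemma blim_mul f g : blim B f -> blim B g -> blim B (fun x => f x * g x).
Proof.
have base_mul h k : B h -> blim B k -> blim B (fun x => h x * k x).
  move=> Bh; elim=> [l Bl|c|l m _ IHl _ IHm|c l _ IH|l_ l M _ IH lM ll].
  - exact: BM.
  - by apply: eq_blim (blim_scale c (blim_base Bh)) => x; rewrite mulrC.
  - by apply: eq_blim (blim_add IHl IHm) => x; rewrite mulrDr.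
  - by apply: eq_blim (blim_scale c IH) => x; rewrite mulrCA.
  - have [N hN] := bB Bh.
    apply: (blim_lim (M := N * M) IH) => [n x|x]; last exact: cvgMl_tmp.
    by rewrite normrM ler_pM.
move=> + Bg; elim=> [h Bh|c|l m _ IHl _ IHm|c l _ IH|l_ l M _ IH lM ll].
- exact: base_mul.
- exact: blim_scale.
- by apply: eq_blim (blim_add IHl IHm) => x; rewrite mulrDl.
- by apply: eq_blim (blim_scale c IH) => x; rewrite mulrA.
- have [N gN] := blim_bounded Bg.
  apply: (blim_lim (M := M * N) IH) => [n x|x]; last exact: cvgMr_tmp.
  by rewrite normrM ler_pM.
Qed.

Lemma blim_exp f n : blim B f -> blim B (fun x => f x ^+ n).
Proof.
move=> Bf; elim: n => [|n IH].
  by apply: eq_blim (blim_cst B 1) => x; rewrite expr0.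
by apply: eq_blim (blim_mul Bf IH) => x; rewrite exprS.
Qed.

Lemma blim_prod (J : Type) (r : seq J) (f : J -> T -> R) :
  (forall j, blim B (f j)) -> blim B (fun x => \prod_(j <- r) f j x).
Proof.
move=> Bf; elim: r => [|j r IH].
  by apply: eq_blim (blim_cst B 1) => x; rewrite big_nil.
by apply: eq_blim (blim_mul (Bf j) IH) => x; rewrite big_cons.
Qed.

End BoundedLimits.

(** * Indicators of sublevel sets as limits of polynomials *)

Section Threshold.
Context (R : realType).
Implicit Types s : R.

Lemma bernoulli_le (h : R) n : -1 <= h -> 1 + n%:R * h <= (1 + h) ^+ n.
Proof.
move=> h1; elim: n => [|n IH]; first by rewrite mul0r addr0 expr0.
have h0 : 0 <= 1 + h by lra.
rewrite exprS (le_trans _ (ler_wpM2l h0 IH))// -subr_ge0 -natr1.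
rewrite (_ : _ - _ = n%:R * h ^+ 2); last by ring.
by rewrite mulr_ge0// sqr_ge0.
Qed.

Lemma cvg_mulrn_expr s : 0 <= s < 1 -> n%:R * s ^+ n @[n --> \oo] --> (0 : R).
Proof.
move=> /andP[s0 s1]; have [->|sn0] := eqVneq s 0.
  apply: cvg_near_cst; exists 1%N => // -[//|n] _ /=.
  by rewrite expr0n mulr0.
have s_gt0 : 0 < s by rewrite lt_neqAle eq_sym sn0.
(* [s ^+ n] is split into two powers of [r]: one absorbs the factor n by Bernoulli's inequality, the
   other tends to 0. *)
pose r := Num.sqrt s; have r0 : 0 < r by rewrite sqrtr_gt0.
have r1 : r < 1 by rewrite -sqrtr1 ltr_sqrt.
pose h := r^-1 - 1; have h0 : 0 < h by rewrite subr_gt0 invf_gt1.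
have rg : h^-1 * r ^+ n @[n --> \oo] --> (0 : R).
  by rewrite -(mulr0 h^-1); apply: cvgMl_tmp; apply: cvg_expr; rewrite gtr0_norm.
apply: cvg0_squeeze rg; apply: nearW => n.
rewrite mulr_ge0 ?exprn_ge0//= -[s]sqr_sqrtr// -/r -exprM mul2n -addnn exprD.
rewrite mulrA ler_wpM2r ?exprn_ge0 ?(ltW r0)//.
have := @bernoulli_le h n; rewrite /h subrKC exprVn => /(_ _) H.
have {}H : n%:R * h <= (r ^+ n)^-1.
  apply: le_trans (H _); first by rewrite -/h lerDr.
  by rewrite -/h; apply: le_trans (ltW h0); lra.
rewrite -(ler_pM2r h0) mulVf ?gt_eqF// mulrAC.
have rn0 : 0 < r ^+ n by exact: exprn_gt0.
by apply: le_trans (ler_wpM2r (ltW rn0) H) _; rewrite mulVf// gt_eqF.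
Qed.

(** A variant of the polynomials in the elementary proof of the Stone-Weierstrass theorem. Exponent
    times [s ^+ m] equals m (2 s)^m, which tends to 0 for s < 1/2 and is at least m for s >= 1/2.
    The extra factor [m] settles s = 1/2, where (1 - 2^-m)^(2^m) would tend to 1/e. *)
Definition threshold (m : nat) (s : R) : R := (1 - s ^+ m) ^+ (m * 2 ^ m).

Lemma threshold_itv m s : 0 <= s <= 1 -> 0 <= threshold m s <= 1.
Proof.
move=> /andP[s0 s1]; have sm0 : 0 <= s ^+ m by exact: exprn_ge0.
have sm1 : s ^+ m <= 1 by exact: exprn_ile1.
apply/andP; split; first by apply: exprn_ge0; rewrite subr_ge0.
by apply: exprn_ile1; rewrite ?subr_ge0 ?gerBl.
Qed.

Lemma threshold_cvg s : 0 <= s <= 1 ->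
  threshold m s @[m --> \oo] --> ((s < 2^-1 :> R)%R%:R : R).
Proof.
move=> /andP[s0 s1].
have sm m : 0 <= s ^+ m <= 1 by rewrite exprn_ge0// exprn_ile1.
have [sh|sh] := ltP s 2^-1.
  have c0 : m%:R * (2 * s) ^+ m @[m --> \oo] --> (0 : R).
    by apply: cvg_mulrn_expr; apply/andP; split; lra.
  apply: (@squeeze_cvgr _ _ _ _ (fun m => 1 - m%:R * (2 * s) ^+ m) (fun=> 1)).
  - apply: nearW => m; have /andP[m0 m1] := sm m.
    have /andP[_ ->] := threshold_itv m (introT andP (conj s0 s1)); rewrite andbT.
    have := @bernoulli_le (- s ^+ m) (m * 2 ^ m); rewrite lerN2 => /(_ m1).
    by rewrite mulrN natrM natrX exprMn mulrA.
  - by rewrite -[X in _ --> X]subr0; apply: cvgB => //; exact: cvg_cst.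
  - exact: cvg_cst.
have c0 : (m.+1%:R : R)^-1 @[m --> \oo] --> (0 : R) by exact: cvg_harmonic.
apply: cvg0_squeeze c0; apply: nearW => m; have /andP[m0 m1] := sm m.
have /andP[-> _] /= := threshold_itv m (introT andP (conj s0 s1)).
have s2m : 1 <= 2 ^+ m * s ^+ m by rewrite -exprMn exprn_ege1//; lra.
(* With u = [s ^+ m] and k the exponent, (1 - u)^k (1 + u)^k <= 1; Bernoulli's inequality makes the
   second factor at least 1 + m. *)
have H : 1 + m%:R <= (1 + s ^+ m) ^+ (m * 2 ^ m).
  apply: le_trans (bernoulli_le _ _); last by rewrite (le_trans _ m0).
  by rewrite lerD2l natrM natrX -mulrA ler_peMr.
rewrite -natr1 addrC -(ler_pM2r (_ : 0 < 1 + m%:R)); last by rewrite ltr_pwDl.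
rewrite mulVf; last by rewrite gt_eqF// ltr_pwDl.
apply: le_trans (ler_wpM2l _ H) _; first by rewrite exprn_ge0// subr_ge0.
have sm2 : 0 <= (s ^+ m) ^+ 2 <= 1 by rewrite sqr_ge0 exprn_ile1.
rewrite /threshold -exprMn (_ : (1 - _) * _ = 1 - (s ^+ m) ^+ 2); last by ring.
by apply: exprn_ile1; lra.
Qed.

End Threshold.

Section BlimSigmaAlgebra.
Context (R : realType) (T : Type) (B : (T -> R) -> Prop).
Hypothesis bB : forall f, B f -> exists M, forall x, `|f x| <= M.
Hypothesis BM : forall f g, B f -> B g -> blim B (fun x => f x * g x).

Definition blim_set (A : set T) := blim B (\1_A : T -> R).

Lemma blim_set_lt f c : blim B f -> blim_set [set x | f x < c].
Proof.
move=> Bf; have [M fM] := blim_bounded bB Bf.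
(* Rescaling by [K] puts the values of [s] into [0, 1] and sends the level [c] to 1/2, where
   [threshold] jumps. *)
pose K := 2 * (`|M| + `|c| + 1).
have K0 : 0 < K by rewrite mulr_gt0// ltr_wpDl// addr_ge0.
pose s x := 2^-1 + - (c * K^-1) + K^-1 * f x.
have sE x : s x = 2^-1 + (f x - c) / K by rewrite /s; ring.
have s01 x : 0 <= s x <= 1.
  have : `|(f x - c) / K| <= 2^-1.
    rewrite normrM [X in _ * X]gtr0_norm ?invr_gt0// ler_pdivrMr//.
    rewrite /K mulKf// (le_trans (ler_normB _ _))//.
    have := fM x; have := ler_norm M; lra.
  by rewrite ler_norml sE => /andP[h1 h2]; apply/andP; split; lra.
have Bs : blim B s.
  apply: (blim_add (blim_cst B (2^-1 + - (c * K^-1)))).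
  exact: blim_scale.
apply: (blim_lim (f_ := fun m x => threshold m (s x)) (M := 1)).
- move=> m; apply: (blim_exp bB BM); apply: blim_add; first exact: blim_cst.
  apply: (@eq_blim _ _ _ (fun x => -1 * s x ^+ m)) => [x|].
    by rewrite mulN1r.
  by apply: blim_scale; exact: (blim_exp bB BM).
- move=> n x; have /andP[t0 t1] := threshold_itv n (s01 x).
  by rewrite ger0_norm.
- move=> x; rewrite (_ : \1__ x = (s x < 2^-1)%R%:R); first exact: threshold_cvg.
  rewrite indicE; congr (nat_of_bool _)%:R; rewrite sE gtrDl.
  by rewrite pmulr_llt0 ?invr_gt0// subr_lt0; apply/idP/idP; rewrite inE.
Qed.

Lemma blim_setC A : blim_set A -> blim_set (~` A).
Proof.
move=> BA; apply: (@eq_blim _ _ _ (fun x => 1 + -1 * \1_A x)).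
  by move=> x; rewrite !indicE in_setC mulN1r; case: (x \in A); rewrite /= ?subrr ?subr0.
by apply: blim_add; [exact: blim_cst | exact: blim_scale].
Qed.

Lemma blim_bigcap (A : nat -> set T) :
  (forall n, blim_set (A n)) -> blim_set (\bigcap_n A n).
Proof.
move=> BA.
apply: (blim_lim (f_ := fun n x => \prod_(k <- iota 0 n) \1_(A k) x) (M := 1)).
- by move=> n; apply: (blim_prod bB BM) => k; exact: BA.
- move=> n x; rewrite normr_prod prodr_ile1// => k.
  by rewrite indicE; case: (x \in A k); rewrite /= ?normr1 ?normr0 ?lexx ?ler01.
- move=> x; apply: cvg_near_cst; rewrite indicE.
  have [xA|] := boolP (x \in _).
    apply: nearW => n; rewrite big1// => k _; rewrite indicE mem_set//.
    by move: xA; rewrite inE => /(_ k); apply.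
  move=> /negP; rewrite inE => /existsNP[k] /not_implyP[_ xk].
  exists k.+1 => // n /= kn; apply/eqP; rewrite prodf_seq_eq0; apply/hasP.
  exists k; [by rewrite mem_iota | by rewrite /= indicE memNset ?eqxx].
Qed.

Lemma blim_sigma_algebra : sigma_algebra setT blim_set.
Proof.
split=> [|A|A].
- by apply: eq_blim (blim_cst B 0) => x; rewrite indicE in_set0.
- by rewrite setTD; exact: blim_setC.
- move=> BA; rewrite -[\bigcup__ _]setCK setC_bigcup; apply: blim_setC.
  by apply: blim_bigcap => n; exact: blim_setC.
Qed.

End BlimSigmaAlgebra.

(** By second countability an open set is a countable union of cubes with rational centres and radii
    1/(k + 1); membership in a cube is a finite conjunction of conditions on coordinates. *)
Lemma measurable_borel_coord dT (T : measurableType dT) (R : realType) (d : nat)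
    (f : T -> 'rV[R]_d) :
  (forall j, measurable_fun setT (fun x => f x ord0 j)) ->
  measurable_fun setT (f : T -> borelE R d).
Proof.
move=> mf; apply: (@measurability _ _ _ _ setT (f : T -> borelE R d) (@open 'rV[R]_d)) => //.
move=> _ [V oV <-]; rewrite setTI.
pose q_ball (c : 'rV[rat]_d * nat) : set 'rV[R]_d :=
  [set v | forall j, `|ratr (c.1 ord0 j) - v ord0 j| < c.2.+1%:R^-1].
(* Cubes are enumerated by their codes; a code of nothing, or of a cube that leaves [V], contributes
   the empty set. *)
pose U n : set 'rV[R]_d := if (choice.unpickle n : option ('rV[rat]_d * nat)%type) is Some c then
  [set v | q_ball c `<=` V /\ q_ball c v] else set0.
have -> : V = \bigcup_n U n.
  apply/seteqP; split=> [x Vx|x [n _]]; last first.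
    by rewrite /U; case: choice.unpickle => // c [cV]; exact: cV.
  have /nbhs_ballP[e /= e0 eV] := open_nbhs_nbhs (conj oV Vx).
  have e20 : 0 < e / 2 by rewrite divr_gt0.
  have [k _ /(_ k (leqnn k)) /= ke] := near_infty_natSinv_lt (PosNum e20).
  have /choice[q qP] : forall j, exists q : rat,
      `|ratr q - x ord0 j| < k.+1%:R^-1.
    move=> j; have h : x ord0 j - k.+1%:R^-1 < x ord0 j + k.+1%:R^-1.
      by rewrite ltrBlDr -addrA ltrDl addr_gt0 ?invr_gt0.
    have [q qi] := rat_in_itvoo h.
    exists q; rewrite ltr_distl; move: qi; rewrite in_itv/=; exact.
  exists (choice.pickle ((\row_j q j), k)) => //; rewrite /U choice.pickleK; split; last first.
    by move=> j; rewrite mxE.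
  move=> v vq; apply: eV; split => // i j; rewrite (ord1 i) /ball /=.
  have := vq j; rewrite mxE => vj; have := qP j; rewrite distrC => xj.
  have ke2 : k.+1%:R^-1 + k.+1%:R^-1 < e by rewrite [e]splitr; exact: (ltrD ke ke).
  apply: le_lt_trans (ler_distD (ratr (q j)) _ _) _.
  exact: lt_trans (ltrD xj vj) ke2.
rewrite preimage_bigcup; apply: bigcup_measurable => n _; rewrite /U.
case: choice.unpickle => [c|]; last by rewrite preimage_set0.
have [cV|cV] := pselect (q_ball c `<=` V); last first.
  by rewrite (_ : _ @^-1` _ = set0)//; apply/seteqP; split=> // x [].
rewrite (_ : _ @^-1` _ = \bigcap_(j in [set: 'I_d])
    [set x | `|ratr (c.1 ord0 j) - f x ord0 j| < c.2.+1%:R^-1]); last first.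
  apply/seteqP; split=> [x [_ cx] j _|x cx]; first exact: cx.
  by split => // j; exact: cx.
apply: fin_bigcap_measurable => // j _; rewrite -[X in measurable X]setTI.
have mg : measurable_fun setT (fun x => `|ratr (c.1 ord0 j) - f x ord0 j|).
  by apply: measurableT_comp => //; apply: measurable_funB.
rewrite (_ : _ `&` _ = setT `&` (fun x => `|ratr (c.1 ord0 j) - f x ord0 j|) @^-1`
  `]-oo, c.2.+1%:R^-1[%classic).
  by apply: mg => //; exact: measurable_itv.
by congr (_ `&` _); apply/seteqP; split=> x /=; rewrite in_itv.
Qed.

(** * Trigonometric functions generate the bounded Borel indicators *)

Section WaveClosure.
Context (R : realType) (d : nat).

Definition waves (f : 'rV[R]_d -> R) :=
  exists b t, f = fun x => wave b (edot x t).

Lemma waves_bounded f : waves f -> exists M, forall x, `|f x| <= M.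
Proof. by move=> [b [t ->]]; exists 1 => x; exact: wave_le1. Qed.

Lemma waves_mul f g : waves f -> waves g -> blim waves (fun x => f x * g x).
Proof.
have w b t : blim waves (fun x => wave b (edot x t)).
  by apply: blim_base; exists b, t.
have half b b' t t' (c : R) : blim waves (fun x => 2^-1 *
    (wave b (edot x t) + c * wave b' (edot x t'))).
  by apply: blim_scale; apply: blim_add; [exact: w | exact: blim_scale].
have eD (x t t' : 'rV[R]_d) : edot x (t + t') = edot x t + edot x t'.
  by rewrite -big_split; apply: eq_bigr => j _; rewrite mxE mulrDr.
have eB (x t t' : 'rV[R]_d) : edot x (t - t') = edot x t - edot x t'.
  by rewrite edotC edotBl 2!(edotC x).
move=> [b [t ->]] [b' [t' ->]]; case: b; case: b'.
- apply: eq_blim (half true true (t - t') (t + t') 1) => x /=.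
  by rewrite eB eD cosB cosD; field.
- apply: eq_blim (half false false (t + t') (t - t') (-1)) => x /=.
  by rewrite eB eD sinB sinD; field.
- apply: eq_blim (half false false (t + t') (t - t') 1) => x /=.
  by rewrite eB eD sinB sinD; field.
- apply: eq_blim (half true true (t - t') (t + t') (-1)) => x /=.
  by rewrite eB eD cosB cosD; field.
Qed.

(** By the mean value theorem sin u - u = u (cos c - 1) with c between 0 and u. The two extra powers
    of u are what makes rescaled sines converge to the identity. *)
Lemma sinB_le (u : R) : `|sin u - u| <= `|u| * u ^+ 2.
Proof.
wlog u0 : u / 0 <= u.
  move=> h; have [/ltW|] := ltP u 0; last exact: h.
  by rewrite -oppr_ge0 => /h; rewrite sinN -opprD !normrN sqrrN.
have cs : {within `[0, u], continuous (@sin R)}.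
  by apply: continuous_subspaceT => z; exact: continuous_sin.
have [c cu] := MVT_segment u0 (fun z _ => is_derive_sin z) cs.
rewrite sin0 !subr0 => ->; rewrite -[X in _ - X]mul1r -mulrBl normrM mulrC.
rewrite ler_wpM2l// distrC ger0_norm ?subr1cos_ge0//.
move: cu; rewrite in_itv/= => /andP[c0 cu].
by rewrite (le_trans (subr1cos_le c))// ler_sqr ?nnegrE.
Qed.

Lemma cvg_mulrn_sin (u : R) :
  n.+1%:R * sin (n.+1%:R^-1 * u) @[n --> \oo] --> u.
Proof.
have c0 : `|u| * u ^+ 2 * n.+1%:R^-1 @[n --> \oo] --> (0 : R).
  by rewrite -(mulr0 (`|u| * u ^+ 2)); apply: cvgMl_tmp; exact: cvg_harmonic.
apply/subr_cvg0; apply/norm_cvg0P; apply: cvg0_squeeze c0; apply: nearW => n.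
rewrite normr_ge0 /=; have n0 : 0 < n.+1%:R^-1 :> R by rewrite invr_gt0.
rewrite -[X in _ - X](mulVKf (_ : n.+1%:R != 0)) ?pnatr_eq0// -mulrBr normrM.
rewrite ger0_norm//; apply: le_trans (ler_wpM2l _ (sinB_le _)) _ => //.
rewrite normrM exprMn (gtr0_norm n0).
rewrite [leLHS](_ : _ = `|u| * u ^+ 2 * n.+1%:R^-1 * n.+1%:R^-1); last first.
  by field; rewrite addrC natr1 pnatr_eq0.
have n1 : n.+1%:R^-1 <= 1 :> R by rewrite invf_le1 ?ler1n ?ltr0n.
apply: ler_piMr => //; apply: mulr_ge0; last exact: ltW.
by apply: mulr_ge0; [exact: normr_ge0 | exact: sqr_ge0].
Qed.

(* The coordinates are limits of rescaled sines. *)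
Lemma blim_waves_indic (A : set (borelE R d)) : measurable A ->
  blim waves (\1_A : 'rV[R]_d -> R).
Proof.
pose S := blim_set (@waves).
have sS : sigma_algebra setT S := blim_sigma_algebra waves_bounded waves_mul.
have SE : <<s S >> = S by exact: sigma_algebra_id.
pose TS : measurableType _ := g_sigma_algebraType S.
have mw b t : measurable_fun setT (fun x : TS => wave b (edot x t)).
  apply: (measurability _ (RGenInftyO.measurableE R)) => //.
  move=> _ [_ [c ->] <-]; rewrite setTI; apply: sub_sigma_algebra.
  rewrite (_ : _ @^-1` _ = [set x | wave b (edot x t) < c]); last first.
    by apply/seteqP; split=> x /=; rewrite in_itv.
  by apply: (blim_set_lt waves_bounded waves_mul); apply: blim_base; exists b, t.
(* Measurability of the identity from [S] to the Borel sets is the inclusion of the Borel sets in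
   [S]. *)
have mid : measurable_fun setT ((fun x => x) : TS -> borelE R d).
  apply: measurable_borel_coord => j.
  pose f_ n (x : TS) := n.+1%:R * wave false (edot x (n.+1%:R^-1 *: 'e_j)).
  apply: (measurable_fun_cvg (h := f_)) => //.
    by move=> n; apply: measurable_funM; [exact: measurable_cst | exact: mw].
  move=> x _; rewrite /f_ /wave.
  under eq_fun => n.
    rewrite (_ : edot x _ = n.+1%:R^-1 * x ord0 j); last first.
      rewrite /edot (bigD1 j)//= !mxE !eqxx mulr1 mulrC big1 ?addr0// => k kj.
      by rewrite !mxE (negbTE kj) andbF !mulr0.
    over.
  exact: cvg_mulrn_sin.
move=> mA; have := mid measurableT A mA; rewrite setTI preimage_id.
by rewrite /measurable /= SE.
Qed.

End WaveClosure.

(** * Averaged waves and the role of full support *)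

Section MeanWaves.
Context (R : realType) (d : nat) (rho : {measure set (borelE R d) -> \bar R}).
Hypotheses (levy : levy_integrable rho) (supp : full_support rho).

(** A single frequency may carry no mass, and then Jensen's inequality says nothing about its wave;
    averages over sets of positive finite mass are controlled by [- cndf rho]. *)
Definition mean_waves (f : 'rV[R]_d -> R) :=
  exists b (B : set (borelE R d)), [/\ measurable B, B `<=` ~` [set 0],
    (0 < rho B < +oo)%E & f = mean_wave rho b B].

Lemma mean_waves_bounded f : mean_waves f -> forall x, `|f x| <= 1.
Proof.
move=> [b [B [mB BD /andP[B0 Boo] ->]]] x; exact: mean_wave_le1.
Qed.

Lemma mean_waves_measurable f : mean_waves f ->
  measurable_fun setT (f : borelE R d -> R).
Proof.
move=> [b [B [mB BD /andP[B0 Boo] ->]]].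
by apply: continuous_borel_measurable; exact: continuous_mean_wave.
Qed.

Lemma l1_eq0 (t : 'rV[R]_d) : l1 t = 0 -> t = 0.
Proof.
move=> /eqP; rewrite psumr_eq0 => [/allP h|j _]; last exact: normr_ge0.
apply/rowP => j; rewrite mxE; apply/eqP; rewrite -normr_eq0.
by apply: h; rewrite mem_index_enum.
Qed.

Lemma l1_le_enorm (t : 'rV[R]_d) : l1 t <= d%:R * enorm t.
Proof.
rewrite /l1 (le_trans (ler_sum _ (fun j _ => coord_le_enorm t j)))//.
by rewrite sumr_const card_ord mulr_natl.
Qed.

Lemma l1D (s t : 'rV[R]_d) : l1 (s + t) <= l1 s + l1 t.
Proof.
rewrite -big_split; apply: ler_sum => j _; rewrite mxE; exact: ler_normD.
Qed.

Lemma l1N (t : 'rV[R]_d) : l1 (- t) = l1 t.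
Proof. by apply: eq_bigr => j _; rewrite mxE normrN. Qed.

Lemma normr_edot_le_l1 (x t : 'rV[R]_d) : `|edot x t| <= l1 x * l1 t.
Proof.
rewrite /l1 mulr_suml (le_trans (ler_norm_sum _ _ _))//.
apply: ler_sum => j _; rewrite normrM ler_wpM2l//.
by rewrite (bigD1 j)//= lerDl sumr_ge0.
Qed.

Definition l1_ball (t : 'rV[R]_d) (r : R) : set (borelE R d) :=
  [set s : 'rV[R]_d | l1 (s - t) < r].

Lemma open_l1_ball t r : open (l1_ball t r : set 'rV[R]_d).
Proof.
rewrite (_ : l1_ball t r = (fun s => l1 (s - t)) @^-1` `]-oo, r[%classic); last first.
  by apply/seteqP; split=> s /=; rewrite in_itv.
apply: open_comp => [s _|]; last exact: interval_open.
rewrite (_ : (fun s => l1 (s - t)) = fun s => \sum_j `|s ord0 j - t ord0 j|).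
  apply: (cvg_sumr (nbhs_filter s)) => j; apply: (cvg_norm (FF := nbhs_filter s)).
  apply: (cvgB (FF := nbhs_filter s)); first exact: coord_continuous.
  exact: cvg_cst.
by apply/funext => u; apply: eq_bigr => j _; rewrite !mxE.
Qed.

(** The ball stays at distance at least [l1 t / 2] from the origin, so [levy_min], whose integral is
    finite, is bounded away from 0 on it. *)
Lemma l1_ball_finite t r : r <= l1 t / 2 -> (rho (l1_ball t r) < +oo)%E.
Proof.
move=> rt; have [r0|r0] := leP r 0.
  rewrite (_ : l1_ball t r = set0) ?measure0//.
  by apply/seteqP; split=> s //=; rewrite /l1_ball /= ltNge (le_trans r0)// l1_ge0.
have mB : measurable (l1_ball t r) by apply: sub_sigma_algebra; exact: open_l1_ball.
(* [d.+1] rather than [d] keeps the divisor positive. *)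
pose c := l1 t / 2 / d.+1%:R; have c0 : 0 < c.
  by rewrite divr_gt0// (lt_le_trans r0).
have Bc s : l1_ball t r s -> Num.min 1 (c ^+ 2) <= levy_min s.
  rewrite /l1_ball /= => sr; have cs : c <= enorm s.
    rewrite ler_pdivrMr//; apply: le_trans (_ : l1 s <= _).
      have := l1D s (t - s); rewrite addrC subrK -(l1N (t - s)) opprB; lra.
    apply: (le_trans (l1_le_enorm s)); rewrite mulrC ler_wpM2l ?sqrtr_ge0//.
    by rewrite ler_nat.
  rewrite /levy_min le_min ge_min lexx /= ge_min; apply/orP; right.
  by rewrite ler_sqr ?nnegrE ?(ltW c0)// (le_trans (ltW c0)).
have m0 : 0 < Num.min 1 (c ^+ 2) by rewrite lt_min ltr01 exprn_gt0.
have : (\int[rho]_(t in l1_ball t r) (Num.min 1 (c ^+ 2))%:E < +oo)%E.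
  apply: le_lt_trans levy.
  apply: (@le_trans _ _ (\int[rho]_(t in l1_ball t r) (levy_min t)%:E)%E).
    apply: ge0_le_integral => //.
    - by move=> s _; rewrite lee_fin ltW.
    - apply: measurable_funTS; apply/measurable_EFinP; exact: measurable_levy_min.
  apply: ge0_subset_integral => //.
    by apply/measurable_EFinP; exact: measurable_levy_min.
  by move=> s _; rewrite lee_fin; exact: levy_min_ge0.
rewrite integral_cst// => h; rewrite ltNge leye_eq; apply/negP => /eqP hoo.
by move: h; rewrite hoo gt0_muley// lte_fin.
Qed.

(** Waves are Lipschitz in the frequency, so averages over balls shrinking to [t] tend to the wave
    at [t]; full support gives these balls positive mass. At frequency 0 the wave is a constant. *)
Lemma blim_mean_waves f : waves f -> blim mean_waves f.
Proof.
move=> [b [t ->]]; have [->|t0] := eqVneq t 0.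
  apply: eq_blim (blim_cst _ (wave b 0)) => x.
  by rewrite edotC edot0l.
have lt0 : 0 < l1 t.
  rewrite lt_neqAle l1_ge0 andbT; apply: contra t0 => /eqP h.
  by apply/eqP/l1_eq0.
(* The first bound makes the balls shrink; the second keeps the origin out and the mass finite. *)
pose r (n : nat) := Num.min n.+1%:R^-1 (l1 t / 2).
have r0 n : 0 < r n by rewrite lt_min invr_gt0 ltr0n /= divr_gt0.
have mB n : measurable (l1_ball t (r n)).
  by apply: sub_sigma_algebra; exact: open_l1_ball.
have B0 n : (0 < rho (l1_ball t (r n)))%E.
  apply: supp; first exact: open_l1_ball.
  by exists t; rewrite /l1_ball /= subrr /l1 big1// => j _; rewrite mxE normr0.
have Boo n : (rho (l1_ball t (r n)) < +oo)%E.
  by apply: l1_ball_finite; rewrite /r ge_min lexx orbT.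
have BD n : l1_ball t (r n) `<=` ~` [set 0].
  move=> s Bs s0; move: Bs; rewrite s0 /l1_ball /= sub0r l1N.
  rewrite lt_min => /andP[_]; lra.
apply: (blim_lim (f_ := fun n => mean_wave rho b (l1_ball t (r n))) (M := 1)).
- by move=> n; apply: blim_base; exists b, (l1_ball t (r n)); split; rewrite // B0 Boo.
- by move=> n x; exact: mean_wave_le1.
- move=> x; apply/subr_cvg0; apply/norm_cvg0P.
  have c0 : l1 x * n.+1%:R^-1 @[n --> \oo] --> (0 : R).
    by rewrite -(mulr0 (l1 x)); apply: cvgMl_tmp; exact: cvg_harmonic.
  apply: cvg0_squeeze c0; apply: nearW => n; rewrite normr_ge0 /=.
  set B := l1_ball t (r n); set m := fine (rho B).
  have m0 : 0 < m by apply: fine_gt0; rewrite B0 Boo.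
  have icst (c : R) : rho.-integrable B (EFin \o (fun=> c)).
    by apply: (integrable_bounded_on (mB n) (Boo n) (M := `|c|)).
  have iw := integrable_wave b (mB n) (Boo n) x.
  have -> : mean_wave rho b B x - wave b (edot x t) =
      m^-1 * \int[rho]_(s in B) (wave b (edot x s) - wave b (edot x t)).
    rewrite (RintegralB (mB n) iw (icst _)) Rintegral_cst// -/m mulrBr mulrCA mulVf ?gt_eqF//.
    by rewrite mulr1.
  rewrite normrM gtr0_norm ?invr_gt0// ler_pdivrMl//.
  apply: le_trans (le_normr_Rintegral (mB n) _) _; first exact: integrableBr.
  apply: (@le_trans _ _ (\int[rho]_(s in B) (l1 x * n.+1%:R^-1))); last first.
    by rewrite (Rintegral_cst _ (mB n)) -/m mulrC.
  apply: le_Rintegral => //; first exact: integrable_norm (integrableBr (mB n) iw (icst _)).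
  move=> s Bs; apply: (le_trans (wave_lipschitz _ _ _)).
  rewrite 2!(edotC x) -edotBl edotC; apply: (le_trans (normr_edot_le_l1 _ _)).
  rewrite ler_wpM2l ?l1_ge0// ltW//; move: Bs; rewrite /B /l1_ball /=.
  by rewrite lt_min => /andP[].
Qed.

Lemma blim_mean_waves_indic (A : set (borelE R d)) : measurable A ->
  blim mean_waves (\1_A : 'rV[R]_d -> R).
Proof. by move=> /blim_waves_indic; apply: blim_trans => f; exact: blim_mean_waves. Qed.

Lemma mean_waves_dominated f : mean_waves f -> exists2 C : R, 0 < C &
  cpd (fun x y => C * - cndf rho (x - y) - f x * f y).
Proof.
move=> [b [B [mB BD /andP[B0 Boo] ->]]]; exists (fine (rho B))^-1.
  by rewrite invr_gt0 fine_gt0// B0.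
split=> [x y|s s0].
  by rewrite (cpd_cndf levy).1 (mulrC (mean_wave _ _ _ x)).
have := mean_wave_dominated levy b mB BD B0 Boo s0.
rewrite -subr_ge0; congr (_ <= _).
rewrite /qform mulr_sumr expr2 mulr_suml -sumrB; apply: eq_bigr => p _.
rewrite !mulr_sumr -sumrB; apply: eq_bigr => q _; ring.
Qed.

Context dO (Omega : measurableType dO) (P : probability Omega R).
Context (X : {RV P >-> borelE R d}).

Lemma ae_constant_blim f : (forall h, mean_waves h ->
    exists c : R, {ae P, forall w, h (X w) = c}) ->
  blim mean_waves f -> exists c : R, {ae P, forall w, f (X w) = c}.
Proof.
move=> base; elim=> [h /base//|c|g h _ [a ga] _ [b hb]|c g _ [a ga]|g_ g M _ IH gM gg].
- by exists c; apply: aeW.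
- by exists (a + b); apply: filterS2 ga hb => w -> ->.
- by exists (c * a); apply: filterS ga => w ->.
- have /choice[c_ cP] := IH; exists (limn c_).
  have := ae_foralln cP.
  apply: filterS => w /= h; rewrite -(cvg_lim _ (gg (X w)))//.
  by congr (limn _); apply/funext => n; rewrite h.
Qed.

(** Being almost surely constant passes to bounded limits, and the coordinates are recovered from
    countably many sines. Read backwards: if [X] is not constant, some averaged wave of it has
    positive variance. *)
Lemma ae_constant_mean_waves : (forall h, mean_waves h ->
    exists c : R, {ae P, forall w, h (X w) = c}) -> ae_constant X.
Proof.
move=> base.
have cw n j : exists c : R, {ae P, forall w,
    n.+1%:R * sin (n.+1%:R^-1 * X w ord0 j) = c}.
  have wn : waves (fun x : 'rV[R]_d => wave false (edot x (n.+1%:R^-1 *: 'e_j))).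
    by exists false, (n.+1%:R^-1 *: 'e_j).
  have [c cP] := ae_constant_blim base (blim_mean_waves wn).
  exists (n.+1%:R * c); apply: filterS cP => w <-; congr (_ * sin _).
  rewrite /edot (bigD1 j)//= !mxE !eqxx mulr1 mulrC big1 ?addr0// => k kj.
  by rewrite !mxE (negbTE kj) andbF !mulr0.
have /choice[c_ cP] : forall j, exists c : nat -> R, {ae P, forall w, forall n,
    n.+1%:R * sin (n.+1%:R^-1 * X w ord0 j) = c n}.
  move=> j; have /choice[c cP] := cw ^~ j.
  by exists c; apply: ae_foralln.
exists (\row_j limn (c_ j)).
have : {ae P, forall w, forall j n,
    n.+1%:R * sin (n.+1%:R^-1 * X w ord0 j) = c_ j n}.
  by apply: filter_forall => j; exact: cP.
apply: filterS => w h; apply/rowP => j; rewrite mxE.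
rewrite -(cvg_lim _ (@cvg_mulrn_sin R (X w ord0 j)))//.
by congr (limn _); apply/funext => n; rewrite h.
Qed.

End MeanWaves.

(** * Independence criterion *)

Section Multilinear.
Context d (T : measurableType d) (R : realType) (P : probability T R).

Definition bounded_meas (f : T -> R) :=
  measurable_fun setT f /\ exists M, forall x, `|f x| <= M.

Lemma bounded_meas_integrable f : bounded_meas f -> P.-integrable setT (EFin \o f).
Proof.
move=> [mf [M fM]].
apply: le_integrabler (@finite_measure_integrable_cst _ _ _ P _ M measurableT) _ => //.
Qed.

Lemma bounded_meas_cst c : bounded_meas (fun=> c).
Proof. by split; [exact: measurable_cst | exists `|c|]. Qed.

Lemma bounded_measM f g : bounded_meas f -> bounded_meas g ->
  bounded_meas (fun x => f x * g x).
Proof.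
move=> [mf [M fM]] [mg [N gN]]; split; first exact: measurable_funM.
by exists (M * N) => x; rewrite normrM ler_pM.
Qed.

Lemma bounded_measB f g : bounded_meas f -> bounded_meas g ->
  bounded_meas (fun x => f x - g x).
Proof.
move=> [mf [M fM]] [mg [N gN]]; split; first exact: measurable_funB.
by exists (M + N) => x; rewrite (le_trans (ler_normB _ _))// lerD.
Qed.

Lemma bounded_meas_prod (J : Type) (r : seq J) (Q : pred J) (f : J -> T -> R) :
  (forall j, bounded_meas (f j)) ->
  bounded_meas (fun x => \prod_(j <- r | Q j) f j x).
Proof.
move=> bf; elim: r => [|j r IH].
  by under eq_fun do rewrite big_nil; exact: bounded_meas_cst.
under eq_fun do rewrite big_cons; case: (Q j) => //.
exact: bounded_measM.
Qed.

Lemma blim_bounded_meas (B : (T -> R) -> Prop) f :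
  (forall g, B g -> bounded_meas g) -> blim B f -> bounded_meas f.
Proof.
move=> bB Bf; split; last by apply: (blim_bounded _ Bf) => g /bB[].
elim: Bf => [g /bB[]//|c|g h _ mg _ mh|c g _ mg|g_ g M _ mg gM gg].
- exact: measurable_cst.
- exact: measurable_funD.
- by apply: measurable_funM => //; exact: measurable_cst.
- by apply: (measurable_fun_cvg (h := g_)) => // x _; exact: gg.
Qed.

Lemma Rintegral_centredM (f W : T -> R) : bounded_meas f -> bounded_meas W ->
  \int[P]_x ((f x - \int[P]_y f y) * W x) =
  \int[P]_x (f x * W x) - (\int[P]_y f y) * \int[P]_x W x.
Proof.
move=> bf bW; under eq_Rintegral do rewrite mulrBl.
rewrite RintegralB ?RintegralZl//.
- exact: bounded_meas_integrable.
- exact/bounded_meas_integrable/bounded_measM.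
- by apply: integrableMcr => //; exact: bounded_meas_integrable.
Qed.

(** Written as E (f W) = E f E W, the claim is linear in [f] and stable under dominated
    convergence. *)
Lemma blim_orthogonal (B : (T -> R) -> Prop) (W : T -> R) f :
  (forall g, B g -> bounded_meas g) -> bounded_meas W ->
  (forall g, B g -> \int[P]_x ((g x - \int[P]_y g y) * W x) = 0) ->
  blim B f -> \int[P]_x ((f x - \int[P]_y f y) * W x) = 0.
Proof.
move=> bB bW BW Bf; have bm := fun f => @blim_bounded_meas B f bB.
rewrite Rintegral_centredM//; last exact: bm.
have iW := bounded_meas_integrable bW.
elim: Bf => [g Bg|c|g h Bg IHg Bh IHh|c g Bg IH|g_ g M Bg IH gM gg].
- by rewrite -Rintegral_centredM ?BW//; exact: bB.
- by rewrite RintegralZl// Rintegral_cst_probability subrr.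
- rewrite RintegralD//; try by apply: bounded_meas_integrable; exact: bm.
  under eq_Rintegral do rewrite mulrDl.
  rewrite RintegralD//; try by apply/bounded_meas_integrable/bounded_measM => //; exact: bm.
  by rewrite mulrDl opprD addrACA IHg IHh addr0.
- under eq_Rintegral do rewrite -mulrA.
  rewrite RintegralZl//; last by apply/bounded_meas_integrable/bounded_measM => //; exact: bm.
  rewrite RintegralZl//; last by apply/bounded_meas_integrable; exact: bm.
  by rewrite -mulrA -mulrBr IH mulr0.
- have mg := (bm _ (blim_lim Bg gM gg)).1; have mg_ n := (bm _ (Bg n)).1.
  have [mW [N WN]] := bW.
  have c1 : \int[P]_x (g_ n x * W x) @[n --> \oo] --> \int[P]_x (g x * W x).
    apply: (@Rintegral_dominated_cvg _ _ _ _ _ _ _ (fun=> M * N)) => //.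
    - by move=> n; exact: measurable_funM.
    - exact: measurable_funM.
    - by move=> x _; exact: cvgMr_tmp.
    - exact: finite_measure_integrable_cst.
    - by move=> n x _; rewrite normrM ler_pM.
  have c2 : \int[P]_x g_ n x @[n --> \oo] --> \int[P]_x g x.
    apply: (@Rintegral_dominated_cvg _ _ _ _ _ _ _ (fun=> M)) => //.
    exact: finite_measure_integrable_cst.
  have : \int[P]_x (g_ n x * W x) - (\int[P]_y g_ n y) * \int[P]_x W x
      @[n --> \oo] --> \int[P]_x (g x * W x) - (\int[P]_y g y) * \int[P]_x W x.
    by apply: cvgB => //; exact: cvgMr_tmp.
  under eq_fun do rewrite IH.
  by move=> /(cvg_lim (@Rhausdorff R)) <-; rewrite lim_cst.
Qed.

(** The arguments are released one by one: at stage [k] the first [k] are general and the others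
    still in their base classes, and the factors other than the current one form the weight [W] of
    [blim_orthogonal]. *)
Lemma blim_multilinear (n : nat) (B : 'I_n -> (T -> R) -> Prop)
    (f : 'I_n -> T -> R) :
  (forall i g, B i g -> bounded_meas g) ->
  (forall g, (forall i, B i (g i)) ->
    \int[P]_x \prod_(i < n) (g i x - \int[P]_y g i y) = 0) ->
  (forall i, blim (B i) (f i)) ->
  \int[P]_x \prod_(i < n) (f i x - \int[P]_y f i y) = 0.
Proof.
move=> bB B0.
suff H k : (k <= n)%N -> forall f, (forall i : 'I_n, (i < k)%N -> blim (B i) (f i)) ->
    (forall i : 'I_n, (k <= i)%N -> B i (f i)) ->
    \int[P]_x \prod_(i < n) (f i x - \int[P]_y f i y) = 0.
  move=> Bf; apply: (H n (leqnn n) f) => [i _|i]; first exact: Bf.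
  by rewrite leqNgt ltn_ord.
elim: k => [|k IH] kn {}f f1 f2; first by apply: B0 => i; exact: f2.
pose k0 := Ordinal kn.
pose W x := \prod_(i < n | i != k0) (f i x - \int[P]_y f i y).
have bf i : bounded_meas (f i).
  have [ik|ik] := ltnP i k.+1; last by apply: bB; exact: f2.
  by apply: blim_bounded_meas (f1 i ik) => g; exact: bB.
have bW : bounded_meas W.
  by apply: bounded_meas_prod => i; apply: bounded_measB => //; exact: bounded_meas_cst.
under eq_Rintegral do rewrite (bigD1 k0)//= -/(W _).
apply: (blim_orthogonal (bB k0)) (f1 k0 (ltnSn k)) => // g Bg.
pose f' i := if i == k0 then g else f i.
have := IH (ltnW kn) f' _ _.
under eq_Rintegral do rewrite (bigD1 k0)//= {1 2}/f' eqxx.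
move=> <- => [|i ik|i ki].
- apply: eq_Rintegral => x _; congr (_ * _); apply: eq_bigr => i /negbTE ik.
  by rewrite /f' ik.
- have ik0 : i != k0 by rewrite -val_eqE /= ltn_eqF.
  by rewrite /f' (negbTE ik0); apply: f1; exact: leqW.
- rewrite /f'; case: eqVneq => [->//|ik]; apply: f2.
  by rewrite ltn_neqAle ki andbT eq_sym.
Qed.

End Multilinear.

Section IndependenceCriterion.
Context (dO : measure_display) (Omega : measurableType dO) (R : realType)
  (P : probability Omega R).

Lemma prod_fset_setT (n : nat) (J : {fset 'I_n}) (F : 'I_n -> R) :
  \prod_(i <- J) F i = \prod_(i < n) (if i \in J then F i else 1).
Proof.
rewrite -[RHS]big_mkcond /= -[RHS]big_filter; apply: perm_big; apply: uniq_perm.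
- exact: fset_uniq.
- by rewrite filter_uniq// index_enum_uniq.
- by move=> i; rewrite mem_filter mem_index_enum andbT.
Qed.

Lemma mutually_independentP (n : nat) (dT : 'I_n -> measure_display)
    (T : forall i, measurableType (dT i)) (X : forall i, {RV P >-> T i}) :
  mutually_independent X <->
  forall A : forall i, set (T i), (forall i, measurable (A i)) ->
    P (\bigcap_(i in [set: 'I_n]) (X i @^-1` A i)) =
    (\prod_(i < n) fine (P (X i @^-1` A i)))%:E.
Proof.
split=> [indX A mA|H J A mA].
  have := indX [fset i | i in 'I_n]%fset A mA; rewrite prod_fset_setT.
  rewrite (_ : [set` _] = setT); last first.
    by apply/seteqP; split=> i //= _; rewrite inE.
  by move=> ->; congr (_%:E); apply: eq_bigr => i _; rewrite inE.
pose A' i := if i \in J then A i else setT.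
have mA' i : measurable (A' i) by rewrite /A'; case: ifP.
have := H A' mA'; rewrite prod_fset_setT (_ : \bigcap_(i in setT) _ =
    \bigcap_(i in [set` J]) (X i @^-1` A i)).
  move=> ->; congr (_%:E); apply: eq_bigr => i _; rewrite /A'.
  by case: ifP => // _; rewrite preimage_setT probability_setT.
apply/seteqP; split=> w h i => [iJ|_]; first by have := h i I; rewrite /A' /= iJ.
by rewrite /A' /=; case: ifP => // iJ; exact: h.
Qed.

(** [lift i0] is an injective enumeration of the [n.-1] indices other than [i0]. *)
Lemma m_independent_except (n : nat) (dT : 'I_n -> measure_display)
    (T : forall i, measurableType (dT i)) (X : forall i, {RV P >-> T i})
    (A : forall i, set (T i)) (i0 : 'I_n) :
  m_independent n.-1 X -> (forall i, measurable (A i)) -> A i0 = setT ->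
  P (\bigcap_(i in [set: 'I_n]) (X i @^-1` A i)) =
  (\prod_(i < n) fine (P (X i @^-1` A i)))%:E.
Proof.
case: n dT T X A i0 => [|n] dT T X A i0 indX mA Ai0; first by have := ltn_ord i0.
have := (mutually_independentP _).1 (indX (lift i0) lift_inj)
  (fun j => A (lift i0 j)) (fun j => mA (lift i0 j)).
rewrite (_ : \bigcap_(i in setT) _ = \bigcap_(i in [set: 'I_n.+1]) (X i @^-1` A i)).
  move=> ->; congr (_%:E); rewrite (bigD1_ord i0)//= Ai0 preimage_setT.
  by rewrite probability_setT mul1r.
apply/seteqP; split=> w h i _; last exact: h.
have [j ij|ii0] := unliftP i0 i; first by rewrite ij; exact: (h j I).
by rewrite ii0 /= Ai0.
Qed.

Lemma prod_indic (n : nat) (A : 'I_n -> set Omega) w :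
  \prod_(i < n) (\1_(A i) w : R) = \1_(\bigcap_(i in [set: 'I_n]) A i) w.
Proof.
rewrite indicE; have [h|h] := boolP (_ \in _).
  rewrite big1// => i _; rewrite indicE mem_set//.
  by move: h; rewrite inE => /(_ i); apply.
move: h => /negP; rewrite inE => /existsNP[i] /not_implyP[_ wi].
by apply/eqP; rewrite prodf_seq_eq0; apply/hasP; exists i;
  rewrite ?mem_index_enum//= indicE memNset.
Qed.

Lemma Rintegral_indic (A : set Omega) : measurable A ->
  \int[P]_w (\1_A w) = fine (P A).
Proof. by move=> mA; rewrite /Rintegral integral_indic// setIT. Qed.

Lemma bounded_meas_indic (A : set Omega) : measurable A ->
  bounded_meas (\1_A : Omega -> R).
Proof.
move=> mA; split => //; exists 1 => w.
by rewrite indicE; case: (w \in A); rewrite /= ?normr1 ?normr0.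
Qed.

Context (n : nat) (d : 'I_n -> nat)
  (rho : forall i, {measure set (borelE R (d i)) -> \bar R}).
Hypotheses (levy : forall i, levy_integrable (rho i))
  (supp : forall i, full_support (rho i)).
Context (X : forall i, {RV P >-> borelE R (d i)}).

Lemma measurable_preimage i (A : set (borelE R (d i))) :
  measurable A -> measurable (X i @^-1` A).
Proof. by move=> mA; rewrite -[_ @^-1` _]setTI; exact: (measurable_funPT (X i)). Qed.

(** Passing from averaged waves to indicators gives E prod_i (1_(A_i) - p_i) = 0. In the expansion
    over subsets J of indices every term but the one for the full set factorises by
    (n-1)-independence; the equation then determines the last term, P (X_i in A_i for all i). *)
Lemma mean_waves_independent : (0 < n)%N -> m_independent n.-1 X ->
  (forall h : forall i, 'rV[R]_(d i) -> R, (forall i, mean_waves (rho i) (h i)) ->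
    \int[P]_w (\prod_(i < n) (h i (X i w) - \int[P]_v h i (X i v))) = 0) ->
  mutually_independent X.
Proof.
move=> n0 indX h0; apply/mutually_independentP => A mA.
pose p i := fine (P (X i @^-1` A i)).
pose B i (f : Omega -> R) := exists2 h, mean_waves (rho i) h & f = fun w => h (X i w).
have bB i f : B i f -> bounded_meas f.
  move=> [h hm ->]; split.
    apply: (@measurableT_comp _ _ _ Omega (borelE R (d i)) _ h); last exact: measurable_funPT.
    exact: (mean_waves_measurable hm).
  by exists 1 => w; exact: mean_waves_bounded hm _.
have B0 f : (forall i, B i (f i)) ->
    \int[P]_w \prod_(i < n) (f i w - \int[P]_v f i v) = 0.
  move=> Bf; have h i : {h | mean_waves (rho i) h & f i = fun w => h (X i w)}.
    by apply: cid2; exact: Bf.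
  have fE i w : f i w = s2val (h i) (X i w).
    exact: (congr1 (fun g : Omega -> R => g w) (s2valP' (h i))).
  have <- := h0 (fun i => s2val (h i)) (fun i => s2valP (h i)).
  apply: eq_Rintegral => w _; apply: eq_bigr => i _.
  by rewrite fE; congr (_ - _); apply: eq_Rintegral => v _; exact: fE.
have BA i : blim (B i) (\1_(X i @^-1` A i)).
  have := blim_mean_waves_indic (levy i) (@supp i) (mA i).
  rewrite (_ : \1_(_ @^-1` _) = fun w => \1_(A i) (X i w))//.
  elim=> [g gm|c|g k _ IHg _ IHk|c g _ IH|g_ g M _ IH gM gg].
  - by apply: blim_base; exists g.
  - exact: blim_cst.
  - exact: blim_add.
  - exact: blim_scale.
  - by apply: (blim_lim (M := M) IH) => [k w|w].
have mX i := measurable_preimage (mA i).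
have := blim_multilinear bB B0 BA.
under eq_Rintegral => w _.
  under eq_bigr => i _ do rewrite (Rintegral_indic (mX i)).
  rewrite bigA_distr.
  over.
pose G (J : {set 'I_n}) w : R := \prod_i (if i \in J then \1_(X i @^-1` A i) w else - p i).
have bG J : bounded_meas (G J).
  apply: bounded_meas_prod => i; case: (i \in J); last exact: bounded_meas_cst.
  exact: bounded_meas_indic.
rewrite (_ : \int[P]_w _ = \int[P]_w (\sum_(J : {set 'I_n}) G J w))//.
rewrite Rintegral_sum//; last by move=> J; exact: (bounded_meas_integrable P (bG J)).
have IG (J : {set 'I_n}) : J != finset.setT -> \int[P]_w G J w =
    \prod_i (if i \in J then p i else - p i).
  rewrite -finset.subTset => /subsetPn[i0 _ i0J].
  pose A' i := if i \in J then A i else setT.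
  have mA' i : measurable (A' i) by rewrite /A'; case: ifP.
  have A'0 : A' i0 = setT by rewrite /A' (negbTE i0J).
  pose c i := if i \in J then 1 else - p i.
  have mX' i := measurable_preimage (mA' i).
  transitivity (\int[P]_w ((\prod_i c i) * \prod_i \1_(X i @^-1` A' i) w)).
    apply: eq_Rintegral => w _; rewrite -big_split; apply: eq_bigr => i _.
    rewrite /c /A'; case: ifP => _ /=; first by rewrite mul1r.
    by rewrite preimage_setT indicE in_setT mulr1.
  rewrite RintegralZl//; last first.
    apply: bounded_meas_integrable; apply: bounded_meas_prod => i.
    exact: bounded_meas_indic.
  under eq_Rintegral do rewrite prod_indic.
  rewrite Rintegral_indic; last by apply: fin_bigcap_measurable.
  rewrite (m_independent_except indX mA' A'0) /= -big_split.
  apply: eq_bigr => i _; rewrite /c /A'; case: ifP => _ /=; first by rewrite mul1r.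
  by rewrite preimage_setT probability_setT mulr1.
rewrite (bigD1 finset.setT)//= (eq_bigr _ IG).
(* If the top term factorised as well, the sum would be prod_i (p_i - p_i) = 0, an empty product
   being excluded by [n0]. Both sums vanish and differ in that term only, so it does factorise. *)
have : \sum_(J : {set 'I_n}) \prod_i (if i \in J then p i else - p i) = 0.
  rewrite -bigA_distr; apply/eqP; rewrite prodf_seq_eq0; apply/hasP.
  by exists (Ordinal n0); rewrite ?mem_index_enum//= subrr.
rewrite (bigD1 finset.setT)//=.
have -> : \int[P]_w G finset.setT w = fine (P (\bigcap_(i in [set: 'I_n]) X i @^-1` A i)).
  rewrite -Rintegral_indic; last by apply: fin_bigcap_measurable.
  apply: eq_Rintegral => w _; rewrite -prod_indic; apply: eq_bigr => i _.
  by rewrite finset.in_setT.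
rewrite (_ : \prod_i _ = \prod_(i < n) p i); last first.
  by apply: eq_bigr => i _; rewrite finset.in_setT.
move=> h1 h2; have Pp := addIr _ (etrans h1 (esym h2)).
rewrite [in RHS]Pp fineK// fin_num_measure//.
by apply: fin_bigcap_measurable.
Qed.

End IndependenceCriterion.

(** * Expectations of products *)

Section IndependentProduct.
Context d d1 d2 (T : measurableType d) (E1 : measurableType d1)
  (E2 : measurableType d2) (R : realType).
Context (P : probability T R) (mu1 : probability E1 R) (mu2 : probability E2 R).
Context (U : T -> E1) (V : T -> E2) (f : E1 -> R) (g : E2 -> R).
Hypotheses (mU : measurable_fun setT U) (mV : measurable_fun setT V)
  (lawUV : forall A B, measurable A -> measurable B ->
    P (U @^-1` A `&` V @^-1` B) = (mu1 A * mu2 B)%E)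
  (fi : mu1.-integrable setT (EFin \o f)) (gi : mu2.-integrable setT (EFin \o g)).

Let F (z : E1 * E2) : R := f z.1 * g z.2.

Let mf : measurable_fun setT f. Proof. exact: integrable_measurable fi. Qed.
Let mg : measurable_fun setT g. Proof. exact: integrable_measurable gi. Qed.

Let mF : measurable_fun setT F.
Proof.
apply: measurable_funM.
  exact: measurableT_comp mf measurable_fst.
exact: measurableT_comp mg measurable_snd.
Qed.

Let iF : (mu1 \x mu2)%E.-integrable setT (EFin \o F).
Proof.
apply/integrable12ltyP; first exact/measurable_EFinP.
have [_ foo] := integrableP _ _ _ fi; have [_ goo] := integrableP _ _ _ gi.
rewrite (_ : (\int[mu1]_x _)%E = ((\int[mu1]_x `|(f x)%:E|) * \int[mu2]_y `|(g y)%:E|)%E).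
  by rewrite lte_mul_pinfty ?integral_ge0// ge0_fin_numE// integral_ge0.
rewrite -ge0_integralZr//; last 2 first.
- by do 2 apply: measurableT_comp => //.
- exact: integral_ge0.
apply: eq_integral => x _; rewrite -ge0_integralZl//.
- by apply: eq_integral => y _; rewrite /F /= normrM EFinM.
- by do 2 apply: measurableT_comp => //.
Qed.

Lemma indep_integrableM : P.-integrable setT (EFin \o (fun w => f (U w) * g (V w))).
Proof.
exact: (integrable_law (measurable_fun_pair mU mV) (pair_law mU mV lawUV) iF).
Qed.

Lemma indep_RintegralM :
  \int[P]_w (f (U w) * g (V w)) = (\int[mu1]_x f x) * \int[mu2]_y g y.
Proof.
rewrite (Rintegral_law (measurable_fun_pair mU mV) (pair_law mU mV lawUV) iF).
rewrite {1}/Rintegral -integral12_prod_meas1// -[RHS]mulrC -RintegralZl//.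
congr fine; apply: eq_integral => x _; rewrite /fubini_F /F /=.
under eq_integral do rewrite EFinM.
rewrite integralZl// mulrC EFinM; congr (_ * _)%E.
by rewrite fineK//; apply: integrable_fin_num gi.
Qed.

End IndependentProduct.

Section Blocks.
Context (R : realType) (n : nat) (d : 'I_n -> nat).

Lemma measurable_coord i :
  measurable_fun setT (fun x : prodE R d => x i : borelE R (d i)).
Proof.
move=> _ A mA; rewrite setTI; apply: sub_sigma_algebra.
by exists i => //; exists A; rewrite ?setTI.
Qed.

Lemma measurable_tuple dT (T : measurableType dT) (f : forall i, T -> borelE R (d i)) :
  (forall i, measurable_fun setT (f i)) ->
  measurable_fun setT ((fun x i => f i x) : T -> prodE R d).
Proof.
move=> mf; apply: (@measurability _ _ _ _ setT ((fun x i => f i x) : T -> prodE R d)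
  (cylinders (d := d))) => //.
move=> _ [_ [i _ [B mB <-]] <-]; rewrite !setTI -[X in measurable X]setTI.
exact: mf.
Qed.

Context (dO : measure_display) (Omega : measurableType dO)
  (P : probability Omega R) (X : forall i, {RV P >-> borelE R (d i)}).
Hypothesis indX : mutually_independent X.

(** Coordinates outside [S] become 0 instead of being dropped, so that all blocks live in the same
    space. *)
Definition masked (S : pred 'I_n) (w : Omega) : prodE R d :=
  fun i => if S i then X i w else 0.

Lemma measurable_masked S : measurable_fun setT (masked S).
Proof.
apply: (measurable_tuple (f := fun i w => if S i then X i w else 0)) => i.
by case: (S i); [exact: measurable_funPT | exact: measurable_cst].
Qed.

(** As functions of [C] both sides are finite measures; they agree on rectangles, which are stable
    under intersection and generate the product sigma-algebra. *)
Lemma masked_independent (S : pred 'I_n) k (A : set (borelE R (d k)))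
    (C : set (prodE R d)) : ~~ S k -> measurable A -> measurable C ->
  P (X k @^-1` A `&` masked S @^-1` C) = (P (X k @^-1` A) * P (masked S @^-1` C))%E.
Proof.
move=> Sk mA mC; have mXA := measurable_preimage X mA.
have mM := measurable_masked S.
pose rect := [set D : set (prodE R d) | exists2 B : forall i, set (borelE R (d i)),
  forall i, measurable (B i) & D = \bigcap_(i in [set: 'I_n]) ((fun x => x i) @^-1` B i)].
pose M_mixin := isMeasurableFun.Build _ _ _ _ _ mM.
pose M : {mfun Omega >-> prodE R d} := MeasurableFun.Pack (MeasurableFun.Class M_mixin).
pose m1 : {measure set (prodE R d) -> \bar R} := pushforward (mrestr P mXA) M.
have pA0 : 0 <= fine (P (X k @^-1` A)) by exact: fine_ge0.
pose m2 : {measure set (prodE R d) -> \bar R} :=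
  mscale (NngNum pA0) (pushforward P M).
suff : m1 mM C = m2 mM C.
  rewrite /m1 /m2 /= /mscale /= /pushforward /mrestr /= => H.
  by rewrite setIC H fineK// fin_num_measure.
have rectT : rect setT.
  exists (fun=> setT) => //; apply/seteqP; split => // x _ i _ //.
have rectm : rect `<=` measurable.
  move=> _ [B mB ->]; apply: fin_bigcap_measurable => // i _.
  by rewrite -[X in measurable X]setTI; exact: measurable_coord.
apply: (measure_unique rect (fun=> setT)) => //.
- apply/seteqP; split.
    apply: smallest_sub; first exact: smallest_sigma_algebra.
    move=> _ [i _ [B mB <-]]; apply: sub_sigma_algebra.
    exists (dfwith (fun=> setT) i B).
      by move=> j; case: dfwithP.
    apply/seteqP; split=> [x [_ xB] j _ /=|x xB]; first by case: dfwithP.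
    by split => //; have := xB i I; rewrite /= dfwithin.
  apply: smallest_sub; last exact: rectm.
  exact: (@sigma_algebra_measurable _ (prodE R d)).
- move=> _ _ [B mB ->] [B' mB' ->]; exists (fun i => B i `&` B' i).
    by move=> i; exact: measurableI.
  by rewrite -bigcapI.
- by apply/seteqP; split=> // x _; exists 0%N.
(* A masked coordinate is constantly 0, so its condition holds everywhere or nowhere, according to
   whether 0 lies in [B i]. *)
- move=> _ [B mB ->]; pose B0 i := if S i then B i else
    if `[< B i 0 >] then setT else set0.
  have mB0 i : measurable (B0 i) by rewrite /B0; case: ifP => // _; case: ifP.
  have MB : masked S @^-1` (\bigcap_(i in [set: 'I_n]) ((fun x => x i) @^-1` B i)) =
      \bigcap_(i in [set: 'I_n]) (X i @^-1` B0 i).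
    apply/seteqP; split=> w h i _; have := h i I; rewrite /B0 /masked /=.
      by case: (S i) => //; case: asboolP.
    by case: (S i) => //; case: asboolP.
  rewrite /m1 /m2 /= /mscale /= /pushforward /mrestr /= MB.
  pose A0 i := if i == k then X k @^-1` A else setT.
  have -> : \bigcap_(i in [set: 'I_n]) (X i @^-1` B0 i) `&` X k @^-1` A =
    \bigcap_(i in [set: 'I_n]) (X i @^-1` (B0 i `&` dfwith (fun=> setT) k A i)).
    apply/seteqP; split=> w.
      move=> [h wA] i _; split; first exact: h.
      by move: wA; case: dfwithP.
    by move=> h; split=> [i _|]; [have [] := h i I | have [_] := h k I; rewrite dfwithin].
  have mBA i : measurable (B0 i `&` dfwith (fun=> setT) k A i).
    by apply: measurableI => //; case: dfwithP.
  rewrite ((mutually_independentP X).1 indX _ mBA) ((mutually_independentP X).1 indX _ mB0).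
  rewrite -EFinM; congr (_%:E); rewrite (bigD1 k)//= [in RHS](bigD1 k)//= dfwithin.
  rewrite mulrA; congr (_ * _).
    rewrite /B0 (negbTE Sk); case: asboolP => _.
      by rewrite setTI preimage_setT probability_setT mulr1.
    by rewrite set0I preimage_set0 measure0 mulr0.
  by apply: eq_bigr => i ik; rewrite dfwithout 1?eq_sym// setIT.
- move=> i; rewrite /m1 /= /pushforward /mrestr /=.
  by rewrite preimage_setT setTI (le_lt_trans (probability_le1 P mXA)) ?ltry.
Qed.

(** Induction on [r]: the first variable is independent of the block of the remaining ones, and
    Fubini's theorem splits off its factor. *)
Lemma indep_prod (r : seq 'I_n) (f : forall i, borelE R (d i) -> R) : uniq r ->
  (forall i, measurable_fun setT (f i)) ->
  (forall i, P.-integrable setT (EFin \o (fun w => f i (X i w)))) ->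
  P.-integrable setT (EFin \o (fun w => \prod_(i <- r) f i (X i w))) /\
  \int[P]_w \prod_(i <- r) f i (X i w) = \prod_(i <- r) \int[P]_w f i (X i w).
Proof.
move=> + mf fi; elim: r => [_|k r IH /= /andP[kr ur]].
  split; last by under eq_Rintegral do rewrite big_nil; rewrite Rintegral_cst_probability big_nil.
  under eq_fun do rewrite big_nil; exact: finite_measure_integrable_cst.
have [ir Er] := IH ur.
pose G (x : prodE R d) := \prod_(i <- r) f i (x i).
have GE w : G (masked (mem r) w) = \prod_(i <- r) f i (X i w).
  by rewrite /G !big_seq; apply: eq_bigr => i /= ir'; rewrite /masked /= ir'.
have mG : measurable_fun setT G.
  apply: measurable_prod => i _.
  apply: (@measurableT_comp _ _ _ (prodE R d) (borelE R (d i)) _ (f i)); first exact: mf.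
  exact: measurable_coord.
have mM := measurable_masked (mem r).
pose M_mixin := isMeasurableFun.Build _ _ _ _ _ mM.
pose M : {mfun Omega >-> prodE R d} := MeasurableFun.Pack (MeasurableFun.Class M_mixin).
pose mu2 := distribution P M; pose mu1 := distribution P (X k).
have lawM C : measurable C -> P (masked (mem r) @^-1` C) = mu2 C by [].
have lawX C : measurable C -> P (X k @^-1` C) = mu1 C by [].
have lawXM A C : measurable A -> measurable C ->
    P (X k @^-1` A `&` masked (mem r) @^-1` C) = (mu1 A * mu2 C)%E.
  by move=> mA mC; exact: masked_independent.
have iG' : P.-integrable setT (EFin \o (fun w => G (masked (mem r) w))).
  by under eq_fun do rewrite GE.
have iG := law_integrable mM lawM mG iG'.
have mXk : measurable_fun setT (X k) by exact: measurable_funPT.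
have ifk := law_integrable mXk lawX (mf k) (fi k).
have eqF : (fun w => \prod_(i <- k :: r) f i (X i w)) =
    (fun w => f k (X k w) * G (masked (mem r) w)).
  by apply/funext => w; rewrite big_cons GE.
split; first by rewrite eqF; exact: (indep_integrableM mXk mM lawXM ifk iG).
rewrite eqF (indep_RintegralM mXk mM lawXM ifk iG) big_cons.
rewrite -(Rintegral_law mXk lawX ifk) -(Rintegral_law mM lawM iG).
by rewrite -Er; congr (_ * _); apply: eq_Rintegral => w _; exact: GE.
Qed.

End Blocks.

(** * The centred kernel *)

Lemma Rintegral_affine d (T : measurableType d) (R : realType)
    (P : probability T R) (f g : T -> R) (a b : R) :
  P.-integrable setT (EFin \o f) -> P.-integrable setT (EFin \o g) ->
  \int[P]_x (f x + a - g x - b) = \int[P]_x f x + a - \int[P]_x g x - b.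
Proof.
move=> fi gi; have ic c := @finite_measure_integrable_cst _ _ _ P _ c measurableT.
have i1 := integrableDr measurableT fi (ic a).
rewrite (RintegralB measurableT (integrableBr measurableT i1 gi) (ic b)).
rewrite (RintegralB measurableT i1 gi) (RintegralD measurableT fi (ic a)).
by rewrite !Rintegral_cst_probability.
Qed.

Section CentredKernel.
Context (R : realType) (d : nat) (rho : {measure set (borelE R d) -> \bar R}).
Hypothesis levy : levy_integrable rho.
Context (nu : probability (borelE R d) R).
Local Notation psi := (cndf rho).
Hypothesis ipsi : nu.-integrable setT (EFin \o psi).

Definition mean_cndf (x : 'rV[R]_d) : R := \int[nu]_y psi (x - y).

Definition mean2_cndf : R := \int[nu]_x mean_cndf x.

(** The kernel [- psi (x - y)] centred in both variables with respect to [nu]: the population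
    counterpart of the matrix A_i. *)
Definition ckernel (x y : 'rV[R]_d) : R :=
  mean_cndf x + mean_cndf y - psi (x - y) - mean2_cndf.

Lemma measurable_cndf : measurable_fun setT (psi : borelE R d -> R).
Proof. by apply: continuous_borel_measurable; exact: continuous_cndf. Qed.

Lemma measurable_cndfB :
  measurable_fun setT (fun z : borelE R d * borelE R d => psi (z.1 - z.2)).
Proof.
have mB : measurable_fun setT
    (fun z : borelE R d * borelE R d => (z.1 - z.2 : 'rV[R]_d) : borelE R d).
  apply: measurable_borel_coord => j.
  under eq_fun do rewrite !mxE.
  have mj : measurable_fun setT (fun x : borelE R d => x ord0 j).
    by apply: continuous_borel_measurable; exact: coord_continuous.
  apply: measurable_funB.
    exact: measurableT_comp mj measurable_fst.
  exact: measurableT_comp mj measurable_snd.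
exact: measurableT_comp measurable_cndf mB.
Qed.

Lemma integrable_cndfB x : nu.-integrable setT (EFin \o (fun y => psi (x - y))).
Proof.
have i1 := integrableMcr 2 measurableT ipsi.
have i2 := @finite_measure_integrable_cst _ _ _ nu _ (2 * psi x) measurableT.
apply: le_integrabler (integrableDr measurableT i2 i1) _ => //.
  exact: measurable_fun_pair2 measurable_cndfB.
by move=> y _; rewrite ger0_norm ?cndf_ge0//; exact: cndfB_le.
Qed.

Lemma mean_cndf_ge0 x : 0 <= mean_cndf x.
Proof. by apply: Rintegral_ge0 => y _; exact: cndf_ge0. Qed.

Lemma measurable_mean_cndf : measurable_fun setT (mean_cndf : borelE R d -> R).
Proof.
have mf : measurable_fun setT
    (fun z : borelE R d * borelE R d => (psi (z.1 - z.2))%:E).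
  by apply/measurable_EFinP; exact: measurable_cndfB.
have f0 z : (0 <= (fun z : borelE R d * borelE R d => (psi (z.1 - z.2))%:E) z)%E.
  by rewrite lee_fin cndf_ge0.
have mF := @measurable_fun_fubini_tonelli_F _ _ _ _ _ nu _ mf f0.
exact: measurableT_comp (fine_measurable measurableT) mF.
Qed.

Lemma integrable_mean_cndf : nu.-integrable setT (EFin \o mean_cndf).
Proof.
have i1 := integrableMcr 2 measurableT ipsi.
have i2 := @finite_measure_integrable_cst _ _ _ nu _ (2 * \int[nu]_y psi y) measurableT.
apply: le_integrabler (integrableDr measurableT i1 i2) _ => //.
  exact: measurable_mean_cndf.
move=> x _; rewrite ger0_norm ?mean_cndf_ge0//.
change (mean_cndf x <= 2 * psi x + 2 * \int[nu]_y psi y).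
rewrite -(RintegralZl 2 measurableT ipsi).
rewrite -[X in X + _](Rintegral_cst_probability nu).
have ic := @finite_measure_integrable_cst _ _ _ nu _ (2 * psi x) measurableT.
have i3 := integrableMcr 2 measurableT ipsi.
rewrite -RintegralD//; apply: le_Rintegral => //.
- exact: integrable_cndfB.
- exact: integrableDr.
- by move=> y _; exact: cndfB_le.
Qed.

Lemma mean2_cndf_ge0 : 0 <= mean2_cndf.
Proof. by apply: Rintegral_ge0 => x _; exact: mean_cndf_ge0. Qed.

Lemma measurable_ckernel : measurable_fun setT
  (fun z : borelE R d * borelE R d => ckernel z.1 z.2).
Proof.
have mr := measurable_mean_cndf.
apply: measurable_funB; last exact: measurable_cst.
apply: measurable_funB; last exact: measurable_cndfB.
apply: measurable_funD.
  exact: measurableT_comp mr measurable_fst.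
exact: measurableT_comp mr measurable_snd.
Qed.

Lemma ckernel_diag x : ckernel x x = 2 * mean_cndf x - mean2_cndf.
Proof.
rewrite /ckernel subrr cndf0//; move: (mean_cndf x) mean2_cndf => r c; ring.
Qed.

Lemma integrable_ckernel_diag : nu.-integrable setT (EFin \o (fun x => ckernel x x)).
Proof.
under eq_fun do rewrite ckernel_diag.
apply: integrableBr => //; last exact: finite_measure_integrable_cst.
by apply: integrableMcr => //; exact: integrable_mean_cndf.
Qed.

Lemma integrable_cndfBl y : nu.-integrable setT (EFin \o (fun x => psi (x - y))).
Proof.
apply: (@eq_integrable _ _ _ _ _ measurableT
  (EFin \o (fun x : borelE R d => psi (y - x)))).
  by move=> x _ /=; rewrite -cndfN opprB.
exact: integrable_cndfB.
Qed.

Lemma integrable_ckernel y : nu.-integrable setT (EFin \o (fun x => ckernel x y)).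
Proof.
have ic c := @finite_measure_integrable_cst _ _ _ nu _ c measurableT.
have i1 := integrableDr measurableT integrable_mean_cndf (ic (mean_cndf y)).
exact: (integrableBr measurableT
  (integrableBr measurableT i1 (integrable_cndfBl y)) (ic mean2_cndf)).
Qed.

Lemma Rintegral_ckernel y : \int[nu]_x ckernel x y = 0.
Proof.
have ir := integrable_mean_cndf; have iB := integrable_cndfBl y.
have EB : \int[nu]_x psi (x - y) = mean_cndf y.
  by apply: eq_Rintegral => x _; rewrite -cndfN opprB.
rewrite /ckernel (Rintegral_affine _ _ ir iB) EB -/mean2_cndf; ring.
Qed.

Lemma qform_ckernel (s : seq (R * 'rV[R]_d)) :
  qform ckernel s = qform (fun x y => - psi (x - y)) s +
    2 * (\sum_(p <- s) p.1) * (\sum_(p <- s) p.1 * mean_cndf p.2) -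
    (\sum_(p <- s) p.1) ^+ 2 * mean2_cndf.
Proof.
set S := \sum_(p <- s) p.1; set V := \sum_(p <- s) _ * mean_cndf _.
transitivity (\sum_(p <- s) (\sum_(q <- s) p.1 * q.1 * - psi (p.2 - q.2) +
    (p.1 * mean_cndf p.2 * S + p.1 * V - p.1 * S * mean2_cndf))).
  apply: eq_bigr => p _; rewrite mulr_sumr mulr_sumr mulr_sumr mulr_suml.
  rewrite -big_split -sumrB -big_split; apply: eq_bigr => q _ /=.
  rewrite /ckernel; move: (mean_cndf p.2) (mean_cndf q.2) (psi _) mean2_cndf.
  by move=> r1 r2 u c; ring.
rewrite big_split -addrA; congr (_ + _); rewrite sumrB big_split /= -!mulr_suml -/S -/V.
by move: mean2_cndf => c; ring.
Qed.

Context d' (T : measurableType d') (P : probability T R) (Y : nat -> T -> borelE R d).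
Hypotheses (mY : forall k, measurable_fun setT (Y k))
  (lawY : forall k A, measurable A -> P (Y k @^-1` A) = nu A)
  (indY : forall j k, j != k -> forall A B, measurable A -> measurable B ->
    P (Y j @^-1` A `&` Y k @^-1` B) = (nu A * nu B)%E).

Let psiB_law x k : \int[P]_w psi (x - Y k w) = mean_cndf x.
Proof. exact: (Rintegral_law (mY k) (lawY k) (integrable_cndfB x)). Qed.

Let integrable_psiB x k : P.-integrable setT (EFin \o (fun w => psi (x - Y k w))).
Proof. exact: (integrable_law (mY k) (lawY k) (integrable_cndfB x)). Qed.

Let integrable_psiBB j k : P.-integrable setT (EFin \o (fun w => psi (Y j w - Y k w))).
Proof.
have ip l := integrableMcr 2 measurableT (integrable_law (mY l) (lawY l) ipsi).
apply: le_integrabler (integrableDr measurableT (ip j) (ip k)) _ => //.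
  exact: measurableT_comp measurable_cndfB (measurable_fun_pair (mY j) (mY k)).
by move=> w _; rewrite ger0_norm ?cndf_ge0//; exact: cndfB_le.
Qed.

Let psiBB_law j k : j != k -> \int[P]_w psi (Y j w - Y k w) = mean2_cndf.
Proof.
move=> jk; have mjk := measurable_fun_pair (mY j) (mY k).
have ljk := pair_law (mY j) (mY k) (indY jk).
have ijk := law_integrable mjk ljk measurable_cndfB (integrable_psiBB j k).
rewrite (Rintegral_law mjk ljk ijk) {1}/Rintegral -integral12_prod_meas1//.
congr fine; apply: eq_integral => x _; rewrite /fubini_F /=.
by rewrite /mean_cndf fineK//; apply: integrable_fin_num (integrable_cndfB x).
Qed.

(* Conditional positivity for the points of [s] together with [M] random
   points of equal weights that make the total weight vanish; take means and
   let [M] tend to infinity. *)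
Lemma psd_ckernel : psd ckernel.
Proof.
split=> [x y|s].
  have psiC : psi (y - x) = psi (x - y) by rewrite -cndfN opprB.
  rewrite /ckernel psiC; move: (mean_cndf x) (mean_cndf y) (psi _) => r1 r2 u; ring.
rewrite qform_ckernel; set q0 := qform _ s; set A := \sum_(p <- s) p.1.
set V := \sum_(p <- s) _; set c := mean2_cndf.
have key (M : nat) : (0 < M)%N -> 0 <= q0 + 2 * A * V - A ^+ 2 * c + A ^+ 2 * c / M%:R.
  move=> M0; have Mn0 : M%:R != 0 :> R by rewrite pnatr_eq0 -lt0n.
  pose a := - A / M%:R.
  pose Q w := q0 + (- 2 * a * (\sum_(p <- s) \sum_(l < M) p.1 * psi (p.2 - Y l w)) -
    a ^+ 2 * \sum_(l < M) \sum_(k < M) psi (Y l w - Y k w)).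
  have Q0 w : 0 <= Q w.
    have := (cpd_cndf levy).2 (s ++ [seq (a, Y l w) | l : 'I_M <- index_enum 'I_M]).
    rewrite big_cat big_map /= -/A sumr_const card_ord.
    rewrite (_ : A + _ = 0); last by rewrite -mulr_natr /a; field.
    move=> /(_ erefl); rewrite /qform big_cat big_map /=.
    under eq_bigr do rewrite big_cat big_map /=.
    under [X in _ + X]eq_bigr do rewrite big_cat big_map /=.
    rewrite !big_split /=; set X0 := \sum_(p <- s) _.
    have -> : X0 = q0 by [].
    set X1 := \sum_(p <- s) _; set X2 := \sum_(l < M) _; set X3 := \sum_(l < M) _.
    have X1E : X1 = - a * \sum_(p <- s) \sum_(l < M) p.1 * psi (p.2 - Y l w).
      rewrite mulr_sumr; apply: eq_bigr => p _; rewrite mulr_sumr.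
      by apply: eq_bigr => l _; move: (psi _) => u; ring.
    have X2E : X2 = X1.
      rewrite /X2 exchange_big /X1; apply: eq_bigr => p _; apply: eq_bigr => l _.
      by rewrite -cndfN opprB (mulrC a).
    have X3E : X3 = - a ^+ 2 * \sum_(l < M) \sum_(k < M) psi (Y l w - Y k w).
      rewrite mulr_sumr; apply: eq_bigr => l _; rewrite mulr_sumr.
      by apply: eq_bigr => k _; move: (psi _) => u; ring.
    have alg (q1 b u v : R) :
        q1 + - b * u + (- b * u + - b ^+ 2 * v) = q1 + (- 2 * b * u - b ^+ 2 * v).
      by ring.
    by rewrite X2E X1E X3E alg.
  have i1 : P.-integrable setT
      (EFin \o (fun w => \sum_(p <- s) \sum_(l < M) p.1 * psi (p.2 - Y l w))).
    apply: integrable_sumr => // p.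
    apply: (@integrable_sumr _ _ _ P _ _ _ (fun (l : 'I_M) w => p.1 * psi (p.2 - Y l w))) => // l.
    by apply: integrableMcr.
  have i2 : P.-integrable setT (EFin \o (fun w => \sum_(l < M) \sum_(k < M) psi (Y l w - Y k w))).
    apply: integrable_sumr => // l.
    by apply: (@integrable_sumr _ _ _ P _ _ _ (fun (k : 'I_M) w => psi (Y l w - Y k w))).
  have : 0 <= \int[P]_w Q w by apply: Rintegral_ge0 => w _; exact: Q0.
  rewrite RintegralD//; last 2 first.
  - exact: finite_measure_integrable_cst.
  - by apply: integrableBr => //; apply: integrableMcr.
  rewrite (Rintegral_cst_probability P q0) RintegralB//; last 2 first.
  - exact: integrableMcr.
  - exact: integrableMcr.
  rewrite !RintegralZl//.
  have -> : \int[P]_w (\sum_(p <- s) \sum_(l < M) p.1 * psi (p.2 - Y l w)) = M%:R * V.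
    rewrite Rintegral_sum//; last first.
      move=> p; apply: (@integrable_sumr _ _ _ P _ _ _
        (fun (l : 'I_M) w => p.1 * psi (p.2 - Y l w))) => // l.
      by apply: integrableMcr.
    rewrite mulr_sumr; apply: eq_bigr => p _.
    rewrite (@Rintegral_sum _ _ _ P setT _ _
      (fun (l : 'I_M) w => p.1 * psi (p.2 - Y l w)))//; last first.
      by move=> l; apply: integrableMcr.
    under eq_bigr do rewrite RintegralZl// psiB_law.
    by rewrite sumr_const card_ord mulr_natl.
  (* Only the M^2 - M pairs of distinct points count, because psi vanishes at 0; hence the error
     term A^2 c / M in [key]. *)
  have -> : \int[P]_w (\sum_(l < M) \sum_(k < M) psi (Y l w - Y k w)) = (M%:R ^+ 2 - M%:R) * c.
    rewrite Rintegral_sum//; last first.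
      by move=> l; apply: (@integrable_sumr _ _ _ P _ _ _
        (fun (k : 'I_M) w => psi (Y l w - Y k w))).
    transitivity (\sum_(l < M) (M%:R * c - c)).
      apply: eq_bigr => l _.
      rewrite (@Rintegral_sum _ _ _ P setT _ _ (fun (k : 'I_M) w => psi (Y l w - Y k w)))//.
      rewrite (bigD1 l)//=; under eq_Rintegral do rewrite subrr cndf0.
      rewrite (Rintegral_cst_probability P 0) add0r.
      rewrite (eq_bigr (fun=> c)); last first.
        by move=> k kl; rewrite psiBB_law// eq_sym.
      rewrite sumr_const cardC1 card_ord -[in LHS]mulr_natl -subn1 natrB//.
      by rewrite mulrBl mul1r.
    have alg (m c' : R) : m * (m * c' - c') = (m ^+ 2 - m) * c' by ring.
    by rewrite sumr_const card_ord -[LHS]mulr_natl alg.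
  have alg (q1 v c' : R) : q1 + (- 2 * (- A / M%:R) * (M%:R * v) -
      (- A / M%:R) ^+ 2 * ((M%:R ^+ 2 - M%:R) * c')) =
      q1 + 2 * A * v - A ^+ 2 * c' + A ^+ 2 * c' / M%:R by field.
  by rewrite /a alg.
rewrite leNgt; apply/negP => neg.
set q := q0 + _ - _ in neg key.
have c0 : 0 <= A ^+ 2 * c by rewrite mulr_ge0 ?sqr_ge0// mean2_cndf_ge0.
have [M MB] : exists M : nat, A ^+ 2 * c / - q < M%:R.
  by exists (Num.truncn (A ^+ 2 * c / - q)).+1; exact: real_truncnS_gt (num_real _).
have M0 : (0 < M)%N.
  by rewrite -(ltr0n R) (le_lt_trans _ MB)// divr_ge0// oppr_ge0 ltW.
have := key M M0; rewrite leNgt => /negP; apply.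
move: MB; rewrite ltr_pdivrMr ?oppr_gt0// => MB.
by rewrite -ltrBrDl sub0r ltr_pdivrMr ?ltr0n// (mulrC (- q)).
Qed.

End CentredKernel.

(** * Bounds for the sample multivariance *)

Section DoubleSums.
Context (R : realFieldType) (N : nat) (a : 'I_N -> R).

Lemma sum_pair_add : \sum_(j < N) \sum_(k < N) (2 * a j + 2 * a k) =
  4 * N%:R * \sum_(j < N) a j.
Proof.
set S := \sum_(j < N) a j.
transitivity (\sum_(j < N) (N%:R * (2 * a j) + 2 * S)).
  by apply: eq_bigr => j _; rewrite big_split /= sumr_const card_ord -[_ *+ N]mulr_natl -mulr_sumr.
rewrite big_split /= sumr_const card_ord -[_ *+ N]mulr_natl -!mulr_sumr -/S.
by ring.
Qed.

Lemma sum_pair_sqrB : \sum_(j < N) \sum_(k < N) (a j - a k) ^+ 2 =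
  2 * N%:R * (\sum_(j < N) a j ^+ 2) - 2 * (\sum_(j < N) a j) ^+ 2.
Proof.
set S := \sum_(j < N) a j; set Q := \sum_(j < N) _ ^+ 2.
transitivity (\sum_(j < N) (N%:R * a j ^+ 2 - 2 * S * a j + Q)).
  apply: eq_bigr => j _.
  transitivity (\sum_(k < N) (a j ^+ 2 + - (2 * a j) * a k + a k ^+ 2)).
    by apply: eq_bigr => k _; ring.
  rewrite !big_split /= sumr_const card_ord -[_ *+ N]mulr_natl -mulr_sumr -/S -/Q.
  by ring.
rewrite big_split /= sumrB sumr_const card_ord -[_ *+ N]mulr_natl -!mulr_sumr.
by rewrite -/S -/Q; ring.
Qed.

End DoubleSums.

Section SampleBounds.
Context (R : realType) (n : nat) (d : 'I_n -> nat)
  (psi : forall i, 'rV[R]_(d i) -> R).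
Context (N : nat) (x : 'I_N -> forall i, 'rV[R]_(d i)).
Hypothesis N0 : (0 < N)%N.

Definition cdist i : 'I_N -> 'I_N -> R :=
  conjk (@cent R N) (fun p q => - psi (x p i - x q i)).

Lemma cdistmxE i j k : cdistmx psi x i j k = cdist i j k.
Proof.
rewrite /cdistmx !mxE -sumrN /cdist /conjk exchange_big; apply: eq_bigr => q _ /=.
rewrite !mxE mulr_suml -sumrN; apply: eq_bigr => p _.
by rewrite !mxE /cent [q == k]eq_sym; ring.
Qed.

Definition cdist_mean : R :=
  (N%:R ^+ 2)^-1 * \sum_(j < N) \sum_(k < N) \prod_(i < n) cdist i j k.

Lemma multivariance2E : (forall i, 0 < mean_psi psi x i) ->
  multivariance2 psi x = (\prod_(i < n) mean_psi psi x i)^-1 * cdist_mean.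
Proof.
move=> m0; rewrite /multivariance2 /cdist_mean mulrCA; congr (_ * _).
rewrite mulr_sumr; apply: eq_bigr => j _; rewrite mulr_sumr; apply: eq_bigr => k _.
rewrite -prodfV -big_split; apply: eq_bigr => i _ /=.
by rewrite /ncdistmx m0 mxE cdistmxE.
Qed.

Lemma mean_psi_le i : (forall y z, psi (y - z : 'rV[R]_(d i)) <= 2 * psi y + 2 * psi z) ->
  mean_psi psi x i <= 4 * (N%:R^-1 * \sum_(j < N) psi (x j i)).
Proof.
move=> psiB; rewrite /mean_psi.
have Nn0 : N%:R != 0 :> R by rewrite pnatr_eq0 -lt0n.
have -> : 4 * (N%:R^-1 * \sum_(j < N) psi (x j i)) = (N%:R ^+ 2)^-1 *
    \sum_(j < N) \sum_(k < N) (2 * psi (x j i) + 2 * psi (x k i)).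
  by rewrite (sum_pair_add (fun j => psi (x j i))); field.
rewrite ler_wpM2l ?invr_ge0 ?sqr_ge0//.
by apply: ler_sum => j _; apply: ler_sum => k _.
Qed.

(** Weights 1 and -1 in [cpd] give (h y - h z)^2 <= 2 C psi (y - z); the mean over all pairs of the
    left-hand side is twice the sample variance of [h]. *)
Lemma mean_psi_ge i (h : 'rV[R]_(d i) -> R) (C : R) : 0 < C ->
  (forall y z, psi (y - z : 'rV[R]_(d i)) = psi (z - y)) -> psi (0 : 'rV[R]_(d i)) = 0 ->
  cpd (fun y z => C * - psi (y - z) - h y * h z) ->
  C^-1 * (N%:R^-1 * (\sum_(j < N) h (x j i) ^+ 2) -
    (N%:R^-1 * \sum_(j < N) h (x j i)) ^+ 2) <= mean_psi psi x i.
Proof.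
move=> C0 psiC psi0 hC; rewrite ler_pdivrMl//.
have h2 y z : (h y - h z) ^+ 2 <= 2 * C * psi (y - z : 'rV[R]_(d i)).
  pose s : seq (R * 'rV[R]_(d i)) := [:: (1, y); (-1, z)].
  have s0 : \sum_(p <- s) p.1 = 0 by rewrite !big_cons big_nil /=; ring.
  have := hC.2 s s0; rewrite /qform !big_cons !big_nil /= !subrr psi0 (psiC z).
  move: (psi _) => u; nra.
have Nn0 : N%:R != 0 :> R by rewrite pnatr_eq0 -lt0n.
have -> : N%:R^-1 * (\sum_(j < N) h (x j i) ^+ 2) - (N%:R^-1 * \sum_(j < N) h (x j i)) ^+ 2 =
    (N%:R ^+ 2)^-1 * (2^-1 * \sum_(j < N) \sum_(k < N) (h (x j i) - h (x k i)) ^+ 2).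
  by rewrite (sum_pair_sqrB (fun j => h (x j i))); field.
rewrite /mean_psi [leRHS]mulrCA ler_wpM2l ?invr_ge0 ?sqr_ge0// ler_pdivrMl// mulrA.
rewrite mulr_sumr; apply: ler_sum => j _; rewrite mulr_sumr; apply: ler_sum => k _.
exact: h2.
Qed.

(** Centring both kernels makes C_i A_i dominate the rank one matrix of the sample-centred h_i.
    Entrywise products keep the domination, and the sum of all entries of a product of rank one
    matrices is a square. *)
Lemma cdist_mean_ge (h : forall i, 'rV[R]_(d i) -> R) (C : 'I_n -> R) :
  (forall i, 0 < C i) ->
  (forall i, cpd (fun y z => C i * - psi (y - z : 'rV[R]_(d i)) - h i y * h i z)) ->
  (\prod_(i < n) C i)^-1 * (N%:R^-1 * \sum_(j < N) \prod_(i < n)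
    (h i (x j i) - N%:R^-1 * \sum_(k < N) h i (x k i))) ^+ 2 <= cdist_mean.
Proof.
move=> C0 hC.
pose g i j := h i (x j i) - N%:R^-1 * \sum_(k < N) h i (x k i).
have gE i j k : g i j * g i k =
    conjk (@cent R N) (fun p q => h i (x p i) * h i (x q i)) j k.
  by rewrite conjk_rank1 !sum_cent_mul.
have psdg i : psd (fun j k => g i j * g i k) by exact: psd_rank1.
have psdB i : psd (fun j k => C i * cdist i j k - g i j * g i k).
  have := cpd_conjk_cent (cpd_comp (fun j => x j i) (hC i)).
  apply: eq_psd => j k; rewrite gE /cdist -conjkZ -[X in _ - X]mul1r -mulNr -conjkZ -conjkD.
  by rewrite /conjk; apply: eq_bigr => p _; apply: eq_bigr => q _; rewrite mulN1r.
have := psd_sum_ge0 (index_enum 'I_N) (fun=> 1) id (psd_prodB (index_enum 'I_n) psdg psdB).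
under eq_bigr do under eq_bigr do rewrite !mul1r.
under eq_bigr do rewrite sumrB; rewrite sumrB subr_ge0 => H.
rewrite ler_pdivrMl ?prodr_gt0// exprMn /cdist_mean [leRHS]mulrCA exprVn.
apply: ler_wpM2l; first by rewrite invr_ge0 sqr_ge0.
move: H; congr (_ <= _).
  rewrite expr2 mulr_suml; apply: eq_bigr => j _; rewrite mulr_sumr.
  by apply: eq_bigr => k _; rewrite -big_split.
rewrite mulr_sumr; apply: eq_bigr => j _; rewrite mulr_sumr; apply: eq_bigr => k _.
by rewrite -big_split.
Qed.

(** For a singleton this is the sample mean q_i; for the empty set it is 1 as soon as N > 0. *)
Definition kernel_mean (K : forall i, 'rV[R]_(d i) -> 'rV[R]_(d i) -> R)
    (J : {set 'I_n}) : R :=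
  (N%:R ^+ 2)^-1 * \sum_(j < N) \sum_(k < N)
    \prod_(i < n) (if i \in J then K i (x j i) (x k i) else 1).

(** The sum over [J] is the expansion of prod_i (2 K_i + 2 q_i). The functions [f i], by which [K i]
    differs from the distance kernel, are removed by the centring. *)
Lemma cdist_mean_le (K : forall i, 'rV[R]_(d i) -> 'rV[R]_(d i) -> R)
    (f : forall i, 'rV[R]_(d i) -> R) :
  (forall i, psd (K i)) ->
  (forall i y z, - psi (y - z : 'rV[R]_(d i)) = K i y z + f i y + f i z) ->
  0 <= cdist_mean <= \sum_(J : {set 'I_n}) 2 ^+ n *
    ((\prod_(i < n) (if i \in J then 1 else kernel_mean K [set i]%SET)) *
      kernel_mean K J).
Proof.
move=> pK psiK; set q := kernel_mean K.
have cE i j k : cdist i j k = conjk (@cent R N) (fun p q => K i (x p i) (x q i)) j k.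
  rewrite -(conjk_cent_shift _ (fun p => f i (x p i))) /cdist /conjk.
  by apply: eq_bigr => p _; apply: eq_bigr => r _; rewrite psiK.
have pKx i : psd (fun p r => K i (x p i) (x r i)) by exact: (psd_comp (fun p => x p i) (pK i)).
have psdc i : psd (cdist i) by apply: eq_psd (psd_conjk (@cent R N) (pKx i)) => j k.
have qi i : (N%:R ^+ 2)^-1 * (\sum_(p < N) \sum_(r < N) K i (x p i) (x r i)) = q [set i]%SET.
  congr (_ * _); apply: eq_bigr => p _; apply: eq_bigr => r _.
  rewrite (bigD1 i)//= finset.set11 big1 ?mulr1// => k ki.
  by rewrite finset.in_set1 (negbTE ki).
have psdB i : psd (fun j k => (2 * K i (x j i) (x k i) + 2 * q [set i]%SET) - cdist i j k).
  by have := psd_conjk_cent_le (pKx i); rewrite qi; apply: eq_psd => j k; rewrite cE.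
have N2 : 0 <= (N%:R ^+ 2 : R)^-1 by rewrite invr_ge0 sqr_ge0.
apply/andP; split.
  rewrite mulr_ge0//.
  have := psd_sum_ge0 (index_enum 'I_N) (fun=> 1) id (psd_prod (index_enum 'I_n) psdc).
  by under eq_bigr do under eq_bigr do rewrite !mul1r.
have := psd_sum_ge0 (index_enum 'I_N) (fun=> 1) id (psd_prodB (index_enum 'I_n) psdc psdB).
under eq_bigr do under eq_bigr do rewrite !mul1r.
under eq_bigr do rewrite sumrB; rewrite sumrB subr_ge0 => H.
apply: le_trans (ler_wpM2l N2 H) _; rewrite le_eqVlt; apply/orP; left; apply/eqP.
transitivity ((N%:R ^+ 2)^-1 * \sum_(j < N) \sum_(k < N) \sum_(J : {set 'I_n})
    2 ^+ n * ((\prod_(i < n) (if i \in J then 1 else q [set i]%SET)) *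
      \prod_(i < n) (if i \in J then K i (x j i) (x k i) else 1))).
  congr (_ * _); apply: eq_bigr => j _; apply: eq_bigr => k _.
  rewrite bigA_distr; apply: eq_bigr => J _.
  have -> : 2 ^+ n = \prod_(i < n) (2 : R) by rewrite prodr_const card_ord.
  rewrite -!big_split; apply: eq_bigr => i _ /=.
  by case: (i \in J); rewrite ?mul1r ?mulr1.
under [in LHS]eq_bigr do rewrite exchange_big; rewrite exchange_big mulr_sumr.
apply: eq_bigr => J _ /=.
set s := \prod_(i < n) _; rewrite /q /kernel_mean.
transitivity ((N%:R ^+ 2)^-1 * (2 ^+ n * s * \sum_(j < N) \sum_(k < N)
    \prod_(i < n) (if i \in J then K i (x j i) (x k i) else 1))); last by ring.
congr (_ * _); rewrite mulr_sumr; apply: eq_bigr => j _; rewrite mulr_sumr.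
by apply: eq_bigr => k _; rewrite mulrA.
Qed.

End SampleBounds.

(** * Laws and almost sure limits of the sample *)

Section Samples.
Context (R : realType) (n : nat) (d : 'I_n -> nat)
  (dO : measure_display) (Omega : measurableType dO) (P : probability Omega R)
  (X : forall i, {RV P >-> borelE R (d i)})
  (Xc : nat -> forall i, {RV P >-> borelE R (d i)}).
Hypothesis Xc_law : forall k, same_law (P := P) (joint (Xc k)) (joint X).
Hypothesis Xc_ind : mutually_independent (P := P) (fun k => joint (Xc k)).

Let mu : probability (prodE R d) R := distribution P (joint X).

Lemma sample_law k (A : set (prodE R d)) : measurable A ->
  P (joint (Xc k) @^-1` A) = mu A.
Proof. by move=> mA; exact: Xc_law. Qed.

Lemma sample_indep j k : j != k -> forall A B : set (prodE R d),
  measurable A -> measurable B ->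
  P (joint (Xc j) @^-1` A `&` joint (Xc k) @^-1` B) = (mu A * mu B)%E.
Proof.
move=> jk A B mA mB.
have mAB i : measurable ((fun i => if i == j then A else B) i) by case: ifP.
have := Xc_ind [fset j; k]%fset mAB.
rewrite big_fsetU1 ?inE//= big_seq_fset1 eqxx eq_sym (negbTE jk) => H.
rewrite -(sample_law j mA) -(sample_law k mB).
have fin (l : nat) C : measurable C -> P (joint (Xc l) @^-1` C) \is a fin_num.
  by move=> mC; rewrite sample_law// fin_num_measure.
rewrite -(fineK (fin j A mA)) -(fineK (fin k B mB)) -EFinM -H; congr (P _).
apply/seteqP; split=> [w [wA wB] l /=|w wAB].
  by rewrite !inE => /orP[] /eqP ->; rewrite ?eqxx// eq_sym (negbTE jk).
split.
  by have := wAB j; rewrite /= !inE !eqxx; apply.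
by have := wAB k; rewrite /= !inE !eqxx orbT eq_sym (negbTE jk); apply.
Qed.

Lemma sample_measurable k : measurable_fun setT (joint (Xc k)).
Proof. exact: measurable_joint. Qed.

Lemma coord_measurable k i : measurable_fun setT (Xc k i).
Proof. exact: (measurable_funPT (Xc k i)). Qed.

Let measurable_coord_preimage i (A : set (borelE R (d i))) : measurable A ->
  measurable ((fun x : prodE R d => x i : borelE R (d i)) @^-1` A).
Proof. by move=> mA; rewrite -[_ @^-1` _]setTI; exact: measurable_coord. Qed.

Lemma coord_law i k (A : set (borelE R (d i))) : measurable A ->
  P (Xc k i @^-1` A) = distribution P (X i) A.
Proof. by move=> mA; exact: (sample_law k (measurable_coord_preimage mA)). Qed.

Lemma coord_indep i j k : j != k -> forall A B : set (borelE R (d i)),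
  measurable A -> measurable B ->
  P (Xc j i @^-1` A `&` Xc k i @^-1` B) =
  (distribution P (X i) A * distribution P (X i) B)%E.
Proof.
move=> jk A B mA mB.
exact: (sample_indep jk (measurable_coord_preimage mA) (measurable_coord_preimage mB)).
Qed.

Lemma sample_mean_cvg (h : prodE R d -> R) (M : R) : measurable_fun setT h ->
  (forall x, `|h x| <= M) ->
  {ae P, forall w, N%:R^-1 * \sum_(j < N) h (joint (Xc j) w) @[N --> \oo] -->
    \int[P]_w h (joint X w)}.
Proof.
move=> mh hM.
rewrite (@Rintegral_law _ _ _ _ _ P mu (joint X) (measurable_joint X) (fun _ _ => erefl)).
  exact: (bounded_mean_cvg sample_measurable sample_law sample_indep mh hM).
by apply: bounded_meas_integrable; split=> //; exists M.
Qed.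

End Samples.

Lemma ae_eq0_Rintegral_sqr d (T : measurableType d) (R : realType)
    (P : probability T R) (f : T -> R) : bounded_meas f ->
  \int[P]_w f w ^+ 2 = 0 -> {ae P, forall w, f w = 0}.
Proof.
move=> bf f20.
have bf2 : bounded_meas (fun w => f w ^+ 2) by exact: (bounded_measM bf bf).
have if2 := bounded_meas_integrable P bf2.
have m2 : measurable_fun setT (fun w => (f w ^+ 2)%:E).
  by apply/measurable_EFinP; exact: (proj1 bf2).
have : (\int[P]_(w in setT) `|(f w ^+ 2)%:E| = 0)%E.
  under eq_integral do rewrite gee0_abs ?lee_fin ?sqr_ge0//.
  by rewrite -[LHS]fineK ?[X in X%:E]f20//; apply: integrable_fin_num if2.
move/(ae_eq_integral_abs P measurableT m2); apply: filterS => w /(_ I) [] /eqP.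
by rewrite sqrf_eq0 => /eqP.
Qed.

Section SampleLimits.
Context (R : realType) (n : nat) (d : 'I_n -> nat)
  (rho : forall i, {measure set (borelE R (d i)) -> \bar R}).
Hypothesis levy : forall i, levy_integrable (rho i).
Context (dO : measure_display) (Omega : measurableType dO) (P : probability Omega R)
  (X : forall i, {RV P >-> borelE R (d i)})
  (Xc : nat -> forall i, {RV P >-> borelE R (d i)}).
Hypothesis Xc_law : forall k, same_law (P := P) (joint (Xc k)) (joint X).
Hypothesis Xc_ind : mutually_independent (P := P) (fun k => joint (Xc k)).
Hypothesis ipsi : forall i, (distribution P (X i)).-integrable setT (EFin \o cndf (rho i)).

Local Notation psi := (fun i => cndf (rho i)).

Definition sample (N : nat) (w : Omega) : 'I_N -> forall i, 'rV[R]_(d i) :=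
  fun k i => Xc k i w.

Lemma bounded_meas_mean_waves i h : mean_waves (rho i) h ->
  bounded_meas (h : borelE R (d i) -> R).
Proof.
move=> hm; split; first exact: mean_waves_measurable hm.
by exists 1; exact: mean_waves_bounded hm.
Qed.

Lemma bounded_meas_mean_wavesX i h : mean_waves (rho i) h ->
  bounded_meas (fun w => h (X i w)).
Proof.
move=> /bounded_meas_mean_waves [mh [M hM]]; split; last by exists M.
exact: measurableT_comp mh (measurable_funPT (X i)).
Qed.

(** Some averaged wave of [X i] has variance V > 0; its sample variances tend to V and bound the
    mean distances from below through [mean_psi_ge]. *)
Lemma mean_psi_bounded_away i : full_support (rho i) -> ~ ae_constant (X i) ->
  {ae P, forall w, exists2 c : R, 0 < c &
    \forall N \near \oo, c <= mean_psi psi (@sample N w) i}.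
Proof.
move=> supp nc.
have [h hm V0] : exists2 h, mean_waves (rho i) h &
    0 < \int[P]_w h (X i w) ^+ 2 - (\int[P]_w h (X i w)) ^+ 2.
  apply: contrapT => noh; apply: nc.
  apply: (ae_constant_mean_waves (@levy i) supp) => h hm.
  set m := \int[P]_w h (X i w); exists m.
  have bh := bounded_meas_mean_wavesX hm.
  have bhm := bounded_measB bh (bounded_meas_cst _ m).
  suff E0 : \int[P]_w (h (X i w) - m) ^+ 2 = 0.
    by have := ae_eq0_Rintegral_sqr bhm E0; apply: filterS => w /subr0_eq.
  apply/eqP; rewrite eq_le Rintegral_ge0 ?andbT//; last by move=> w _; exact: sqr_ge0.
  have -> : \int[P]_w (h (X i w) - m) ^+ 2 = \int[P]_w h (X i w) ^+ 2 - m ^+ 2.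
    have i1 := bounded_meas_integrable P (bounded_measM bh bh).
    have i0 := bounded_meas_integrable P bh.
    have i2 := integrableMcr (2 * m) measurableT i0.
    transitivity (\int[P]_w (h (X i w) ^+ 2 + m ^+ 2 - 2 * m * h (X i w) - 0)).
      by apply: eq_Rintegral => w _; ring.
    by rewrite (Rintegral_affine _ _ i1 i2) RintegralZl// -/m; ring.
  by rewrite leNgt; apply/negP => V0; apply: noh; exists h.
set V := _ - _ in V0; have [C C0 hC] := mean_waves_dominated (@levy i) hm.
have [mh _] := bounded_meas_mean_waves hm; have h1 := mean_waves_bounded hm.
have mhi := measurableT_comp mh (@measurable_coord R n d i).
have mhi2 := measurable_funM mhi mhi.
have h21 (x : 'rV[R]_(d i)) : `|h x * h x| <= 1 by rewrite normrM mulr_ile1.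
have := sample_mean_cvg Xc_law Xc_ind mhi (fun x => h1 (x i)).
have := sample_mean_cvg Xc_law Xc_ind mhi2 (fun x => h21 (x i)).
apply: filterS2 => w cv2 cv1; exists (C^-1 * (V / 2)).
  by rewrite mulr_gt0 ?invr_gt0 ?divr_gt0.
have cV : (N%:R^-1 * (\sum_(j < N) h (Xc j i w) ^+ 2) -
    (N%:R^-1 * \sum_(j < N) h (Xc j i w)) ^+ 2) @[N --> \oo] --> V.
  exact: (cvgB cv2 (cvgM cv1 cv1)).
have V2 : V / 2 < V by rewrite ltr_pdivrMr// mulr_natr mulr2n ltrDl.
have n0 : \forall N \near \oo, (0 < N)%N by exists 1%N.
apply: filterS2 n0 (cvgr_gt _ cV _ V2) => N N0 VN.
apply: le_trans (mean_psi_ge (psi := psi) (@sample N w) N0 C0 _ _ hC).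
- by rewrite ler_pM2l ?invr_gt0//; exact: ltW VN.
- by move=> y z; rewrite -cndfN opprB.
- exact: cndf0.
Qed.

Lemma mean_psi_growth i (gamma : R) : 0 < gamma < 1 ->
  {ae P, forall w, \forall N \near \oo,
    mean_psi psi (@sample N w) i <= N%:R `^ gamma}.
Proof.
move=> /andP[g0 g1].
have g01 : 0 < 1 - gamma < 1 by apply/andP; split; lra.
have := mean_growth (fun k => @coord_measurable R n d dO Omega P Xc k i)
  (@coord_law _ _ _ _ _ _ _ _ Xc_law i)
  (fun x => cndf_ge0 (rho i) x) (ipsi i) g01.
(* The bound 1/4 cancels the factor 4 of [mean_psi_le]; the exponent [1 - gamma] against N^2 leaves
   the mean below N^gamma. *)
apply: filterS => w cw; have q0 : (0 : R) < 4^-1 by rewrite invr_gt0.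
have n0 : \forall N \near \oo, (0 < N)%N by exists 1%N.
apply: filterS2 n0 (cvgr_lt _ cw _ q0) => N N0.
set S := \sum_(j < N) _ => SN.
apply: le_trans (mean_psi_le (psi := psi) (@sample N w) N0 (cndfB_le (@levy i))) _.
have Npos : 0 < N%:R :> R by rewrite ltr0n.
have Nn0 : N%:R != 0 :> R by rewrite gt_eqF.
move: SN; rewrite powRD ?Nn0 ?implybT// powRr1 ?ler0n// powRN.
have pg : 0 < N%:R `^ gamma :> R by rewrite powR_gt0.
set p := N%:R `^ gamma in pg *.
have -> : N%:R * p^-1 * (N%:R ^- 2 * S) = (N%:R^-1 * S) / p.
  by field; rewrite Nn0 gt_eqF.
by rewrite ltr_pdivrMr// => H; rewrite -/S -ler_pdivlMl// ltW.
Qed.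

End SampleLimits.

Lemma cvgy_powR (R : realType) (a : R) : 0 < a -> N%:R `^ a @[N --> \oo] --> +oo.
Proof.
move=> a0; apply/cvgryPge => A.
exists (Num.truncn (`|A| `^ a^-1)).+1 => // N /= NA.
have AN : `|A| `^ a^-1 <= N%:R.
  apply: (le_trans (ltW (real_truncnS_gt (num_real _)))).
  by rewrite ler_nat.
apply: le_trans (ler_norm A) _.
have := ge0_ler_powR (ltW a0) _ _ AN; rewrite !nnegrE powR_ge0 ler0n.
by rewrite -powRrM mulVf ?gt_eqF// powRr1//; apply.
Qed.

(** * Dependent components: divergence *)

Section Dependent.
Context (R : realType) (n : nat) (d : 'I_n -> nat)
  (rho : forall i, {measure set (borelE R (d i)) -> \bar R}).
Hypothesis levy : forall i, levy_integrable (rho i).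
Context (dO : measure_display) (Omega : measurableType dO) (P : probability Omega R)
  (X : forall i, {RV P >-> borelE R (d i)})
  (Xc : nat -> forall i, {RV P >-> borelE R (d i)}).
Hypothesis Xc_law : forall k, same_law (P := P) (joint (Xc k)) (joint X).
Hypothesis Xc_ind : mutually_independent (P := P) (fun k => joint (Xc k)).

Local Notation psi := (fun i => cndf (rho i)).

Let prod_subC (a b : 'I_n -> R) : \prod_(i < n) (a i - b i) =
  \sum_(J : {set 'I_n}) (\prod_(i < n) (if i \in J then 1 else - b i)) *
    \prod_(i < n) (if i \in J then a i else 1).
Proof.
rewrite bigA_distr; apply: eq_bigr => J _; rewrite -big_split.
by apply: eq_bigr => i _ /=; case: ifP; rewrite ?mul1r ?mulr1.
Qed.

(** Empirical centring makes the summands change with N. Expanding the product over subsets of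
    indices leaves finitely many sample means of fixed bounded functions, for which the strong law
    holds. *)
Lemma mean_prod_centred_cvg (h : forall i, 'rV[R]_(d i) -> R) :
  (forall i, mean_waves (rho i) (h i)) ->
  {ae P, forall w, N%:R^-1 * (\sum_(j < N) \prod_(i < n)
      (h i (Xc j i w) - N%:R^-1 * \sum_(k < N) h i (Xc k i w))) @[N --> \oo] -->
    \int[P]_w \prod_(i < n) (h i (X i w) - \int[P]_v h i (X i v))}.
Proof.
move=> hm; set b := fun i => \int[P]_v h i (X i v).
pose F (J : {set 'I_n}) (x : prodE R d) := \prod_(i < n) (if i \in J then h i (x i) else 1).
have bhi i : bounded_meas (fun x : prodE R d => h i (x i)).
  have [mh [M hM]] := bounded_meas_mean_waves (hm i); split; last by exists M.
  exact: measurableT_comp mh (@measurable_coord R n d i).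
have bF J : bounded_meas (F J).
  by apply: bounded_meas_prod => i; case: (i \in J) => //; exact: bounded_meas_cst.
have cvF J : {ae P, forall w, N%:R^-1 * \sum_(j < N) F J (joint (Xc j) w) @[N --> \oo] -->
    \int[P]_w F J (joint X w)}.
  have [mF [M FM]] := bF J.
  exact: (@sample_mean_cvg R n d dO Omega P X Xc Xc_law Xc_ind (F J) M mF FM).
have cvh i : {ae P, forall w, N%:R^-1 * \sum_(j < N) h i (Xc j i w) @[N --> \oo] --> b i}.
  have [mF [M FM]] := bhi i.
  exact: (@sample_mean_cvg R n d dO Omega P X Xc Xc_law Xc_ind
    (fun x => h i (x i)) M mF FM).
have iF J : P.-integrable setT (EFin \o (fun w => F J (joint X w))).
  apply: bounded_meas_integrable; have [mF [M FM]] := bF J; split; last by exists M.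
  exact: measurableT_comp mF (measurable_joint X).
have -> : \int[P]_w \prod_(i < n) (h i (X i w) - b i) =
    \sum_(J : {set 'I_n}) (\prod_(i < n) (if i \in J then 1 else - b i)) *
      \int[P]_w F J (joint X w).
  under eq_Rintegral do rewrite prod_subC.
  rewrite Rintegral_sum//; last by move=> J; exact: (integrableMcr _ measurableT (iF J)).
  by apply: eq_bigr => J _; exact: (RintegralZl _ measurableT (iF J)).
have aF := filter_forall (ae_filter_ringOfSetsType P) cvF.
have ah := filter_forall (ae_filter_ringOfSetsType P) cvh.
apply: filterS2 ah aF => w {}cvh {}cvF.
pose a i N : R := N%:R^-1 * \sum_(k < N) h i (Xc k i w).
suff : \sum_(J : {set 'I_n}) (\prod_(i < n) (if i \in J then 1 else - a i N)) *
    (N%:R^-1 * \sum_(j < N) F J (joint (Xc j) w)) @[N --> \oo] -->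
    \sum_(J : {set 'I_n}) (\prod_(i < n) (if i \in J then 1 else - b i)) *
      \int[P]_w F J (joint X w).
  apply: cvg_trans; apply: near_eq_cvg; apply: nearW => N.
  under [in RHS]eq_bigr do rewrite prod_subC.
  rewrite exchange_big /= mulr_sumr; apply: eq_bigr => J _.
  by rewrite -mulr_sumr mulrCA.
apply: cvg_sumr => J; apply: cvgM; last exact: cvF.
apply: cvg_prodr => i; case: (i \in J); first exact: cvg_cst.
exact: cvgN (cvh i).
Qed.

Hypothesis ipsi : forall i, (distribution P (X i)).-integrable setT (EFin \o cndf (rho i)).

Lemma multivariance2_dependent (n0 : (0 < n)%N) (supp : forall i, full_support (rho i))
    (X_nc : forall i, ~ ae_constant (X i)) (X_ind : m_independent n.-1 X) (beta : R) :
  0 < beta < 1 -> ~ mutually_independent X ->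
  {ae P, forall w, N%:R `^ beta * multivariance2 psi (sample Xc (N := N) w)
    @[N --> \oo] --> +oo}.
Proof.
move=> /andP[b0 b1] dep.
have [h hm kn0] : exists2 h : forall i, 'rV[R]_(d i) -> R,
    forall i, mean_waves (rho i) (h i) &
    \int[P]_w (\prod_(i < n) (h i (X i w) - \int[P]_v h i (X i v))) != 0.
  apply: contrapT => noh; apply: dep.
  apply: (mean_waves_independent levy (fun i => supp i) n0 X_ind) => h hm.
  by apply/eqP/negPn/negP => hn0; apply: noh; exists h.
set kappa := \int[P]_w _ in kn0.
have /choice[C CP] i : exists c : R, 0 < c /\
    cpd (fun y z : 'rV[R]_(d i) => c * - cndf (rho i) (y - z) - h i y * h i z).
  by have [c c0 hc] := mean_waves_dominated (@levy i) (hm i); exists c.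
(* Then the product of the [n] mean distances is at most N^(beta/2), and half of the power N^beta is
   left. *)
pose gamma := beta / (2 * n%:R).
have npos : 0 < n%:R :> R by rewrite ltr0n.
have n1 : 1 <= n%:R :> R by rewrite ler1n.
have g01 : 0 < gamma < 1.
  rewrite /gamma divr_gt0 ?mulr_gt0//= ltr_pdivrMr ?mulr_gt0//; lra.
have FP := ae_filter_ringOfSetsType P.
have ag := filter_forall FP (fun i => mean_psi_growth levy Xc_law ipsi i g01).
have a0 := filter_forall FP (fun i =>
  mean_psi_bounded_away levy Xc_law Xc_ind (@supp i) (@X_nc i)).
apply: filterS3 (mean_prod_centred_cvg hm) a0 ag => w cva m0 mg.
set a := fun N : nat => _ in cva.
pose D := (\prod_(i < n) C i)^-1 * (kappa ^+ 2 / 2).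
have D0 : 0 < D.
  rewrite mulr_gt0 ?invr_gt0 ?prodr_gt0 ?divr_gt0 ?exprn_even_gt0//.
  by move=> i _; exact: (CP i).1.
have cva2 : a N ^+ 2 @[N --> \oo] --> kappa ^+ 2 by exact: (cvgM cva cva).
have k2 : kappa ^+ 2 / 2 < kappa ^+ 2.
  by rewrite ltr_pdivrMr// mulr_natr mulr2n ltrDl exprn_even_gt0.
have lbd : \forall N \near \oo, D * N%:R `^ (beta / 2) <=
    N%:R `^ beta * multivariance2 psi (sample Xc (N := N) w).
  have NN : \forall N \near \oo, (0 < N)%N by exists 1%N.
  have m0' : \forall N \near \oo, forall i, 0 < mean_psi psi (sample Xc (N := N) w) i.
    apply: filter_forall => i; have [c c0] := m0 i.
    by apply: filterS => N; exact: lt_le_trans.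
  have mg' : \forall N \near \oo, forall i,
      mean_psi psi (sample Xc (N := N) w) i <= N%:R `^ gamma by exact: filter_forall.
  have NM : \forall N \near \oo, (0 < N)%N /\
    forall i, 0 < mean_psi psi (sample Xc (N := N) w) i by exact: filterI.
  have ak : \forall N \near \oo, kappa ^+ 2 / 2 < a N ^+ 2 by exact: cvgr_gt cva2 _ k2.
  apply: filterS3 NM mg' ak => N [N0 {}m0'] {}mg ka.
  have Np : 0 < N%:R :> R by rewrite ltr0n.
  have p0 : 0 < \prod_(i < n) mean_psi psi (sample Xc (N := N) w) i.
    by apply: prodr_gt0.
  have pmg : \prod_(i < n) mean_psi psi (sample Xc (N := N) w) i <= N%:R `^ (beta / 2).
    apply: (@le_trans _ _ (\prod_(i < n) N%:R `^ gamma)).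
      by apply: ler_prod => i _; rewrite ltW ?m0'//=.
    rewrite prodr_const card_ord -powR_mulrn ?powR_ge0// -powRrM /gamma.
    rewrite (_ : _ * _ = beta / 2)//; field; exact: lt0r_neq0.
  rewrite multivariance2E//.
  have cd : D <= cdist_mean psi (sample Xc (N := N) w).
    have := cdist_mean_ge (psi := psi) (sample Xc (N := N) w)
      (fun i => (CP i).1) (fun i => (CP i).2).
    apply: le_trans.
    rewrite /D ler_pM2l ?invr_gt0 ?prodr_gt0//; last by move=> i _; exact: (CP i).1.
    exact: ltW ka.
  have -> : N%:R `^ beta = N%:R `^ (beta / 2) * N%:R `^ (beta / 2) :> R.
    by rewrite -powRD ?gt_eqF ?implybT// -splitr.
  have pb : 0 < N%:R `^ (beta / 2) :> R by rewrite powR_gt0.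
  move: pmg p0 cd pb; set p := \prod_(i < n) _; set e := cdist_mean _ _.
  set s := N%:R `^ _ => pmg p0 cd pb.
  rewrite (_ : s * s * (p^-1 * e) = (s / p) * (e * s)); last by ring.
  have ps : 1 <= s / p by rewrite ler_pdivlMr ?mul1r.
  have de : D * s <= e * s by rewrite ler_pM2r.
  have Ds : 0 <= D * s by rewrite mulr_ge0 ?ltW.
  by rewrite -[leLHS]mul1r; exact: ler_pM ler01 Ds ps de.
apply/cvgryPge => A; have b2 : 0 < beta / 2 by rewrite divr_gt0.
have /cvgryPge/(_ (A / D)) AN := cvgy_powR b2.
by apply: filterS2 AN lbd => N; rewrite ler_pdivrMr// mulrC; exact: le_trans.
Qed.

End Dependent.

(** * Independent components: convergence to 0 *)

Section Independent.
Context (R : realType) (n : nat) (d : 'I_n -> nat)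
  (rho : forall i, {measure set (borelE R (d i)) -> \bar R}).
Hypothesis levy : forall i, levy_integrable (rho i).
Context (dO : measure_display) (Omega : measurableType dO) (P : probability Omega R)
  (X : forall i, {RV P >-> borelE R (d i)})
  (Xc : nat -> forall i, {RV P >-> borelE R (d i)}).
Hypothesis Xc_law : forall k, same_law (P := P) (joint (Xc k)) (joint X).
Hypothesis Xc_ind : mutually_independent (P := P) (fun k => joint (Xc k)).
Hypothesis indX : mutually_independent X.

Let mu : probability (prodE R d) R := distribution P (joint X).
Let nu i : probability (borelE R (d i)) R := distribution P (X i).

Hypothesis ipsi : forall i, (distribution P (X i)).-integrable setT (EFin \o cndf (rho i)).

Local Notation psi := (fun i => cndf (rho i)).
Let K i : 'rV[R]_(d i) -> 'rV[R]_(d i) -> R := ckernel (rho i) (nu i).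

Lemma Rintegral_prod_coord (f : forall i, borelE R (d i) -> R) :
  (forall i, (nu i).-integrable setT (EFin \o f i)) ->
  mu.-integrable setT (EFin \o (fun x : prodE R d => \prod_(i < n) f i (x i))) /\
  \int[mu]_x (\prod_(i < n) f i (x i)) = \prod_(i < n) \int[nu i]_x f i x.
Proof.
move=> fi; have mf i : measurable_fun setT (f i) by exact: integrable_measurable (fi i).
have lX i : forall A : set (borelE R (d i)), measurable A -> P (X i @^-1` A) = nu i A by [].
have mX i : measurable_fun setT (X i) := measurable_funPT (X i).
have fX i := integrable_law (mX i) (lX i) (fi i).
have [iP EP] := indep_prod indX (index_enum_uniq _) mf fX.
have mF : measurable_fun setT (fun x : prodE R d => \prod_(i < n) f i (x i)).
  apply: measurable_prod => i _.
  exact: measurableT_comp (mf i) (@measurable_coord R n d i).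
have lJ (A : set (prodE R d)) : measurable A -> P (joint X @^-1` A) = mu A by [].
have imu := law_integrable (measurable_joint X) lJ mF iP.
split=> //; rewrite -(Rintegral_law (measurable_joint X) lJ imu) EP.
by apply: eq_bigr => i _; exact: (Rintegral_law (mX i) (lX i) (fi i)).
Qed.

Let psdK i : psd (@K i).
Proof.
exact: (psd_ckernel (@levy i) (ipsi i) (fun k => @coord_measurable R n d dO Omega P Xc k i)
  (@coord_law R n d dO Omega P X Xc Xc_law i) (@coord_indep R n d dO Omega P X Xc Xc_law Xc_ind i)).
Qed.

(** By independence the integral of the product kernel in one variable factorises, and the factor of
    any index in [J] vanishes; for the same reason the diagonal is integrable. *)
Lemma kernel_mean_cvg0 (J : {set 'I_n}) (beta : R) : J != finset.set0 -> 0 < beta < 1 ->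
  {ae P, forall w, N%:R `^ beta * kernel_mean (sample Xc (N := N) w) (@K) J
    @[N --> \oo] --> (0 : R)}.
Proof.
move=> /set0Pn[i0 i0J] beta01.
pose kJ (x y : prodE R d) := \prod_(i < n) (if i \in J then K (x i) (y i) else 1).
have i1 i := @finite_measure_integrable_cst _ _ _ (nu i) _ (1 : R) measurableT.
have mk : measurable_fun setT (fun z : prodE R d * prodE R d => kJ z.1 z.2).
  apply: measurable_prod => i _; case: (i \in J); last exact: measurable_cst.
  have mc := @measurable_coord R n d i.
  have mz : measurable_fun setT (fun z : prodE R d * prodE R d =>
      (z.1 i : borelE R (d i), z.2 i : borelE R (d i))).
    apply: measurable_fun_pair.
      exact: measurableT_comp mc measurable_fst.
    exact: measurableT_comp mc measurable_snd.
  exact: (measurableT_comp (measurable_ckernel (@levy i) (nu i)) mz).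
have pk : psd kJ.
  apply: psd_prod => i; case: (i \in J); last exact: psd_cst.
  exact: (psd_comp (fun x : prodE R d => x i) (psdK i)).
have k0 y : \int[mu]_x kJ x y = 0.
  have fi i : (nu i).-integrable setT
      (EFin \o (fun x : borelE R (d i) => if i \in J then K x (y i) else 1)).
    by case: (i \in J) => //; exact: integrable_ckernel.
  rewrite (Rintegral_prod_coord fi).2 (bigD1 i0)//= i0J.
  by rewrite Rintegral_ckernel ?mul0r.
have ik : mu.-integrable setT (EFin \o (fun x => kJ x x)).
  have fi i : (nu i).-integrable setT
      (EFin \o (fun x : borelE R (d i) => if i \in J then K x x else 1)).
    by case: (i \in J) => //; exact: integrable_ckernel_diag.
  exact: (Rintegral_prod_coord fi).1.
exact: (psd_kernel_cvg0 (sample_measurable Xc) (sample_law Xc_law)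
  (sample_indep Xc_law Xc_ind) mk pk k0 ik beta01).
Qed.

Let psiK i (y z : 'rV[R]_(d i)) : - cndf (rho i) (y - z) =
  K y z + (mean2_cndf (rho i) (nu i) / 2 - mean_cndf (rho i) (nu i) y) +
  (mean2_cndf (rho i) (nu i) / 2 - mean_cndf (rho i) (nu i) z).
Proof.
rewrite /K /ckernel; move: (mean2_cndf _ _) (mean_cndf _ _ y) (mean_cndf _ _ z) (cndf _ _).
by move=> c u v p; field.
Qed.

Lemma multivariance2_independent (n0 : (0 < n)%N) (supp : forall i, full_support (rho i))
    (X_nc : forall i, ~ ae_constant (X i)) (beta : R) : 0 < beta < 1 ->
  {ae P, forall w, N%:R `^ beta * multivariance2 psi (sample Xc (N := N) w)
    @[N --> \oo] --> (0 : R)}.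
Proof.
move=> beta01; have FP := ae_filter_ringOfSetsType P.
have aq : {ae P, forall w, forall J : {set 'I_n}, J != finset.set0 ->
    N%:R `^ beta * kernel_mean (sample Xc (N := N) w) (@K) J @[N --> \oo] --> (0 : R)}.
  apply: filter_forall => J; have [->|J0] := eqVneq J finset.set0.
    by apply: aeW => w.
  by have := kernel_mean_cvg0 J0 beta01; apply: filterS.
have am := filter_forall FP (fun i =>
  mean_psi_bounded_away levy Xc_law Xc_ind (@supp i) (@X_nc i)).
apply: filterS2 aq am => w cq mp.
have /choice[c cP] i : exists c : R, 0 < c /\
    \forall N \near \oo, c <= mean_psi psi (sample Xc (N := N) w) i.
  by have [c] := mp i; exists c.
pose q J N := kernel_mean (sample Xc (N := N) w) (@K) J.
have sn0 (i : 'I_n) : [set i]%SET != finset.set0.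
  by apply/set0Pn; exists i; rewrite finset.set11.
have N0 : \forall N \near \oo, (0 < N)%N by exists 1%N.
(* Without the power of N, which is at least 1, the convergence persists. *)
have cq1 i : q [set i]%SET N @[N --> \oo] --> (0 : R).
  have cn : `|N%:R `^ beta * q [set i]%SET N| @[N --> \oo] --> (0 : R).
    by apply/norm_cvg0P; exact: cq _ (sn0 i).
  apply/norm_cvg0P; apply: cvg0_squeeze cn.
  apply: filterS N0 => N N0; rewrite normr_ge0 /=.
  rewrite [leRHS]normrM; apply: ler_peMl => //; rewrite ger0_norm ?powR_ge0//.
  have N1 : 1 <= N%:R :> R by rewrite ler1n.
  by have := ler_powR N1 (ltW (proj1 (andP beta01))); rewrite powRr0.
pose t (J : {set 'I_n}) N := N%:R `^ beta *
  (2 ^+ n * ((\prod_(i < n) (if i \in J then 1 else q [set i]%SET N)) * q J N)).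
have ct J : t J N @[N --> \oo] --> (0 : R).
  (* For empty [J] the kernel mean is 1, so N^beta is attached to one of the factors q_i, and [n0]
     provides an index; otherwise the kernel mean over [J] takes it. *)
  have [->|J0] := eqVneq J finset.set0.
    have [i0 _] : exists i0 : 'I_n, true by exists (Ordinal n0).
    suff : 2 ^+ n * \prod_(i < n) (if i == i0 then N%:R `^ beta * q [set i]%SET N
        else q [set i]%SET N) @[N --> \oo] --> (0 : R).
      apply: cvg_trans; apply: near_eq_cvg; apply: filterS N0 => N N0; rewrite /t.
      have -> : q finset.set0 N = 1.
        rewrite /q /kernel_mean; under eq_bigr do under eq_bigr do
          (rewrite big1; last by move=> i _; rewrite finset.in_set0).
        rewrite !sumr_const !card_ord -mulrnA -natrX mulVf//.
        by rewrite natrX expf_neq0// pnatr_eq0 -lt0n.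
      rewrite mulr1 mulrCA; congr (_ * _).
      rewrite [LHS](bigD1 i0)//= eqxx [X in _ = _ * X](bigD1 i0)//= finset.in_set0 [RHS]mulrA.
      congr (_ * _); apply: eq_bigr => i /negbTE ii0.
      by rewrite ii0 finset.in_set0.
    have -> : (0 : R) = 2 ^+ n * \prod_(i < n) 0 by rewrite (bigD1 i0)//= mul0r mulr0.
    apply: cvgM; first exact: cvg_cst.
    apply: cvg_prodr => i; case: (i == i0); last exact: cq1.
    exact: cq (sn0 i).
  suff : 2 ^+ n * (\prod_(i < n) (if i \in J then 1 else q [set i]%SET N)) *
      (N%:R `^ beta * q J N) @[N --> \oo] --> (0 : R).
    apply: cvg_trans; apply: near_eq_cvg; apply: nearW => N.
    by rewrite /t mulrCA -!mulrA; congr (_ * _); rewrite mulrCA.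
  have -> : (0 : R) = 2 ^+ n * (\prod_(i < n) (if i \in J then 1 else 0)) * 0.
    by rewrite mulr0.
  apply: cvgM; last exact: cq.
  apply: cvgM; first exact: cvg_cst.
  apply: cvg_prodr => i; case: (i \in J); first exact: cvg_cst.
  exact: cq1.
have cT : (\prod_(i < n) c i)^-1 * (\sum_(J : {set 'I_n}) t J N) @[N --> \oo] --> (0 : R).
  have e : \sum_(J : {set 'I_n}) (0 : R) = 0 by rewrite big1.
  have cS := cvg_sumr (r := index_enum {set 'I_n}) _ ct.
  rewrite -[X in _ --> X](mulr0 (\prod_(i < n) c i)^-1); apply: cvgM; first exact: cvg_cst.
  by move: cS; rewrite e; apply.
apply: cvg0_squeeze cT.
have mc : \forall N \near \oo, forall i, c i <= mean_psi psi (sample Xc (N := N) w) i.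
  by apply: filter_forall => i; case: (cP i).
apply: filterS mc => N mc.
have c0 i : 0 < c i by case: (cP i).
have m0 i : 0 < mean_psi psi (sample Xc (N := N) w) i by exact: lt_le_trans (c0 i) (mc i).
have /andP[e0 eq] := cdist_mean_le (psi := psi) (sample Xc (N := N) w) psdK psiK.
rewrite multivariance2E//.
have p0 : 0 < \prod_(i < n) c i by apply: prodr_gt0.
have pm : \prod_(i < n) c i <= \prod_(i < n) mean_psi psi (sample Xc (N := N) w) i.
  by apply: ler_prod => i _; rewrite ltW ?c0//=.
have m0' := lt_le_trans p0 pm.
have b0 : 0 <= N%:R `^ beta :> R by exact: powR_ge0.
have e1 : 0 <= (\prod_(i < n) mean_psi psi (sample Xc (N := N) w) i)^-1.
  by rewrite invr_ge0 ltW.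
apply/andP; split; first exact: mulr_ge0 b0 (mulr_ge0 e1 e0).
rewrite mulrCA.
have be : 0 <= N%:R `^ beta * cdist_mean psi (sample Xc (N := N) w) by exact: mulr_ge0.
apply: ler_pM e1 be _ _; first by rewrite lef_pV2.
rewrite /t -mulr_sumr; apply: ler_wpM2l b0 _ _ eq.
Qed.

End Independent.

(** * Integrability of the distance functions *)

Section CndfMoment.
Context (R : realType) (d : nat) (rho : {measure set (borelE R d) -> \bar R}).
Hypothesis levy : levy_integrable rho.
Context (dO : measure_display) (Omega : measurableType dO) (P : probability Omega R)
  (X : {RV P >-> borelE R d}).

Lemma integrable_cndf_bounded : bounded_fun (cndf rho) ->
  (distribution P X).-integrable setT (EFin \o cndf rho).
Proof.
move=> [M0 [_ bM]]; apply: bounded_meas_integrable.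
split; first exact: measurable_cndf.
by exists (M0 + 1) => x; apply: bM => //; rewrite ltrDl.
Qed.

Lemma integrable_cndf_moment : ('E_P[fun w => cndf rho (X w)] < +oo)%E ->
  (distribution P X).-integrable setT (EFin \o cndf rho).
Proof.
rewrite unlock => EX; have mX : measurable_fun setT X := measurable_funPT X.
have lX (A : set (borelE R d)) : measurable A -> P (X @^-1` A) = distribution P X A by [].
have mc := measurable_cndf levy.
apply: (law_integrable mX lX mc); apply/integrableP; split.
  by apply/measurable_EFinP; exact: measurableT_comp mc mX.
by under eq_integral do rewrite /= ger0_norm ?cndf_ge0//.
Qed.

End CndfMoment.

Theorem corollary6p2 (R : realType) (n : nat) (hn : (1 < n)%N)
  (d : 'I_n -> nat)
  (rho : forall i, {measure set (borelE R (d i)) -> \bar R})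
  (rho_sym : forall i, symmetric_measure (rho i))
  (rho_supp : forall i, full_support (rho i))
  (rho_int : forall i, levy_integrable (rho i))
  (dO : measure_display) (Omega : measurableType dO) (P : probability Omega R)
  (X : forall i, {RV P >-> borelE R (d i)})
  (X_ind : m_independent n.-1 X)
  (X_nc : forall i, ~ ae_constant (X i))
  (Xc : nat -> forall i, {RV P >-> borelE R (d i)})
  (Xc_law : forall k, same_law (P := P) (joint (Xc k)) (joint X))
  (Xc_ind : mutually_independent (P := P) (fun k => joint (Xc k)))
  (moments :
    (forall i, bounded_fun (cndf (rho i))) \/
    (forall i, ('E_P[fun w => cndf (rho i) (X i w)] < +oo)%E /\
       exists eps : R, 0 < eps /\
         ('E_P[fun w => (ln (1 + enorm (X i w) ^+ 2) `^ (1 + eps))%R] < +oo)%E))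
  (beta : R) (beta01 : 0 < beta < 1) :
  let nM2 (N : nat) (w : Omega) : R :=
    N%:R `^ beta *
    multivariance2 (fun i => cndf (rho i)) (fun (k : 'I_N) i => Xc k i w) in
  (~ mutually_independent X ->
    {ae P, forall w, nM2 N w @[N --> \oo] --> +oo}) /\
  (mutually_independent X ->
    {ae P, forall w, nM2 N w @[N --> \oo] --> (0 : R)}).
Proof.
have ipsi i : (distribution P (X i)).-integrable setT (EFin \o cndf (rho i)).
  case: moments => [bpsi|mpsi].
    exact: (integrable_cndf_bounded (rho_int i) (X i) (bpsi i)).
  exact: (@integrable_cndf_moment _ _ _ (rho_int i) _ _ _ (X i) (proj1 (mpsi i))).
have n0 : (0 < n)%N by exact: ltnW.
split=> [dep|ind].
  exact: (multivariance2_dependent rho_int Xc_law Xc_ind ipsi n0 rho_supp X_nc X_ind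
    beta01 dep).
exact: (multivariance2_independent rho_int Xc_law Xc_ind ind ipsi n0 rho_supp X_nc beta01).
Qed.
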